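(* There is a randomized (Monte Carlo) algorithm for Tree-Contractibility with running time $4.88^k\, n^{O(1)}$, where $n$ is the number of vertices of the input graph $G$. If $G$ is not $k$-contractible to a tree, the algorithm outputs no. If $G$ is $k$-contractible to a tree, the algorithm outputs yes with probability at least $1-\frac{1}{e}$. Moreover, whenever it outputs yes, it also outputs a $T$-witness structure of $G$ for a tree $T$ such that $G$ is $k$-contractible to $T$.
   Context: All graphs are finite, undirected and simple. Contracting an edge $xy$ removes $x$ and $y$ and replaces them by a new vertex adjacent to exactly the vertices adjacent to at least one of $x,y$. A graph $G$ is $k$-contractible to $H$ if $H$ can be obtained from $G$ by at most $k$ edge contractions. Tree-Contractibility: given a graph $G$ and an integer $k$, decide whether $G$ is $k$-contractible to a tree. For a tree $T$, a $T$-witness structure of $G$ is a partition $\{W(t): t\in V(T)\}$ of $V(G)$ into nonempty sets, each inducing a connected subgraph of $G$, such that for $t\ne t'$ there is an edge of $G$ between $W(t)$ and $W(t')$ if and only if $tt'\in E(T)$. *)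

(* Defs.v *)
From mathcomp Require Import all_boot.
Set Implicit Arguments.
Unset Strict Implicit.
Unset Printing Implicit Defensive.

(** * Graphs and contractions *)

Record graph (V : finType) := Graph {
  adj :> rel V;
  adj_sym : symmetric adj;
  adj_irr : irreflexive adj }.

Definition isomorphic (V U : finType) (G : graph V) (H : graph U) : Prop :=
  exists2 f : V -> U, bijective f & forall x y, adj H (f x) (f y) = adj G x y.

Section Contraction.
Variables (V : finType) (G : graph V) (x y : V).

(* [None] is the new vertex. *)
Definition contract_adj : rel (option {z : V | (z != x) && (z != y)}) :=
  fun u v => match u, v with
  | Some a, Some b => adj G (val a) (val b)
  | Some a, None | None, Some a => adj G (val a) x || adj G (val a) y
  | None, None => false
  end.

Lemma contract_sym : symmetric contract_adj.
Proof. by move=> [a|] [b|] //=; rewrite adj_sym. Qed.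

Lemma contract_irr : irreflexive contract_adj.
Proof. by move=> [a|] //=; rewrite adj_irr. Qed.

Definition contract := Graph contract_sym contract_irr.

End Contraction.

Section Induced.
Variables (V : finType) (G : graph V) (A : {set V}).

Definition induced_adj : rel {x : V | x \in A} :=
  fun u v => adj G (val u) (val v).

Lemma induced_sym : symmetric induced_adj.
Proof. by move=> u v; rewrite /induced_adj adj_sym. Qed.

Lemma induced_irr : irreflexive induced_adj.
Proof. by move=> u; rewrite /induced_adj adj_irr. Qed.

Definition induced := Graph induced_sym induced_irr.

End Induced.

(* H is obtained, up to isomorphism, by exactly j successive contractions. *)
Fixpoint contracts_in (j : nat) (V : finType) (G : graph V)
    (U : finType) (H : graph U) : Prop :=
  if j is j'.+1 then
    exists x y, adj G x y /\ contracts_in j' (contract G x y) H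
  else isomorphic G H.

Definition k_contractible (k : nat) (V : finType) (G : graph V)
    (U : finType) (H : graph U) : Prop :=
  exists2 j, j <= k & contracts_in j G H.

Definition graph_connected (V : finType) (G : graph V) : Prop :=
  forall x y, connect (adj G) x y.

(* A duplicate-free closed walk on one or two vertices is not a cycle of a
   simple graph, hence the bound 3. *)
Definition graph_acyclic (V : finType) (G : graph V) : Prop :=
  forall s : seq V, ucycle (adj G) s -> size s < 3.

(* The graph without vertices is not a tree. *)
Definition is_tree (V : finType) (G : graph V) : Prop :=
  [/\ 0 < #|V|, graph_connected G & graph_acyclic G].

Definition k_contractible_to_tree (k : nat) (V : finType) (G : graph V) : Prop :=
  exists (U : finType) (T : graph U), is_tree T /\ k_contractible k G T.

Record witness_structure (V : finType) (G : graph V) (U : finType)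
    (T : graph U) (W : U -> {set V}) : Prop := WitnessStructure {
  witness_nonempty : forall t, W t != set0;
  witness_disjoint : forall t t', t != t' -> [disjoint W t & W t'];
  witness_cover : forall v, exists t, v \in W t;
  witness_connected : forall t, graph_connected (induced G (W t));
  witness_edges : forall t t', t != t' ->
    ((exists x y, [/\ x \in W t, y \in W t' & adj G x y]) <-> adj T t t') }.

(** * Randomized algorithms *)

(* The machine model is the first-order functional language over binary trees
   (N. D. Jones, Computability and Complexity, 1997), extended with coin
   tossing.  Values are immutable and shared, environments have a length
   bounded by the program, so each syntax node evaluated costs O(1) pointer
   operations on a RAM; it is charged one time unit. *)

Inductive data := Nil | Pair of data & data.

Inductive term :=
| Var of nat                      (* de Bruijn index in the environment *)
| TNil
| TPair of term & term
| Fst of term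
| Snd of term
| If of term & term & term        (* the else branch is taken on [Nil] *)
| Let of term & term
| Call of nat & term
| Toss.

(* The bodies of the unary, mutually recursive functions; function 0 is the
   entry point. *)
Definition program := seq term.

Definition fst_data (v : data) := if v is Pair a _ then a else Nil.
Definition snd_data (v : data) := if v is Pair _ b then b else Nil.
Definition bool_data (b : bool) := if b then Pair Nil Nil else Nil.

(* [eval p env s e v s' t]: with random tape s, the term e evaluates in
   environment env to v in t steps, leaving the tape s'. *)
Inductive eval (p : program) :
  seq data -> seq bool -> term -> data -> seq bool -> nat -> Prop :=
| EvVar env s i : eval p env s (Var i) (nth Nil env i) s 1
| EvNil env s : eval p env s TNil Nil s 1
| EvPair env s0 s1 s2 e1 e2 v1 v2 t1 t2 :
    eval p env s0 e1 v1 s1 t1 -> eval p env s1 e2 v2 s2 t2 ->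
    eval p env s0 (TPair e1 e2) (Pair v1 v2) s2 (t1 + t2).+1
| EvFst env s0 s1 e v t : eval p env s0 e v s1 t ->
    eval p env s0 (Fst e) (fst_data v) s1 t.+1
| EvSnd env s0 s1 e v t : eval p env s0 e v s1 t ->
    eval p env s0 (Snd e) (snd_data v) s1 t.+1
| EvIfT env s0 s1 s2 e e1 e2 a b v t t1 :
    eval p env s0 e (Pair a b) s1 t -> eval p env s1 e1 v s2 t1 ->
    eval p env s0 (If e e1 e2) v s2 (t + t1).+1
| EvIfF env s0 s1 s2 e e1 e2 v t t2 :
    eval p env s0 e Nil s1 t -> eval p env s1 e2 v s2 t2 ->
    eval p env s0 (If e e1 e2) v s2 (t + t2).+1
| EvLet env s0 s1 s2 e1 e2 v1 v2 t1 t2 :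
    eval p env s0 e1 v1 s1 t1 -> eval p (v1 :: env) s1 e2 v2 s2 t2 ->
    eval p env s0 (Let e1 e2) v2 s2 (t1 + t2).+1
| EvCall env s0 s1 s2 f e a v t1 t2 :
    eval p env s0 e a s1 t1 -> eval p [:: a] s1 (nth TNil p f) v s2 t2 ->
    eval p env s0 (Call f e) v s2 (t1 + t2).+1
| EvToss env b s : eval p env (b :: s) Toss (bool_data b) s 1.

Lemma eval_det p env s e v s' t : eval p env s e v s' t ->
  forall w r u, eval p env s e w r u -> [/\ v = w, s' = r & t = u].
Proof.
elim=> {env s e v s' t} [env s i|env s|env s0 s1 s2 e1 e2 v1 v2 t1 t2 _ I1 _ I2
  |env s0 s1 e v t _ I|env s0 s1 e v t _ I
  |env s0 s1 s2 e e1 e2 a b v t t1 _ I1 _ I2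
  |env s0 s1 s2 e e1 e2 v t t2 _ I1 _ I2
  |env s0 s1 s2 e1 e2 v1 v2 t1 t2 _ I1 _ I2
  |env s0 s1 s2 f e a v t1 t2 _ I1 _ I2|env b s] w r u E;
inversion E; subst; split=> //;
repeat match goal with
| I : forall _ _ _, eval _ _ _ ?e _ _ _ -> _, H : eval _ _ _ ?e _ _ _ |- _ =>
    case: (I _ _ _ H) => ? ? ?; clear I; subst
end; try discriminate; congruence.
Qed.

(* Every toss costs a step, so a tape of T uniform bits suffices for a run of
   at most T steps; unused bits do not affect the answer. *)
Definition runs_within (p : program) (T : nat) (s : seq bool) (x y : data) :
    Prop :=
  exists s' t, t <= T /\ eval p [:: x] s (nth TNil p 0) y s' t.

Lemma runs_within_det p T s x y z :
  runs_within p T s x y -> runs_within p T s x z -> y = z.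
Proof. by move=> [s1 [t [_ H]]] [s2 [u [_ H']]]; case: (eval_det H H'). Qed.

(** * Encoding of instances and answers *)

Definition seq_data (s : seq data) : data := foldr Pair Nil s.

Definition nat_data (k : nat) : data := seq_data (nseq k Nil).

Definition set_data (n : nat) (A : {set 'I_n}) : data :=
  seq_data [seq bool_data (v \in A) | v <- enum 'I_n].

Definition graph_data (n : nat) (G : graph 'I_n) : data :=
  seq_data [seq set_data [set v | adj G u v] | u <- enum 'I_n].

Definition instance_data (n : nat) (G : graph 'I_n) (k : nat) : data :=
  Pair (graph_data G) (nat_data k).

(* [None] is the answer "no"; [Some Ws] is the answer "yes" together with a
   list of vertex sets. *)
Definition answer_data (n : nat) (o : option (seq {set 'I_n})) : data :=
  if o is Some Ws then Pair Nil (seq_data (map (@set_data n) Ws)) else Nil.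

Lemma bool_data_inj : injective bool_data.
Proof. by case; case. Qed.

Lemma seq_data_inj : injective seq_data.
Proof. by elim=> [|a s IH] [|b r] //= [-> /IH ->]. Qed.

Lemma set_data_inj n : injective (@set_data n).
Proof.
move=> A B /seq_data_inj /eq_in_map E; apply/setP => v.
by apply: bool_data_inj; apply: E; rewrite mem_enum.
Qed.

Lemma answer_data_inj n : injective (@answer_data n).
Proof.
by move=> [s|] [r|] //= [] /seq_data_inj /(inj_map (@set_data_inj n)) ->.
Qed.

(* Main.v *)
(* Colour every vertex black or white at random.  Fix a contraction of [G] onto
   a tree with [j <= k] contractions, and let [b] of its witness sets be big,
   that is, have at least two vertices.  As a tree is bipartite, with
   probability at least 2^-(j+b) all big witness sets are monochromatic and
   adjacent ones have different colours.

   Split [G] into its blocks.  In a block [Y], every component [X] of a colour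
   class consists of the trace of one witness set and of vertices whose
   neighbours in [Y] all lie in that trace.  Hence a minimum connected vertex
   cover of [X] containing the vertices of [X] with neighbours in [Y :\: X] is
   at most as large as the trace, and merging these covers, over all blocks and
   components, loses at most [j] vertices; the quotient is again a tree, which
   is checked afterwards.

   The covers are computed by iterative compression: the cover must contain a
   connected set [P], which shrinks from [X] to a single vertex.  The big witness
   sets have at most [j + 2 - b] vertices, so the cover [Z] to be improved has at
   most [k + 2 - b] vertices outside [P], and the compression explores pairs
   (part of [Z] left out, part of [Z] reached so far).  As [Z] is connected,
   there are only 2^|Z :\: P| such pairs.  For each [b], 2^(k+b) colourings are
   tried, at a cost of 2^(k-b) n^O(1) each, which is 4^k n^O(1) altogether; all
   of them fail with probability at most (1 - 2^-(k+b))^(2^(k+b)) <= 1/e. *)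

From mathcomp Require Import all_boot all_order all_algebra zify lra.
From mathcomp Require Import reals sequences exp.
Require Import Defs.
Import Order.TTheory GRing.Theory Num.Theory.

Set Implicit Arguments.
Unset Strict Implicit.
Unset Printing Implicit Defensive.

(** * A recursive language compiled to the machine *)

(** The covers that are merged need not be the traces of the witness sets: only their sizes are
    compared, so the bags found may form another tree than the given one. That their quotient has no
    cycle therefore needs a proof of its own, and this is where the blocks come in. Walks can be
    shortened to a block, so acyclicity may be tested block by block; and as no vertex of a block
    separates it, each part of a colour class is a star-like set: one trace as core, all other
    vertices attached to the core only. The distinctness of the keys is what keeps the lists of
    states short. Two states with equal keys may contain different vertices outside the old cover,
    so optimality has to be argued about keys alone. The machine counts steps. The algorithm is
    therefore written in a small language whose only loop is structural recursion over a list: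
    values and costs are total functions, and exponential running times arise only from lists of
    exponential length. *)

Inductive code :=
| CVar of nat
| CNil
| CPair of code & code
| CFst of code
| CSnd of code
| CIf of code & code & code
| CLet of code & code
| CApp of code & code
| CRec of code & code & code & code & code.

(** [CRec] walks down a list, updating an accumulator by [pre] on the way, starts from [base] at the
    end and combines the results by [post] on the way back. This one scheme yields folds, maps and
    zips. *)
Fixpoint sem (c : code) (env : seq data) : data :=
  match c with
  | CVar i => nth Nil env i
  | CNil => Nil
  | CPair a b => Pair (sem a env) (sem b env)
  | CFst a => fst_data (sem a env)
  | CSnd a => snd_data (sem a env)
  | CIf a b c => if sem a env is Pair _ _ then sem b env else sem c env
  | CLet a b => sem b (sem a env :: env)
  | CApp f a => sem f [:: sem a env]
  | CRec l a base pre post =>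
      (fix go (l a : data) := match l with
        | Nil => sem base (a :: env)
        | Pair x l' =>
            sem post (go l' (sem pre (x :: a :: env)) :: x :: a :: env)
        end) (sem l env) (sem a env)
  end.

Definition semrec base pre post env := fix go (l a : data) : data :=
  match l with
  | Nil => sem base (a :: env)
  | Pair x l' => sem post (go l' (sem pre (x :: a :: env)) :: x :: a :: env)
  end.

(** The exact number of steps of the compiled term. The constants count the nodes that compilation
    adds for packing environments and for calling the function of a recursion. *)
Fixpoint cost (c : code) (env : seq data) : nat :=
  match c with
  | CVar i => i.+2
  | CNil => 1
  | CPair a b => (cost a env + cost b env).+1
  | CFst a => (cost a env).+1
  | CSnd a => (cost a env).+1
  | CIf a b c => (cost a env +
      if sem a env is Pair _ _ then cost b env else cost c env).+1
  | CLet a b => (cost a env + cost b (sem a env :: env)).+3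
  | CApp f a => (cost a env + cost f [:: sem a env]).+3
  | CRec l a base pre post =>
      cost l env + cost a env + 4 +
      (fix go (l a : data) := match l with
        | Nil => cost base (a :: env) + 6
        | Pair x l' =>
            let a' := sem pre (x :: a :: env) in
            cost pre (x :: a :: env) + go l' a' +
            cost post (semrec base pre post env l' a' :: x :: a :: env) + 24
        end) (sem l env) (sem a env)
  end.

Definition costrec base pre post env := fix go (l a : data) : nat :=
  match l with
  | Nil => cost base (a :: env) + 6
  | Pair x l' =>
      let a' := sem pre (x :: a :: env) in
      cost pre (x :: a :: env) + go l' a' +
      cost post (semrec base pre post env l' a' :: x :: a :: env) + 24
  end.

(* Compiled terms keep the whole environment, packed as a list, in [Var 0];
   the functions needed by the recursions get indices from [o] on. *)
Fixpoint compile (o : nat) (c : code) : term * seq term :=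
  match c with
  | CVar i => (Fst (iter i Snd (Var 0)), [::])
  | CNil => (TNil, [::])
  | CPair a b =>
      let: (ta, fa) := compile o a in
      let: (tb, fb) := compile (o + size fa) b in (TPair ta tb, fa ++ fb)
  | CFst a => let: (ta, fa) := compile o a in (Fst ta, fa)
  | CSnd a => let: (ta, fa) := compile o a in (Snd ta, fa)
  | CIf a b c =>
      let: (ta, fa) := compile o a in
      let: (tb, fb) := compile (o + size fa) b in
      let: (tc, fc) := compile (o + size fa + size fb) c in
      (If ta tb tc, fa ++ fb ++ fc)
  | CLet a b =>
      let: (ta, fa) := compile o a in
      let: (tb, fb) := compile (o + size fa) b in
      (Let (TPair ta (Var 0)) tb, fa ++ fb)
  | CApp f a =>
      let: (ta, fa) := compile o a in
      let: (tf, ff) := compile (o + size fa) f in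
      (Let (TPair ta TNil) tf, fa ++ ff)
  | CRec l a base pre post =>
      let: (tl, fl) := compile o l in
      let: (ta, fa) := compile (o + size fl) a in
      let j := o + size fl + size fa in
      let: (tb, fb) := compile j.+1 base in
      let: (tp, fp) := compile (j.+1 + size fb) pre in
      let: (tq, fq) := compile (j.+1 + size fb + size fp) post in
      (Call j (TPair tl (TPair ta (Var 0))),
       fl ++ fa ++
       (If (Fst (Var 0))
          (Let (TPair (Fst (Fst (Var 0))) (Snd (Var 0)))
            (Let (Call j (TPair (Snd (Fst (Var 1)))
                                (TPair tp (Snd (Snd (Var 0))))))
              (Let (TPair (Var 0) (Var 1)) tq)))
          (Let (Snd (Var 0)) tb)) :: fb ++ fp ++ fq)
  end.

Definition has_at (p : program) o fs :=
  forall i, i < size fs -> nth TNil p (o + i) = nth TNil fs i.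

Lemma has_at_cat p o f1 f2 :
  has_at p o (f1 ++ f2) -> has_at p o f1 /\ has_at p (o + size f1) f2.
Proof.
move=> H; split=> i lti; last first.
  by rewrite -addnA H ?size_cat ?ltn_add2l // nth_cat ltnNge leq_addr addKn.
by rewrite H ?nth_cat ?lti // size_cat ltn_addr.
Qed.

Lemma has_at_cons p o f fs :
  has_at p o (f :: fs) -> nth TNil p o = f /\ has_at p o.+1 fs.
Proof.
move=> H; split; first by have := H 0 isT; rewrite addn0.
by move=> i lti; rewrite addSnnS H.
Qed.

Lemma nth_iter_snd env i :
  iter i snd_data (seq_data env) = seq_data (drop i env).
Proof.
elim: i => [|i IH]; first by rewrite drop0.
by rewrite iterS IH -addn1 addnC -drop_drop; case: (drop i env) => //= *; rewrite drop0.
Qed.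

Lemma eval_var p env r s i :
  eval p (seq_data env :: r) s (Fst (iter i Snd (Var 0))) (nth Nil env i) s i.+2.
Proof.
have -> : nth Nil env i = fst_data (iter i snd_data (seq_data env)).
  by rewrite nth_iter_snd -[in LHS](addn0 i) -nth_drop; case: (drop i env).
apply: EvFst; elim: i => [|i IH]; first exact: EvVar.
by rewrite !iterS; apply: EvSnd.
Qed.

Lemma eval_t p env s e v s' t t' :
  eval p env s e v s' t -> t = t' -> eval p env s e v s' t'.
Proof. by move=> H <-. Qed.

(** Compiled terms read only [Var 0], so the rest [r] of the machine environment is arbitrary, which
    lets compiled code be nested. The tape [s] comes back unchanged, as the language has no
    tosses. *)
Theorem compile_correct p c : forall o env r s,
  has_at p o (compile o c).2 ->
  eval p (seq_data env :: r) s (compile o c).1 (sem c env) s (cost c env).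
Proof.
elim: c => [i||a IHa b IHb|a IHa|a IHa|a IHa b IHb c IHc|a IHa b IHb|f IHf a IHa
  |l IHl a IHa b IHb pr IHp q IHq] o env r s.
- by move=> _; exact: eval_var.
- by move=> _; exact: EvNil.
- have := IHa o env r s; rewrite /=; case: (compile o a) => ta fa /= {}IHa.
  have := IHb (o + size fa) env r s; case: (compile _ b) => tb fb /= {}IHb.
  by case/has_at_cat=> /IHa Ha /IHb Hb; exact: (EvPair Ha Hb).
- have := IHa o env r s; rewrite /=; case: (compile o a) => ta fa /= {}IHa /IHa H.
  exact: (EvFst H).
- have := IHa o env r s; rewrite /=; case: (compile o a) => ta fa /= {}IHa /IHa H.
  exact: (EvSnd H).
- have := IHa o env r s; rewrite /=; case: (compile o a) => ta fa /= {}IHa.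
  have := IHb (o + size fa) env r s; case: (compile _ b) => tb fb /= {}IHb.
  have := IHc (o + size fa + size fb) env r s; case: (compile _ c) => tc fc /= {}IHc.
  case/has_at_cat=> /IHa Ha /has_at_cat [/IHb Hb /IHc Hc].
  case: (sem a env) Ha => [|x y] Ha; first exact: (EvIfF _ Ha Hc).
  exact: (EvIfT _ Ha Hb).
- have := IHa o env r s; rewrite /=; case: (compile o a) => ta fa /= {}IHa.
  have := IHb (o + size fa) (sem a env :: env) (seq_data env :: r) s.
  case: (compile _ b) => tb fb /= {}IHb.
  case/has_at_cat=> /IHa Ha /IHb Hb.
  by apply: eval_t (EvLet (EvPair Ha (EvVar _ _ _ 0)) Hb) _; lia.
- have := IHa o env r s; rewrite /=; case: (compile o a) => ta fa /= {}IHa.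
  have := IHf (o + size fa) [:: sem a env] (seq_data env :: r) s.
  case: (compile _ f) => tf ff /= {}IHf.
  case/has_at_cat=> /IHa Ha /IHf Hf.
  by apply: eval_t (EvLet (EvPair Ha (EvNil _ _ _)) Hf) _; lia.
- have := IHl o env r s; rewrite /=; case: (compile o l) => tl fl /= {}IHl.
  have := IHa (o + size fl) env r s; case: (compile _ a) => ta fa /= {}IHa.
  set j := o + size fl + size fa.
  have := IHb j.+1; case: (compile _ b) => tb fb /= {}IHb.
  have := IHp (j.+1 + size fb); case: (compile _ pr) => tp fp /= {}IHp.
  have := IHq (j.+1 + size fb + size fp); case: (compile _ q) => tq fq /= {}IHq.
  case/has_at_cat=> /IHl Hl /has_at_cat [/IHa Ha] /has_at_cons [Hj].
  case/has_at_cat=> Hb /has_at_cat [Hp Hq].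
  rewrite -/(semrec b pr q env) -/(costrec b pr q env).
  have loop : forall ld ad, eval p [:: Pair ld (Pair ad (seq_data env))] s
      (nth TNil p j) (semrec b pr q env ld ad) s (costrec b pr q env ld ad).
    rewrite Hj; elim=> [|x _ ld IH] ad /=.
      have H1 := EvFst (EvVar p [:: Pair Nil (Pair ad (seq_data env))] s 0).
      have H2 := EvSnd (EvVar p [:: Pair Nil (Pair ad (seq_data env))] s 0).
      by apply: eval_t (EvIfF _ H1 (EvLet H2 (IHb (ad :: env) _ s Hb))) _; lia.
    set arg := Pair (Pair x ld) (Pair ad (seq_data env)).
    have H1 := EvFst (EvVar p [:: arg] s 0).
    have H2 := EvPair (EvFst (EvFst (EvVar p [:: arg] s 0)))
                      (EvSnd (EvVar p [:: arg] s 0)).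
    set xa := Pair x (Pair ad (seq_data env)).
    have H3 := EvSnd (EvFst (EvVar p [:: xa; arg] s 1)).
    have H4 := IHp (x :: ad :: env) [:: arg] s Hp.
    have H5 := EvSnd (EvSnd (EvVar p [:: xa; arg] s 0)).
    have H6 := EvPair H3 (EvPair H4 H5).
    have /= {}IH := IH (sem pr (x :: ad :: env)).
    rewrite -[X in eval _ _ _ X]Hj in IH.
    have H7 := EvCall H6 IH.
    set rs := semrec b pr q env ld (sem pr (x :: ad :: env)) in H7 *.
    have H8 := EvPair (EvVar p [:: rs; xa; arg] s 0) (EvVar p [:: rs; xa; arg] s 1).
    have H9 := IHq (rs :: x :: ad :: env) [:: rs; xa; arg] s Hq.
    apply: eval_t (EvIfT _ H1 (EvLet H2 (EvLet H7 (EvLet H8 H9)))) _.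
    by rewrite /rs /=; lia.
  apply: eval_t (EvCall (EvPair Hl (EvPair Ha (EvVar _ _ _ 0))) (loop _ _)) _.
  by rewrite /=; lia.
Qed.

(** * Running times *)

(** One constant serves as factor and as exponent, and the base is [n.+1] so that the bound does not
    vanish at [n = 0]. *)
Definition polynomial (t : nat -> nat) := exists c, forall n, t n <= c * n.+1 ^ c.

Lemma polynomial_const m : polynomial (fun=> m).
Proof. by exists m => n; rewrite leq_pmulr // expn_gt0. Qed.

Lemma polynomial_id : polynomial id.
Proof. by exists 1 => n; rewrite mul1n expn1. Qed.

Lemma polynomial_add f g :
  polynomial f -> polynomial g -> polynomial (fun n => f n + g n).
Proof.
move=> [a Ha] [b Hb]; exists (a + b) => n; rewrite mulnDl leq_add //.
  by rewrite (leq_trans (Ha n)) // leq_mul2l leq_pexp2l ?leq_addr ?orbT.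
by rewrite (leq_trans (Hb n)) // leq_mul2l leq_pexp2l ?leq_addl ?orbT.
Qed.

Lemma polynomial_succ f : polynomial f -> polynomial (fun n => (f n).+1).
Proof.
move=> Hf; have [c H] := polynomial_add (polynomial_const 1) Hf.
by exists c => n; rewrite -add1n.
Qed.

Lemma polynomial_mul f g :
  polynomial f -> polynomial g -> polynomial (fun n => f n * g n).
Proof.
move=> [a Ha] [b Hb]; exists (a * b + a + b) => n.
rewrite (leq_trans (leq_mul (Ha n) (Hb n))) // mulnACA -expnD.
by rewrite leq_mul ?leq_pexp2l //; lia.
Qed.

(** Time bounds are left as existential variables that the derivation of the cost instantiates,
    which is why the polynomiality goal is always postponed; this tactic then decomposes whatever
    expression was found. *)
Ltac poly := lazymatch goal with
  | |- polynomial (fun n => n) => exact polynomial_id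
  | |- polynomial (fun n => @?f n + @?g n) => apply (@polynomial_add f g); poly
  | |- polynomial (fun n => @?f n * @?g n) => apply (@polynomial_mul f g); poly
  | |- polynomial (fun n => S (@?f n)) =>
      first [exact (polynomial_const _) | apply (@polynomial_succ f); poly]
  | |- _ => first [assumption | exact (polynomial_const _)]
  end.

(* Code with named binders: an expression is given the length of its
   environment, and [lv k] refers to the k-th oldest entry. *)
Definition ex := nat -> code.
Definition lv k : ex := fun d => CVar (d - k.+1).
Definition nilx : ex := fun=> CNil.
Definition pairx (a b : ex) : ex := fun d => CPair (a d) (b d).
Definition fstx (a : ex) : ex := fun d => CFst (a d).
Definition sndx (a : ex) : ex := fun d => CSnd (a d).
Definition ifx (a b c : ex) : ex := fun d => CIf (a d) (b d) (c d).
Definition letx (a : ex) (f : ex -> ex) : ex := fun d => CLet (a d) (f (lv d) d.+1).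
Definition appx (c : code) (a : ex) : ex := fun d => CApp c (a d).
Definition recx (l a : ex) (base : ex -> ex) (pre : ex -> ex -> ex)
    (post : ex -> ex -> ex -> ex) : ex := fun d =>
  CRec (l d) (a d) (base (lv d) d.+1) (pre (lv d.+1) (lv d) d.+2)
    (post (lv d.+1) (lv d) (lv d.+2) d.+3).
Definition foldx (l a : ex) (f : ex -> ex -> ex) : ex :=
  recx l a id f (fun _ _ r => r).
Definition fn (f : ex -> ex) : code := f (lv 0) 1.

Definition truex : ex := pairx nilx nilx.

(** The depth is [size env], so that the indices computed by [lv] point to the intended entries.
    From here on costs are only bounded from above. *)
Definition runs (e : ex) env v t :=
  sem (e (size env)) env = v /\ cost (e (size env)) env <= t.

Definition computes (c : code) (x y : data) t := sem c [:: x] = y /\ cost c [:: x] <= t.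

Lemma runs_eq e env v w t : runs e env v t -> v = w -> runs e env w t.
Proof. by move=> H <-. Qed.

Lemma runs_le e env v t u : runs e env v t -> t <= u -> runs e env v u.
Proof. by move=> [H1 H2] H; split=> //; exact: leq_trans H. Qed.

Lemma computes_fn f x y t : runs (f (lv 0)) [:: x] y t -> computes (fn f) x y t.
Proof. by []. Qed.

(** Reading a variable costs its index plus two; with at most 28 entries a flat 30 keeps indices out
    of all later bounds. *)
Lemma runs_lv k env : size env <= 28 ->
  runs (lv k) env (nth Nil env (size env - k.+1)) 30.
Proof. by move=> H; split=> //=; rewrite !ltnS leq_subLR; lia. Qed.

Lemma runs_nil env : runs nilx env Nil 1.
Proof. by []. Qed.

Lemma runs_true env : runs truex env (Pair Nil Nil) 3.
Proof. by []. Qed.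

Lemma runs_pair a b env v w t u : runs a env v t -> runs b env w u ->
  runs (pairx a b) env (Pair v w) (t + u).+1.
Proof. by move=> [<- Ha] [<- Hb]; split=> //=; rewrite ltnS leq_add. Qed.

Lemma runs_fst a env v t : runs a env v t -> runs (fstx a) env (fst_data v) t.+1.
Proof. by move=> [<- Ha]. Qed.

Lemma runs_snd a env v t : runs a env v t -> runs (sndx a) env (snd_data v) t.+1.
Proof. by move=> [<- Ha]. Qed.

Lemma runs_let a f env v w t u : runs a env v t ->
  runs (f (lv (size env))) (v :: env) w u ->
  runs (letx a f) env w (t + u).+3.
Proof. by move=> [<- Ha] [<- Hb]; split=> //=; rewrite !ltnS leq_add. Qed.

Lemma runs_app c a env v w t u : runs a env v t -> computes c v w u ->
  runs (appx c a) env w (t + u).+3.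
Proof. by move=> [<- Ha] [<- Hb]; split=> //=; rewrite !ltnS leq_add. Qed.

(** The costs of both branches are added, so the bound does not depend on the test; each branch may
    still assume the outcome of the test. *)
Lemma runs_if c e1 e2 env (b : bool) v1 v2 t t1 t2 :
  runs c env (bool_data b) t ->
  (b -> runs e1 env v1 t1) -> (~~ b -> runs e2 env v2 t2) ->
  runs (ifx c e1 e2) env (if b then v1 else v2) (t + t1 + t2).+1.
Proof.
move=> [Hc tc]; rewrite /runs /= Hc; case: b {Hc} => /=.
  by move=> /(_ isT) [-> H] _; split=> //; lia.
by move=> _ /(_ isT) [-> H]; split=> //; lia.
Qed.

Lemma runs_ifd c e1 e2 env v v1 v2 t t1 t2 :
  runs c env v t -> runs e1 env v1 t1 -> runs e2 env v2 t2 ->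
  runs (ifx c e1 e2) env (if v is Pair _ _ then v1 else v2) (t + t1 + t2).+1.
Proof. by move=> [Hc ?] [<- ?] [<- ?]; rewrite /runs /= Hc; case: v {Hc}; split=> //; lia. Qed.

Lemma runs_if_nil c e1 e2 env v t t2 :
  runs c env Nil t -> runs e2 env v t2 -> runs (ifx c e1 e2) env v (t + t2).+1.
Proof. by move=> [Hc tc] [H2 t2']; rewrite /runs /= Hc; split=> //; lia. Qed.

Lemma runs_if_pair c e1 e2 env a b v t t1 :
  runs c env (Pair a b) t -> runs e1 env v t1 -> runs (ifx c e1 e2) env v (t + t1).+1.
Proof. by move=> [Hc tc] [H2 t2']; rewrite /runs /= Hc; split=> //; lia. Qed.

Section Rec.
Variables (A X Y : Type) (encA : A -> data) (encX : X -> data) (encY : Y -> data).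

Fixpoint recs (b : A -> Y) (p : X -> A -> A) (q : X -> A -> Y -> Y) xs a :=
  if xs is x :: xs' then q x a (recs b p q xs' (p x a)) else b a.

(** [Inv] relates the remaining list to the accumulator, for bodies whose cost bound has a
    precondition. The result [r] given to [post] is known to be the value of the recursive call, so
    facts about its size are available as well. *)
Lemma runs_rec (Inv : seq X -> A -> Prop) b p q (l a : ex) base pre post env xs a0
    N tl ta tb tp tq :
  runs l env (seq_data (map encX xs)) tl -> runs a env (encA a0) ta ->
  size xs <= N -> Inv xs a0 ->
  (forall a, Inv [::] a ->
     runs (base (lv (size env))) (encA a :: env) (encY (b a)) tb) ->
  (forall x xs a, Inv (x :: xs) a ->
     [/\ Inv xs (p x a),
       runs (pre (lv (size env).+1) (lv (size env))) (encX x :: encA a :: env)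
         (encA (p x a)) tp
     & forall r, r = recs b p q xs (p x a) ->
       runs (post (lv (size env).+1) (lv (size env)) (lv (size env).+2))
         (encY r :: encX x :: encA a :: env) (encY (q x a r)) tq]) ->
  runs (recx l a base pre post) env (encY (recs b p q xs a0))
    (tl + ta + N * (tp + tq + 24) + tb + 10).
Proof.
move=> [El Tl] [Ea Ta] sN I0 Hb Hs.
rewrite /runs /= -/(semrec _ _ _ _) -/(costrec _ _ _ _) El Ea.
set B := base _ _; set P := pre _ _ _; set Q := post _ _ _ _.
have H : forall a, Inv xs a ->
  semrec B P Q env (seq_data (map encX xs)) (encA a) = encY (recs b p q xs a) /\
  costrec B P Q env (seq_data (map encX xs)) (encA a) <=
    size xs * (tp + tq + 24) + tb + 6.
  elim: xs {El sN I0} => [|x xs IH] a1 I1 /=.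
    by have [-> ?] := Hb _ I1; split=> //; rewrite mul0n add0n leq_add2r.
  have [/IH [E1 T1] [Ep Tp] /(_ _ erefl) [Eq Tq]] := Hs _ _ _ I1.
  rewrite [sem P _]Ep E1; split=> //.
  move: Tp Tq; rewrite /= -/P -/Q => Tp Tq; nia.
have [-> H2] := H _ I0; split=> //.
have : size xs * (tp + tq + 24) <= N * (tp + tq + 24) by rewrite leq_mul2r sN orbT.
lia.
Qed.

End Rec.

Section Fold.
Variables (A X : Type) (encA : A -> data) (encX : X -> data).

Lemma runs_fold (Inv : seq X -> A -> Prop) (F : A -> X -> A) (l a : ex) f env xs a0
    N tl ta t :
  runs l env (seq_data (map encX xs)) tl -> runs a env (encA a0) ta ->
  size xs <= N -> Inv xs a0 ->
  (forall x xs' a, Inv (x :: xs') a ->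
     Inv xs' (F a x) /\
     runs (f (lv (size env).+1) (lv (size env))) (encX x :: encA a :: env)
         (encA (F a x)) t) ->
  size env <= 20 ->
  runs (foldx l a f) env (encA (foldl F a0 xs)) (tl + ta + N * (t + 60) + 50).
Proof.
move=> Hl Ha sN I0 Hs se.
have -> : foldl F a0 xs = recs id (fun x a => F a x) (fun _ _ r => r) xs a0.
  by elim: xs a0 {Hl Ha sN I0} => //= x xs IH a0.
apply: runs_le (runs_rec (encY := encA) (Inv := Inv) (tp := t) (tq := 30) (tb := 30)
   Hl Ha sN I0 _ _) _; last by nia.
- move=> a1 _; apply: runs_eq (runs_lv _ _) _ => /=; first by lia.
  by rewrite ?subSS ?subnn.
- move=> x xs' a1 /(Hs x) [I1 H1]; split=> // r _.
  apply: runs_eq (runs_lv _ _) _ => /=; first by lia.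
  by rewrite ?subSS ?subnn.
Qed.

End Fold.

Lemma runs_and a b env x y t u :
  runs a env (bool_data x) t -> runs b env (bool_data y) u ->
  runs (ifx a b nilx) env (bool_data (x && y)) (t + u + 2).
Proof.
move=> Ha Hb; apply: runs_le (runs_eq (runs_if Ha (fun=> Hb) (fun=> runs_nil _)) _) _.
  by case: x {Ha}.
by lia.
Qed.

Lemma runs_not a env x t :
  runs a env (bool_data x) t -> runs (ifx a nilx truex) env (bool_data (~~ x)) (t + 5).
Proof.
move=> Ha; apply: runs_le (runs_eq (runs_if Ha (fun=> runs_nil _) (fun=> runs_true _)) _) _.
  by case: x {Ha}.
by lia.
Qed.

Definition andx a b := ifx a b nilx.
Definition notx a := ifx a nilx truex.

(** * Automation for symbolic evaluation *)

Ltac run_var :=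
  match goal with |- runs (lv ?k) ?env _ _ =>
    let v := eval lazy [nth size subn subn_rec Nat.sub] in (nth Nil env (size env - k.+1)) in
    refine (runs_eq (w := v) (@runs_lv k env isT) (erefl v)) end.

Ltac run_prim := match goal with
  | [ H : context [computes ?c] |- computes ?d _ _ _ ] =>
      constr_eq c d; solve [eapply H] end.

Ltac run :=
  lazymatch goal with
  | |- runs (lv _) _ _ _ => run_var
  | |- runs nilx _ _ _ => eapply runs_nil
  | |- runs truex _ _ _ => eapply runs_true
  | |- runs (pairx _ _) _ _ _ => eapply runs_pair; [run|run]
  | |- runs (fstx _) _ _ _ =>
      eapply runs_eq; [eapply runs_fst; run | cbn [fst_data snd_data]; reflexivity]
  | |- runs (sndx _) _ _ _ =>
      eapply runs_eq; [eapply runs_snd; run | cbn [fst_data snd_data]; reflexivity]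
  | |- runs (andx _ _) _ _ _ => eapply runs_and; [run|run]
  | |- runs (notx _) _ _ _ => eapply runs_not; run
  | |- runs (appx _ _) _ _ _ => eapply runs_app; [run|try run_prim]
  | |- runs (letx _ _) _ _ _ => eapply runs_let; [run|cbv beta; run]
  | |- runs (ifx _ _ _) _ _ _ =>
      eapply runs_if; [run | let H := fresh in intro H; clear H; run
                      | let H := fresh in intro H; clear H; run]
  | |- _ => idtac
  end.

Ltac runv := eapply runs_eq; [cbv beta; run | try reflexivity].

(** * Bit vectors and unary numbers *)

Section Bits.

Definition bits_data (s : seq bool) := seq_data (map bool_data s).

Lemma set_bits n (A : {set 'I_n}) :
  set_data A = bits_data [seq v \in A | v <- enum 'I_n].
Proof. by rewrite /bits_data -map_comp. Qed.

(** The recursion is over the first vector, with the second as accumulator, consumed one entry per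
    step. *)
Definition zip_with (op : ex -> ex -> ex) : code :=
  fn (fun p => recx (fstx p) (sndx p) (fun=> nilx) (fun _ a => sndx a)
        (fun x a r => pairx (op x (fstx a)) r)).

Lemma zip_with_correct (opx : ex -> ex -> ex) (op : bool -> bool -> bool) m :
  (forall env a b e1 e2 t u, size env <= 4 ->
     runs e1 env (bool_data a) t -> runs e2 env (bool_data b) u ->
     runs (opx e1 e2) env (bool_data (op a b)) (t + u + m)) ->
  exists2 t, polynomial t & forall n (A B : {set 'I_n}),
    computes (zip_with opx) (Pair (set_data A) (set_data B))
      (set_data [set v | op (v \in A) (v \in B)]) (t n).
Proof.
move=> H; eexists; last first.
  move=> n A B; apply: computes_fn.
  rewrite (set_bits A) (set_bits B).
  pose q (x : bool) (a r : seq bool) := op x (head false a) :: r.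
  eapply runs_eq.
  eapply (runs_rec (N := n) (Inv := fun xs a => size xs = size a) (encA := bits_data)
    (encY := bits_data) (b := fun=> [::]) (p := fun _ a => behead a) (q := q)).
  - by runv.
  - by runv.
  - by rewrite size_map size_enum_ord.
  - by rewrite !size_map.
  - by move=> a _; runv.
  - move=> x xs [|y a] //= [E]; split=> //.
      by runv.
    move=> r _; runv.
    apply: H => //; by runv.
  rewrite set_bits; congr bits_data.
  elim: (enum 'I_n) => //= v s IH; rewrite inE /q /= -/q; congr cons; exact: IH.
by poly.
Qed.

End Bits.

Definition c_union := zip_with (fun x y => ifx x truex y).
Definition c_inter := zip_with (fun x y => ifx x y nilx).
Definition c_diff := zip_with (fun x y => ifx x (ifx y nilx truex) nilx).

Lemma c_union_correct : exists2 t, polynomial t & forall n (A B : {set 'I_n}),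
  computes c_union (Pair (set_data A) (set_data B)) (set_data (A :|: B)) (t n).
Proof.
have [|t pt H] := @zip_with_correct (fun x y => ifx x truex y) orb 4.
  move=> env a b e1 e2 t u _ H1 H2.
  apply: runs_le (runs_eq (runs_if H1 (fun=> runs_true _) (fun=> H2)) _) _; last by lia.
  by case: a {H1}.
by exists t => // n A B; have := H n A B; congr computes; congr set_data; apply/setP=> v; rewrite !inE.
Qed.

Lemma c_inter_correct : exists2 t, polynomial t & forall n (A B : {set 'I_n}),
  computes c_inter (Pair (set_data A) (set_data B)) (set_data (A :&: B)) (t n).
Proof.
have [|t pt H] := @zip_with_correct (fun x y => ifx x y nilx) andb 4.
  by move=> env a b e1 e2 t u _ H1 H2; apply: runs_le (runs_and H1 H2) _; lia.
by exists t => // n A B; have := H n A B; congr computes; congr set_data; apply/setP=> v; rewrite !inE.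
Qed.

Lemma c_diff_correct : exists2 t, polynomial t & forall n (A B : {set 'I_n}),
  computes c_diff (Pair (set_data A) (set_data B)) (set_data (A :\: B)) (t n).
Proof.
have [|t pt H] := @zip_with_correct (fun x y => ifx x (ifx y nilx truex) nilx)
    (fun x y => x && ~~ y) 10.
  by move=> env a b e1 e2 t u _ H1 H2; apply: runs_le (runs_and H1 (runs_not H2)) _; lia.
by exists t => // n A B; have := H n A B; congr computes; congr set_data; apply/setP=> v; rewrite !inE andbC.
Qed.

Definition c_meets : code :=
  fn (fun p => recx (fstx p) (sndx p) (fun=> nilx) (fun _ a => sndx a)
        (fun x a r => ifx (andx x (fstx a)) truex r)).

Lemma c_meets_correct : exists2 t, polynomial t & forall n (A B : {set 'I_n}),
  computes c_meets (Pair (set_data A) (set_data B)) (bool_data (A :&: B != set0)) (t n).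
Proof.
eexists; last first.
  move=> n A B; apply: computes_fn.
  rewrite (set_bits A) (set_bits B).
  pose q (x : bool) (a : seq bool) (r : bool) := x && head false a || r.
  eapply runs_eq.
  eapply (runs_rec (N := n) (Inv := fun xs a => size xs = size a) (encA := bits_data)
    (encY := bool_data) (b := fun=> false) (p := fun _ a => behead a) (q := q)).
  - by runv.
  - by runv.
  - by rewrite size_map size_enum_ord.
  - by rewrite !size_map.
  - by move=> a _; runv.
  - move=> x xs [|y a] //= [E]; split=> //.
      by runv.
    move=> r _; runv.
    by rewrite /q /=; case: x y => [] [].
  congr bool_data; transitivity (has (mem (A :&: B)) (enum 'I_n)).
    by elim: (enum 'I_n) => //= v s IH; rewrite inE /q /= -/q; congr orb; exact: IH.
  apply/hasP/set0Pn => [[v _ H]|[v H]]; first by exists v.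
  by exists v => //; rewrite mem_enum.
by poly.
Qed.

(** Numbers are unary and lose one cell per step; [Snd] of [Nil] is [Nil], which agrees with [a.-1]
    at zero. *)
Definition nat_leq : code :=
  fn (fun p => recx (fstx p) (sndx p) (fun=> truex) (fun _ a => sndx a)
        (fun _ a r => ifx a r nilx)).

Lemma nat_leq_correct : exists2 t, polynomial t & forall n a b, a <= n.+1 ->
  computes nat_leq (Pair (nat_data a) (nat_data b)) (bool_data (a <= b)) (t n).
Proof.
eexists; last first.
  move=> n a b an; apply: computes_fn.
  rewrite /nat_data -(map_nseq a (fun=> Nil) tt).
  pose q (x : unit) (a : nat) (r : bool) := (a != 0) && r.
  eapply runs_eq.
  eapply (runs_rec (N := n.+1) (Inv := fun _ _ => True) (encX := fun=> Nil) (encA := nat_data)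
    (encY := bool_data) (b := fun=> true) (p := fun _ a => a.-1) (q := q)).
  - by runv.
  - by runv.
  - by rewrite size_nseq.
  - by [].
  - by move=> ? _; runv.
  - move=> x xs m _; split=> //.
      by runv; case: m.
    move=> r _; eapply runs_eq; first by eapply runs_ifd; run.
    by rewrite /q; case: m.
  congr bool_data.
  by elim: a b {an} => //= a IH [|b] //=; rewrite /q /= -/q IH.
by poly.
Qed.

(** * The algorithm *)

Section Algorithm.
Variables (V : finType) (G : graph V).
Implicit Types (A S U X B P Q Z O R C D W best phi : {set V}).

Definition nbh v : {set V} := [set u | adj G v u].
Definition meets A B := A :&: B != set0 :> {set V}.
(** A fold over [enum V], like most functions below, so that the machine code can follow the
    definition literally and only encodings remain to be matched. *)
Definition nbs A := foldl (fun S v => if v \in A then S :|: nbh v else S) set0 (enum V).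

(* The vertices of the component of r in S, and the order, latest first, in
   which they are found. *)
Definition grow_step S (a : {set V} * seq V) v :=
  if [&& v \in S, v \notin a.1 & meets (nbh v) a.1] then (v |: a.1, v :: a.2) else a.
Definition grow_pass S a := foldl (grow_step S) a (enum V).
Definition grow S r :=
  foldl (fun a (_ : V) => grow_pass S a) ([set r], [::]) (enum V).

Definition comps_step S (a : {set V} * seq {set V}) v :=
  if (v \in S) && (v \notin a.1)
  then (a.1 :|: (grow S v).1, (grow S v).1 :: a.2) else a.
Definition comps S := (foldl (comps_step S) (set0, [::]) (enum V)).2.

Definition attach v acc (Cs : seq {set V}) :=
  foldl (fun acc C => (v |: C) :: acc) acc Cs.
Definition split_step v (acc : seq {set V}) U :=
  if v \in U then attach v acc (comps (U :\ v)) else U :: acc.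
Definition split Us v := foldl (split_step v) [::] Us.
(** Every vertex in turn splits each set containing it into the components left by its removal, with
    the vertex put back into each of them. A set of one vertex has no such component and disappears,
    so after a split all members have at least two vertices. *)
Definition blocks := foldl split [:: setT] (enum V).

Definition boundary U X :=
  foldl (fun S v => if (v \in X) && meets (nbh v) (U :\: X) then v |: S else S)
    set0 (enum V).

Definition outs_add z (acc : seq {set V}) O :=
  if meets (nbh z) O then acc else (z |: O) :: acc.
Definition outs_step Z Q L z :=
  if z \in Z :\: Q then foldl (outs_add z) L L else L.
(* The independent subsets of [Z :\: Q]. *)
Definition outs Z Q := foldl (outs_step Z Q) [:: set0] (enum V).

(* A connected vertex cover containing [Q] that leaves out exactly [O] from the
   cover [Z] must contain these vertices. *)
Definition forced X Z Q O := (Z :\: O) :|: (nbs O :&: X) :|: Q.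

(* In a state [(O, R)], [O] is the part of [Z] left out and [R] the component of
   the root in the set of forced and chosen vertices.  Chosen vertices outside
   [Z] matter only through [R :&: Z], hence the key. *)
Definition state := ({set V} * {set V})%type.
Definition key Z (st : state) := (st.1, st.2 :&: Z).
Definition insert Z (acc : seq state) st :=
  if key Z st \in map (key Z) acc then acc else st :: acc.

Definition init_states X Q r Z :=
  foldl (fun acc O => insert Z acc (O, (grow (forced X Z Q O) r).1)) [::] (outs Z Q).
Definition explore_step X Q r Z (st : state) acc v :=
  if [&& v \in X :\: st.1, v \notin st.2 & meets (nbh v) st.2]
  then insert Z acc (st.1, (grow (v |: (forced X Z Q st.1 :|: st.2)) r).1) else acc.
Definition explore_state X Q r Z acc st :=
  foldl (explore_step X Q r Z st) acc (enum V).
(** The list traversed is also the initial accumulator: states are only added, and in each round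
    every old state may choose one more vertex. *)
Definition explore X Q r Z (acc : seq state) := foldl (explore_state X Q r Z) acc acc.
Definition best_step X Q Z best (st : state) : {set V} :=
  if (forced X Z Q st.1 \subset st.2) && (#|st.2| < #|best|) then st.2 else best.
Definition compress X Q r Z :=
  foldl (best_step X Q Z) Z
    (foldl (fun acc (_ : V) => explore X Q r Z acc) (init_states X Q r Z) (enum V)).

(* Iterative compression: [P = a.1] shrinks from [X] to the root, and [a.2] is a
   minimum connected vertex cover of [X] containing [P] and [B], unless the
   bound [cap] was exceeded. *)
Definition shrink_step X B r cap (a : {set V} * {set V}) x :=
  (a.1 :\ x, if #|a.2 :\: (a.1 :\ x)| <= cap
             then compress X ((a.1 :\ x) :|: B) r a.2 else a.2).
Definition shrink X B cap r := (foldl (shrink_step X B r cap) (X, X) (grow X r).2).2.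
Definition cvc_step X B cap best r : {set V} :=
  if r \in X then
    (if #|shrink X B cap r| < #|best| then shrink X B cap r else best) else best.
(** No vertex is known in advance to lie in a minimum cover, so every root in [X] is tried, with [X]
    itself as the starting value. *)
Definition cvc cap U X := foldl (cvc_step X (boundary U X) cap) X (enum V).

Definition cover_all cap U acc (Xs : seq {set V}) :=
  foldl (fun acc X => cvc cap U X :: acc) acc Xs.
Definition cover_block phi cap acc U :=
  cover_all cap U (cover_all cap U acc (comps (U :&: phi))) (comps (U :\: phi)).
Definition covers phi cap := foldl (cover_block phi cap) [::] blocks.

(* The class of v when overlapping members of [Ws] are merged. *)
Definition bag_step S W : {set V} := if meets W S then S :|: W else S.
Definition bag (Ws : seq {set V}) v :=
  foldl (fun S (_ : V) => foldl bag_step S Ws) [set v] (enum V).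

(* The classes form a tree if each, in the order of a search of [G], is
   connected and adjacent to exactly one earlier class. *)
Definition nb_bags D (Bs : seq {set V}) := count (meets (nbs D)) Bs.
Definition add_bag Ws v (a : ({set V} * seq {set V}) * bool) :=
  if v \in a.1.1 then a else
  let D := bag Ws v in
  ((a.1.1 :|: D, D :: a.1.2),
   [&& a.2, ~~ meets D a.1.1, (grow D v).1 == D & nb_bags D a.1.2 == 1]).
Definition bags Ws v0 :=
  foldr (add_bag Ws) ((bag Ws v0, [:: bag Ws v0]), (grow (bag Ws v0) v0).1 == bag Ws v0)
    (grow setT v0).2.

(** The checks make the answer sound for every colouring and every [cap]. The last one bounds the
    number of contractions, which is [#|V|] minus the number of bags. *)
Definition verify k Ws : option (seq {set V}) :=
  if enum V is v0 :: _ then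
    let a := bags Ws v0 in
    if [&& a.2, a.1.1 == setT & #|V| <= size a.1.2 + k] then Some a.1.2 else None
  else None.

Definition try k cap phi := verify k (covers phi cap).

End Algorithm.

(* The bound, its polynomiality and the correctness statement stay anonymous: [poly] and [run_prim]
   find them by their form. *)
Tactic Notation "use" uconstr(lem) := let H := fresh "use" in have H := lem; case: H => ? ? ?.

Ltac fold_goals tac := [> runv | runv | tac | done | move=> ? ? ? _; split=> //; runv | done].
Ltac sizes := by rewrite size_enum_ord.

(** * Coded operations on sets and on graph searches *)

Definition c_card : code :=
  fn (fun p => recx p nilx (fun=> nilx) (fun _ a => a)
     (fun x _ r => ifx x (pairx nilx r) r)).

Lemma c_card_correct : exists2 t, polynomial t & forall n (A : {set 'I_n}),
  computes c_card (set_data A) (nat_data #|A|) (t n).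
Proof.
eexists; last first.
  move=> n A; apply: computes_fn; rewrite set_bits.
  pose q (x : bool) (a : unit) (r : nat) := x + r.
  eapply runs_eq.
    eapply (runs_rec (N := n) (Inv := fun _ _ => True) (encX := bool_data)
      (encA := fun=> Nil) (a0 := tt) (encY := nat_data) (b := fun=> 0) (p := fun _ a => a) (q := q)).
    - by runv.
    - by runv.
    - by rewrite size_map size_enum_ord.
    - by [].
    - by move=> ? _; runv.
    - move=> x xs m _; split=> //; first by runv.
      by move=> r _; runv; case: x.
  have -> : #|A| = count (mem A) (enum 'I_n).
    by rewrite cardE enumT {1}/enum_mem size_filter.
  by congr nat_data; elim: (enum _) => //= v s ->.
by poly.
Qed.

Definition c_subset : code :=
  fn (fun p => letx (appx c_diff p) (fun d => notx (appx c_meets (pairx d d)))).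

Lemma c_subset_correct : exists2 t, polynomial t & forall n (A B : {set 'I_n}),
  computes c_subset (Pair (set_data A) (set_data B)) (bool_data (A \subset B)) (t n).
Proof.
use c_diff_correct; use c_meets_correct; eexists; last first.
  move=> n A B; apply: computes_fn.
  by runv; rewrite setIid negbK setD_eq0.
by poly.
Qed.

Definition c_eq : code :=
  fn (fun p => andx (appx c_subset p) (appx c_subset (pairx (sndx p) (fstx p)))).

Lemma c_eq_correct : exists2 t, polynomial t & forall n (A B : {set 'I_n}),
  computes c_eq (Pair (set_data A) (set_data B)) (bool_data (A == B)) (t n).
Proof.
use c_subset_correct; eexists; last first.
  move=> n A B; apply: computes_fn.
  by runv; rewrite eqEsubset.
by poly.
Qed.

Definition nat_lt : code :=
  fn (fun p => appx nat_leq (pairx (pairx nilx (fstx p)) (sndx p))).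

Lemma nat_lt_correct : exists2 t, polynomial t & forall n a b, a <= n ->
  computes nat_lt (Pair (nat_data a) (nat_data b)) (bool_data (a < b)) (t n).
Proof.
use nat_leq_correct; eexists; last first.
  move=> n a b an; apply: computes_fn.
  run; rewrite -[Pair Nil (nat_data a)]/(nat_data a.+1).
  by match goal with H : _ |- _ => apply: (H n) end.
by poly.
Qed.

Section Vertices.
Variables (n : nat) (G : graph 'I_n).

(** A vertex is represented by two bit vectors, its singleton and its neighbourhood, so that
    membership and adjacency become set operations and no index arithmetic is needed. *)
Definition vertex_data v := Pair (set_data [set v]) (set_data (nbh G v)).
Definition vertices_data s := seq_data (map vertex_data s).
Definition sets_data (s : seq {set 'I_n}) := seq_data (map (@set_data n) s).

End Vertices.

Notation vs G := (vertices_data G (enum 'I_ _)).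

Definition c_in : code := fn (fun p => appx c_meets (pairx (fstx (fstx p)) (sndx p))).

Lemma c_in_correct : exists2 t, polynomial t & forall n (G : graph 'I_n) v A,
  computes c_in (Pair (vertex_data G v) (set_data A)) (bool_data (v \in A)) (t n).
Proof.
use c_meets_correct; eexists; last first.
  move=> n G v A; apply: computes_fn.
  by runv; rewrite setI_eq0 disjoints1 negbK.
by poly.
Qed.

Notation inx v a := (appx c_in (pairx v a)) (only parsing).
Notation meetsx a b := (appx c_meets (pairx a b)) (only parsing).
Notation unionx a b := (appx c_union (pairx a b)) (only parsing).
Notation interx a b := (appx c_inter (pairx a b)) (only parsing).
Notation diffx a b := (appx c_diff (pairx a b)) (only parsing).
Notation subsetx a b := (appx c_subset (pairx a b)) (only parsing).

Definition c_empty : code := fn (fun p => foldx p nilx (fun _ a => pairx nilx a)).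

Lemma c_empty_correct : exists2 t, polynomial t & forall n (G : graph 'I_n),
  computes c_empty (vs G) (set_data (set0 : {set 'I_n})) (t n).
Proof.
eexists; last first.
  move=> n G; apply: computes_fn; eapply runs_eq.
    eapply (runs_fold (encX := vertex_data G) (encA := bits_data) (a0 := [::])
      (F := fun a _ => false :: a) (Inv := fun _ _ => True) (N := n)); fold_goals sizes.
  rewrite set_bits; congr bits_data.
  rewrite [RHS](eq_map (g := fun=> false)); last by move=> v; rewrite inE.
  have E k (s : seq 'I_n) : foldl (fun a (_ : 'I_n) => false :: a) (nseq k false) s = nseq (k + size s) false.
    by elim: s k => [|v s IH] k; rewrite ?addn0 //= (IH k.+1) addSnnS.
  by rewrite (E 0) add0n; elim: (enum _) => //= v s ->.
by poly.
Qed.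

Definition c_full : code :=
  fn (fun p => foldx p (appx c_empty p) (fun x a => unionx (fstx x) a)).

Lemma c_full_correct : exists2 t, polynomial t & forall n (G : graph 'I_n),
  computes c_full (vs G) (set_data [set: 'I_n]) (t n).
Proof.
use c_empty_correct; use c_union_correct; eexists; last first.
  move=> n G; apply: computes_fn; eapply runs_eq.
    eapply (runs_fold (encX := vertex_data G) (encA := @set_data n)
      (F := fun a v => v |: a) (Inv := fun _ _ => True) (N := n)); fold_goals sizes.
  congr set_data; apply/setP=> v; rewrite inE.
  have E (s : seq 'I_n) A : foldl (fun a v => v |: a) A s = [set v in s] :|: A.
    elim: s A => [|x s IH] A /=; first by rewrite set_nil set0U.
    by rewrite IH set_cons setUA [_ :|: [set x]]setUC.
  by rewrite E !inE mem_enum.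
by poly.
Qed.

Definition c_nbs : code :=
  fn (fun p => foldx (fstx p) (appx c_empty (fstx p))
    (fun v a => ifx (inx v (sndx p)) (unionx a (sndx v)) a)).

Lemma c_nbs_correct : exists2 t, polynomial t & forall n (G : graph 'I_n) A,
  computes c_nbs (Pair (vs G) (set_data A)) (set_data (nbs G A)) (t n).
Proof.
use c_empty_correct; use c_union_correct; use c_in_correct; eexists; last first.
  move=> n G A; apply: computes_fn; eapply runs_eq.
    eapply (runs_fold (encX := vertex_data G) (encA := @set_data n)
      (F := fun S v => if v \in A then S :|: nbh G v else S) (Inv := fun _ _ => True) (N := n)); fold_goals sizes.
    by case: ifP.
  by [].
by poly.
Qed.

Definition c_grow_pass : code :=
  fn (fun p => foldx (fstx p) (sndx (sndx p)) (fun v a =>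
    ifx (andx (inx v (fstx (sndx p))) (andx (notx (inx v (fstx a))) (meetsx (sndx v) (fstx a))))
      (pairx (unionx (fstx v) (fstx a)) (pairx v (sndx a))) a)).

Definition grow_data n (G : graph 'I_n) (a : {set 'I_n} * seq 'I_n) :=
  Pair (set_data a.1) (vertices_data G a.2).

Lemma c_grow_pass_correct : exists2 t, polynomial t & forall n (G : graph 'I_n) S a,
  computes c_grow_pass (Pair (vs G) (Pair (set_data S) (grow_data G a)))
    (grow_data G (grow_pass G S a)) (t n).
Proof.
use c_union_correct; use c_in_correct; use c_meets_correct; eexists; last first.
  move=> n G S a; apply: computes_fn; eapply runs_eq.
    eapply (runs_fold (encX := vertex_data G) (encA := grow_data G)
      (F := grow_step G S) (Inv := fun _ _ => True) (N := n)); fold_goals sizes.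
    by rewrite /grow_step /meets; case: ifP.
  by [].
by poly.
Qed.

Definition c_grow : code :=
  fn (fun p => foldx (fstx p) (pairx (fstx (sndx (sndx p))) nilx) (fun _ a =>
    appx c_grow_pass (pairx (fstx p) (pairx (fstx (sndx p)) a)))).

Lemma c_grow_correct : exists2 t, polynomial t & forall n (G : graph 'I_n) S r,
  computes c_grow (Pair (vs G) (Pair (set_data S) (vertex_data G r)))
    (grow_data G (grow G S r)) (t n).
Proof.
use c_grow_pass_correct; eexists; last first.
  move=> n G S r; apply: computes_fn; eapply runs_eq.
    eapply (runs_fold (encX := vertex_data G) (encA := grow_data G)
      (a0 := ([set r], [::])) (F := fun a _ => grow_pass G S a) (Inv := fun _ _ => True) (N := n)); fold_goals sizes.
  by [].
by poly.
Qed.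

Notation growx vs s r := (appx c_grow (pairx vs (pairx s r))) (only parsing).

Definition c_comps : code :=
  fn (fun p => sndx (foldx (fstx p) (pairx (appx c_empty (fstx p)) nilx) (fun v a =>
    ifx (andx (inx v (sndx p)) (notx (inx v (fstx a))))
      (letx (fstx (growx (fstx p) (sndx p) v)) (fun c =>
        pairx (unionx (fstx a) c) (pairx c (sndx a)))) a))).

Lemma c_comps_correct : exists2 t, polynomial t & forall n (G : graph 'I_n) S,
  computes c_comps (Pair (vs G) (set_data S)) (sets_data (comps G S)) (t n).
Proof.
use c_union_correct; use c_in_correct; use c_empty_correct; use c_grow_correct; eexists; last first.
  move=> n G S; apply: computes_fn; eapply runs_eq.
    eapply runs_snd.
    eapply (runs_fold (encX := vertex_data G) (encA := fun a => Pair (set_data a.1) (sets_data a.2))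
      (a0 := (set0, [::])) (F := comps_step G S) (Inv := fun _ _ => True) (N := n)); fold_goals sizes.
    by rewrite /comps_step; case: ifP.
  by [].
by poly.
Qed.

Definition c_attach : code :=
  fn (fun p => foldx (sndx (sndx p)) (fstx (sndx p)) (fun c a => pairx (unionx (fstx (fstx p)) c) a)).

Lemma c_attach_correct : exists2 t, polynomial t & forall n (G : graph 'I_n) v acc Cs,
  size Cs <= n ->
  computes c_attach (Pair (vertex_data G v) (Pair (sets_data acc) (sets_data Cs)))
    (sets_data (attach v acc Cs)) (t n).
Proof.
use c_union_correct; eexists; last first.
  move=> n G v acc Cs sn; apply: computes_fn; eapply runs_eq.
    eapply (runs_fold (encX := @set_data n) (encA := @sets_data n)
      (F := fun acc C => (v |: C) :: acc) (Inv := fun _ _ => True) (N := n)); fold_goals ltac:(exact: sn).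
  by [].
by poly.
Qed.

(** * Connectivity *)

Lemma foldl_iter (T U : Type) (f : T -> T) a (s : seq U) :
  foldl (fun a _ => f a) a s = iter (size s) f a.
Proof. by elim: s a => //= x s IH a; rewrite IH -iterSr iterS. Qed.

(** As long as [P] fails, the measure after [i] rounds exceeds [i]; the start with [0 < m a] is what
    makes [N] rounds enough. Both graph search and the merging of sets terminate by this
    argument. *)
Lemma iter_saturate (T : Type) (f : T -> T) (P : T -> bool) (m : T -> nat) N a :
  (forall a, m a <= N) -> 0 < m a ->
  (forall a, P a -> P (f a)) -> (forall a, ~~ P a -> m a < m (f a)) ->
  P (iter N f a).
Proof.
move=> mN m0 Pf mf; apply: contraT => nP.
suff H i : P (iter i f a) || (i < m (iter i f a)).
  by have := H N; rewrite (negPf nP) ltnNge mN.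
elim: i => [|i /orP[/Pf H|H]]; rewrite ?iterS ?H ?m0 ?orbT //.
have [/Pf ->//|/mf] := boolP (P (iter i f a)); rewrite orbC => H'.
by rewrite (leq_ltn_trans H H').
Qed.

Section Connectivity.
Variables (V : finType) (G : graph V).
Implicit Types (A B S T U D P : {set V}) (e : rel V).

Definition within e S : rel V := fun x y => [&& x \in S, y \in S & e x y].
(** Connectivity of a vertex set without passing to a subtype; the empty set counts as connected. *)
Definition conn S := forall x y, x \in S -> y \in S -> connect (within (adj G) S) x y.

Lemma within_sym e S : symmetric e -> symmetric (within e S).
Proof. by move=> es x y; rewrite /within es; case: (x \in S); case: (y \in S). Qed.

Lemma connect_withinC S x y :
  connect (within (adj G) S) x y = connect (within (adj G) S) y x.
Proof. by apply: sym_connect_sym; apply: within_sym; exact: adj_sym. Qed.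

Lemma within_sub e e' S T : S \subset T -> subrel e e' ->
  subrel (within e S) (within e' T).
Proof.
by move=> /subsetP ST ee x y /and3P[/ST ? /ST ? /ee ?]; apply/and3P.
Qed.

Lemma connect_within_sub e e' S T : S \subset T -> subrel e e' ->
  subrel (connect (within e S)) (connect (within e' T)).
Proof.
by move=> ST ee; apply: connect_sub => x y /(within_sub ST ee); exact: connect1.
Qed.

Lemma connect_indP e (P : V -> Prop) x y :
  (forall u v, P u -> e u v -> P v) -> P x -> connect e x y -> P y.
Proof.
move=> H Px /connectP[p]; elim: p x Px => [|z p IH] x Px /=; first by move=> _ ->.
by case/andP=> /(H _ _ Px) Pz /(IH _ Pz); exact.
Qed.

Lemma connect_ind e (P : pred V) x y :
  (forall u v, P u -> e u v -> P v) -> P x -> connect e x y -> P y.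
Proof. exact: (@connect_indP e P). Qed.

Lemma connect_within_mem e S x y : x \in S -> connect (within e S) x y -> y \in S.
Proof. by move=> xS; apply: connect_ind xS => u v _ /and3P[]. Qed.

Lemma connect_closed S T x y :
  (forall u v, u \in T -> v \in S -> adj G u v -> v \in T) ->
  x \in T -> connect (within (adj G) S) x y -> y \in T.
Proof. by move=> H; apply: connect_ind => u v uT /and3P[_ vS /(H _ _ uT vS)]. Qed.

Lemma in_nbh u v : (u \in nbh G v) = adj G v u.
Proof. by rewrite inE. Qed.

Lemma meetsP A B : reflect (exists2 x : V, x \in A & x \in B) (meets A B).
Proof.
apply: (iffP (set0Pn _)) => [[x]|[x xA xB]]; first by rewrite inE => /andP[? ?]; exists x.
by exists x; rewrite inE xA.
Qed.

Lemma meets_nbhP v S : reflect (exists2 u, u \in S & adj G v u) (meets (nbh G v) S).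
Proof.
by apply: (iffP (meetsP _ _)) => -[u H1 H2]; exists u; rewrite ?in_nbh // -in_nbh.
Qed.

Lemma in_nbs S v : (v \in nbs G S) = [exists u in S, adj G u v].
Proof.
have E s A : (v \in foldl (fun B u => if u \in S then B :|: nbh G u else B) A s) =
    (v \in A) || has (fun u => (u \in S) && adj G u v) s.
  elim: s A => [|x s IH] A /=; first by rewrite orbF.
  by rewrite IH; case: (x \in S) => //=; rewrite inE in_nbh orbA.
rewrite /nbs E inE /=; apply/hasP/existsP => -[u]; first by move=> _; exists u.
by exists u => //; rewrite mem_enum.
Qed.

Lemma meets_nbsP S D : reflect (exists x y, [/\ x \in S, y \in D & adj G x y]) (meets (nbs G S) D).
Proof.
apply: (iffP (meetsP _ _)) => [[y]|[x [y [xS yD xy]]]].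
  by rewrite in_nbs => /exists_inP[x xS xy] yD; exists x, y.
by exists y => //; rewrite in_nbs; apply/exists_inP; exists x.
Qed.

(** * Searching a component *)

(** Each vertex of [l] is new and has a neighbour among those found before it, which stand behind
    it. Dropping the head thus leaves a connected set; both the shrinking of [P] and the elimination
    order of the bags rest on this. *)
Fixpoint search_order r (l : seq V) : Prop :=
  if l is x :: l' then
    [/\ x \notin r |: [set y in l'], exists2 y, y \in r |: [set y in l'] & adj G x y
      & search_order r l']
  else True.

Definition grow_inv S r (a : {set V} * seq V) :=
  [/\ r \in a.1, a.1 \subset S, a.1 = r |: [set x in a.2], search_order r a.2
    & forall x, x \in a.1 -> connect (within (adj G) S) r x].

Lemma grow_step_inv S r a v : grow_inv S r a -> grow_inv S r (grow_step G S a v).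
Proof.
rewrite /grow_step; case: and3P => // -[vS va /meets_nbhP[u ua vu]] [ra aS aE ao ac].
have uS := subsetP aS _ ua.
split=> /=.
- by rewrite inE ra orbT.
- by rewrite subUset sub1set vS.
- by rewrite set_cons aE setUCA.
- by split=> //; rewrite -aE //; exists u.
- move=> x; rewrite !inE => /orP[/eqP->|/ac//].
  apply: connect_trans (ac _ ua) (connect1 _).
  by rewrite /within uS vS adj_sym.
Qed.

Lemma grow_pass_inv S r a : grow_inv S r a -> grow_inv S r (grow_pass G S a).
Proof.
by rewrite /grow_pass; elim: (enum V) a => //= v s IH a /(grow_step_inv v) /IH.
Qed.

Definition grow_closed S (a : {set V} * seq V) :=
  [forall v, [&& v \in S, v \notin a.1 & meets (nbh G v) a.1] ==> false].

Lemma grow_step_closed S a v : grow_closed S a -> grow_step G S a v = a.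
Proof. by move/forallP/(_ v); rewrite implybF /grow_step => /negPf->. Qed.

Lemma grow_pass_closed S a : grow_closed S a -> grow_pass G S a = a.
Proof.
rewrite /grow_pass => H; elim: (enum V) => //= v s IH.
by rewrite grow_step_closed.
Qed.

Lemma grow_step_sub S (a : {set V} * seq V) v : a.1 \subset (grow_step G S a v).1.
Proof. by rewrite /grow_step; case: ifP => //= _; exact: subsetUr. Qed.

Lemma grow_steps_sub S s (a : {set V} * seq V) : a.1 \subset (foldl (grow_step G S) a s).1.
Proof.
elim: s a => //= v s IH a; exact: subset_trans (grow_step_sub S a v) (IH _).
Qed.

(** A vertex that can be added at the start of a pass is still addable, or already present, when its
    turn comes, because the set only grows. *)
Lemma grow_pass_open S a : ~~ grow_closed S a -> #|a.1| < #|(grow_pass G S a).1|.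
Proof.
case/forallPn=> v; rewrite implybF negbK => /and3P[vS va vm].
rewrite proper_card // properE grow_steps_sub /=.
apply/subsetPn; exists v => //; rewrite /grow_pass.
have: v \in enum V by rewrite mem_enum.
case/splitPr=> p1 p2; rewrite foldl_cat /=.
set b := foldl _ a p1; apply: (subsetP (grow_steps_sub S p2 _)).
have /subsetP ab : a.1 \subset b.1 by exact: grow_steps_sub.
rewrite /grow_step vS /=; case: (boolP (v \in b.1)) => //= vb.
case: meets_nbhP => [_|[]]; first by rewrite !inE eqxx.
by case/meets_nbhP: vm => u /ab ub vu; exists u.
Qed.

Lemma growE S r : grow G S r = iter #|V| (grow_pass G S) ([set r], [::]).
Proof. by rewrite /grow foldl_iter -cardE. Qed.

Lemma grow_correct S r : r \in S ->
  [/\ (grow G S r).1 = [set x | connect (within (adj G) S) r x],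
      (grow G S r).1 = r |: [set x in (grow G S r).2],
      (grow G S r).1 \subset S & search_order r (grow G S r).2].
Proof.
move=> rS.
have H0 : grow_inv S r ([set r], [::]).
  split=> //=; rewrite ?set11 ?sub1set //; first by rewrite set_nil setU0.
  by move=> x /set1P->.
have: grow_inv S r (grow G S r).
  by rewrite growE; elim: #|V| => //= i; exact: grow_pass_inv.
case=> ra aS aE ao ac; split=> //.
have: grow_closed S (grow G S r).
  rewrite growE; apply: (iter_saturate (P := grow_closed S) (m := fun a : {set V} * seq V => #|a.1|)).
  - by move=> a; exact: max_card.
  - by rewrite cards1.
  - by move=> a Ha; rewrite grow_pass_closed.
  - exact: grow_pass_open.
move/forallP=> cl; apply/eqP; rewrite eqEsubset; apply/andP; split.
  by apply/subsetP=> x /ac; rewrite inE.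
apply/subsetP=> x; rewrite inE; apply: connect_closed ra => u v ua vS uv.
have := cl v; rewrite implybF vS /=; case: (boolP (v \in _)) => //= _.
by case/meets_nbhP; exists u => //; rewrite adj_sym.
Qed.

Lemma mem_grow S r x : r \in S ->
  (x \in (grow G S r).1) = connect (within (adj G) S) r x.
Proof. by case/grow_correct=> -> _ _ _; rewrite inE. Qed.

Lemma grow_sub S r : r \in S -> (grow G S r).1 \subset S.
Proof. by case/grow_correct. Qed.

Lemma grow_root S r : r \in S -> r \in (grow G S r).1.
Proof. by move/mem_grow->; exact: connect0. Qed.

Lemma grow_adj S r u v : r \in S ->
  u \in (grow G S r).1 -> v \in S -> adj G u v -> v \in (grow G S r).1.
Proof.
move=> rS; rewrite !mem_grow // => ru vS uv; apply: (connect_trans ru (connect1 _)).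
apply/and3P; split=> //; exact: connect_within_mem ru.
Qed.

Lemma conn_grow S r : r \in S -> conn (grow G S r).1.
Proof.
move=> rS; set C := (grow G S r).1.
suff H x : x \in C -> connect (within (adj G) C) r x.
  by move=> x y /H rx /H; apply: connect_trans; rewrite connect_withinC.
rewrite mem_grow // => rx.
have: x \in [set y | connect (within (adj G) C) r y]; last by rewrite inE.
apply: connect_closed rx; last by rewrite inE connect0.
move=> u v; rewrite !inE => ru vS uv; apply: (connect_trans ru (connect1 _)).
have uC : u \in C := connect_within_mem (grow_root rS) ru.
by apply/and3P; split=> //; exact: grow_adj uv.
Qed.

Lemma search_order_conn r l : search_order r l -> conn (r |: [set x in l]).
Proof.
elim: l => [_|x l IH [_ [y yl xy] /IH cl]].
  by rewrite set_nil setU0 => x y /set1P-> /set1P->; exact: connect0.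
rewrite set_cons setUCA; set P := r |: _ in yl cl *.
have sP : P \subset x |: P by exact: subsetUr.
have H z : z \in x |: P -> connect (within (adj G) (x |: P)) z y.
  case/setU1P=> [->|zP].
    by apply: connect1; rewrite /within setU11 setU1r ?yl ?xy.
  by apply: connect_within_sub (cl _ _ zP yl).
by move=> u v /H uy /H vy; apply: connect_trans uy _; rewrite connect_withinC.
Qed.

End Connectivity.

(** * Components and blocks *)

Section Blocks.
Variables (V : finType) (G : graph V).
Implicit Types (A B C S T U D P : {set V}) (Us : seq {set V}).

(** Disjointness of the components is recorded as an equation between cardinalities, the form needed
    for counting ranks. *)
Record comps_inv S (a : {set V} * seq {set V}) : Prop := CompsInv {
  comps_inv_sub : a.1 \subset S;
  comps_inv_closed : forall u v, u \in a.1 -> v \in S -> adj G u v -> v \in a.1;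
  comps_inv_card : #|a.1| = \sum_(C <- a.2) #|C|;
  comps_inv_cover : forall x, x \in a.1 -> exists2 C, C \in a.2 & x \in C;
  comps_inv_grow : forall C, C \in a.2 -> exists2 r, r \in S & C = (grow G S r).1 }.

Lemma comps_step_inv S a v : comps_inv S a -> comps_inv S (comps_step G S a v).
Proof.
rewrite /comps_step; case: andP => // -[vS va] [aS ac aE acov ag].
set C := (grow G S v).1.
have CS : C \subset S := grow_sub G vS.
have aC : [disjoint a.1 & C].
  rewrite -setI_eq0; apply: contraNT va => /set0Pn[x]; rewrite inE => /andP[xa xC].
  move: xC; rewrite mem_grow // connect_withinC; apply: connect_closed xa.
  by move=> u w ua wS uw; exact: ac uw.
split=> /=.
- by rewrite subUset aS.
- move=> u w; rewrite !inE => /orP[ua|uC] wS uw; first by rewrite (ac u).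
  by rewrite (grow_adj vS uC) ?orbT.
- by rewrite big_cons cardsU disjoint_setI0 // cards0 subn0 aE addnC.
- move=> x; rewrite inE => /orP[/acov[D Da xD]|xC].
    by exists D; rewrite // inE Da orbT.
  by exists C; rewrite // inE eqxx.
- move=> D; rewrite inE => /orP[/eqP->|/ag//]; by exists v.
Qed.

Lemma comps_correct S :
  [/\ #|S| = \sum_(C <- comps G S) #|C|,
      forall x, x \in S -> exists2 C, C \in comps G S & x \in C
    & forall C, C \in comps G S -> exists2 r, r \in S & C = (grow G S r).1].
Proof.
have H s a : comps_inv S a -> comps_inv S (foldl (comps_step G S) a s) /\
    a.1 \subset (foldl (comps_step G S) a s).1 /\
    forall v, v \in s -> v \in S -> v \in (foldl (comps_step G S) a s).1.
  elim: s a => //= v s IH a /(comps_step_inv v) Ia.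
  have [I1 [I2 I3]] := IH _ Ia; split=> //.
  have sub : a.1 \subset (comps_step G S a v).1.
    by rewrite /comps_step; case: ifP => //= _; exact: subsetUl.
  split; first exact: subset_trans I2.
  move=> u; rewrite inE => /orP[/eqP->|]; last exact: I3.
  move=> vS; apply: (subsetP I2); rewrite /comps_step vS /=.
  by case: ifPn; rewrite ?negbK //= => _; rewrite inE grow_root ?orbT.
have I0 : comps_inv S (set0, [::]).
  split=> //=; rewrite ?sub0set ?cards0 ?big_nil // => x; rewrite ?inE //.
have [[aS ac aE acov ag] [_ all]] := H (enum V) _ I0.
have E : (foldl (comps_step G S) (set0, [::]) (enum V)).1 = S.
  apply/eqP; rewrite eqEsubset aS; apply/subsetP=> v vS.
  by apply: all; rewrite ?mem_enum.
by rewrite E in aE acov; split.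
Qed.

Lemma comps_eq S r r' x : r \in S -> r' \in S ->
  x \in (grow G S r).1 -> x \in (grow G S r').1 -> (grow G S r).1 = (grow G S r').1.
Proof.
move=> rS r'S; rewrite !mem_grow // => rx r'x; apply/setP=> y; rewrite !mem_grow //.
have rr' : connect (within (adj G) S) r r'.
  by apply: connect_trans rx _; rewrite connect_withinC.
apply/idP/idP; last exact: connect_trans.
by apply: connect_trans; rewrite connect_withinC.
Qed.

Lemma size_comps S : size (comps G S) <= #|S|.
Proof.
have [-> _ H] := comps_correct S; rewrite -sum1_size.
rewrite !big_seq; apply: leq_sum => C /H[r rS ->].
by apply/card_gt0P; exists r; exact: grow_root.
Qed.

Definition pieces v U :=
  if v \in U then [seq v |: C | C <- comps G (U :\ v)] else [:: U].

Lemma split_perm Us v : perm_eq (split G Us v) (flatten [seq pieces v U | U <- Us]).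
Proof.
have Ha acc Cs : perm_eq (attach v acc Cs) ([seq v |: C | C <- Cs] ++ acc).
  elim: Cs acc => //= C Cs IH acc; rewrite /attach /= -/(attach v _ _).
  apply: (perm_trans (IH _)).
  by rewrite -cat1s -[(v |: C) :: _]/([:: v |: C] ++ _) perm_catCA.
suff H acc : perm_eq (foldl (split_step G v) acc Us) (flatten [seq pieces v U | U <- Us] ++ acc).
  by have := H [::]; rewrite cats0.
elim: Us acc => //= U Us IH acc; apply: (perm_trans (IH _)).
rewrite -catA perm_sym perm_catCA perm_cat2l perm_sym /split_step /pieces.
by case: (v \in U).
Qed.

Lemma mem_split Us v U' : U' \in split G Us v ->
  exists2 U, U \in Us & if v \in U then
    exists a, a \in U :\ v /\ U' = v |: (grow G (U :\ v) a).1 else U' = U.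
Proof.
rewrite (perm_mem (split_perm Us v)) => /flattenP[s /mapP[U UUs ->]] U's.
exists U => //; move: U's; rewrite /pieces; case: (v \in U); last by rewrite inE => /eqP.
case/mapP=> C; have [_ _ H] := comps_correct (U :\ v).
by case/H=> a aU -> ->; exists a.
Qed.

Lemma split_mem Us v U x : U \in Us -> v \in U -> x \in U :\ v ->
  v |: (grow G (U :\ v) x).1 \in split G Us v.
Proof.
move=> UUs vU xU; rewrite (perm_mem (split_perm Us v)).
apply/flattenP; exists (pieces v U); first exact: map_f.
rewrite /pieces vU; apply: map_f.
have [_ H H'] := comps_correct (U :\ v).
have [C CC xC] := H _ xU; have [r rU E] := H' _ CC.
have := @comps_eq (U :\ v) x r x xU rU (grow_root G xU); rewrite -E => /(_ xC) -> //.
Qed.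

Lemma split_mem_notin Us v U : U \in Us -> v \notin U -> U \in split G Us v.
Proof.
move=> UUs vU; rewrite (perm_mem (split_perm Us v)).
apply/flattenP; exists (pieces v U); first exact: map_f.
by rewrite /pieces (negPf vU) inE.
Qed.

(* A walk leaving a piece can only do so, and come back, through v. *)
Lemma shortcut (e : rel V) U v a x y :
  subrel e (adj G) -> v \in U -> a \in U :\ v ->
  let A := v |: (grow G (U :\ v) a).1 in
  x \in A -> y \in A -> connect (within e U) x y -> connect (within e A) x y.
Proof.
move=> eG vU aU; set C := (grow G _ a).1 => A xA yA.
pose P z := connect (within e A) x (if z \in A then z else v).
have vA : v \in A by rewrite setU11.
suff : connect (within e U) x y -> P y by rewrite /P yA.
apply: (@connect_ind _ _ P); last by rewrite /P xA connect0.
have out u w : u \in A -> w \in U -> w \notin A -> adj G u w -> u = v.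
  move=> uA wU wA uw; case/setU1P: uA => // uC.
  have wv : w != v by apply: contraNneq wA => ->.
  case/negP: wA; apply/setU1P; right; apply: (grow_adj aU uC _ uw).
  by rewrite !inE wU wv.
move=> u w; rewrite /P => Pu /and3P[uU wU uw].
case: (boolP (u \in A)) Pu => uA Pu; case: (boolP (w \in A)) => wA //.
- by apply: connect_trans Pu (connect1 _); rewrite /within uA wA.
- by rewrite -(out u w) // eG.
- by rewrite (out w u) // adj_sym eG.
Qed.

(** The generality in [e] matters: the property is applied to walks inside a witness set, inside a
    class of the quotient, and along edges contained in covers. *)
Definition shortcuts Us := forall U (e : rel V) x y, U \in Us -> subrel e (adj G) ->
  x \in U -> y \in U -> connect e x y -> connect (within e U) x y.

Lemma shortcuts_split Us v : shortcuts Us -> shortcuts (split G Us v).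
Proof.
move=> H U' e x y /mem_split[U UUs]; case: ifP => [vU [a [aU ->]] eG xA yA exy|_ ->]; last exact: H.
have AU : v |: (grow G (U :\ v) a).1 \subset U.
  rewrite subUset sub1set vU; apply: subset_trans (grow_sub G aU) _.
  exact: subD1set.
by apply: shortcut => //; apply: H; rewrite ?(subsetP AU).
Qed.

Lemma shortcuts_blocks vs Us : shortcuts Us -> shortcuts (foldl (split G) Us vs).
Proof. by elim: vs Us => //= v vs IH Us /(@shortcuts_split _ v) /IH. Qed.

Lemma shortcuts_setT : shortcuts [:: setT].
Proof.
move=> U e x y; rewrite inE => /eqP -> _ _ _.
by apply: connect_sub => u w uw; apply: connect1; rewrite /within !inE.
Qed.

(** The vertices [vs] already used for splitting do not separate any piece. Connectivity is asserted
    in the whole graph without [w], not inside the piece, so that smaller pieces inherit it. *)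
Definition uncut (vs : seq V) Us := forall U w x y, U \in Us -> w \in vs -> w \in U ->
  x \in U :\ w -> y \in U :\ w -> connect (within (adj G) (~: [set w])) x y.

Lemma sub_split Us v U' : U' \in split G Us v -> exists2 U, U \in Us & U' \subset U.
Proof.
case/mem_split=> U UUs; case: ifP => [vU [a [aU ->]]|_ ->]; exists U => //.
rewrite subUset sub1set vU; apply: subset_trans (grow_sub G aU) _.
exact: subD1set.
Qed.

Lemma uncut_split vs Us v : uncut vs Us -> uncut (v :: vs) (split G Us v).
Proof.
move=> H U' w x y U's; rewrite inE; case: eqP => [-> _|_ /= wvs].
  move=> vU' xU' yU'; case/mem_split: U's => U UUs; case: ifP => [vU [a [aU E]]|vU E]; last first.
    by rewrite E vU in vU'.
  have sub z : z \in U' :\ v -> z \in (grow G (U :\ v) a).1.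
    by rewrite E !inE => /andP[/negPf->].
  apply: connect_within_sub (conn_grow aU (sub _ xU') (sub _ yU')) => //.
  apply: subset_trans (grow_sub G aU) _.
  by apply/subsetP=> z; rewrite !inE => /andP[].
have [U UUs /subsetP UU'] := sub_split U's.
move=> wU' /setD1P[xw xU'] /setD1P[yw yU'].
by apply: (H U); rewrite ?inE ?xw ?yw ?UU'.
Qed.

Lemma uncut_blocks vs ws Us : uncut ws Us -> uncut (vs ++ ws) (foldl (split G) Us vs).
Proof.
elim: vs ws Us => //= v vs IH ws Us /(@uncut_split _ _ v) /IH H U w x y UU wvs.
by apply: (H U w) => //; move: wvs; rewrite !(inE, mem_cat) orbCA.
Qed.

(** Pieces sharing two vertices coincide, so a block is determined by any of its edges. *)
Definition thin Us := forall U U' x y, U \in Us -> U' \in Us ->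
  x \in U -> x \in U' -> y \in U -> y \in U' -> x != y -> U = U'.

Lemma thin_split Us v : thin Us -> thin (split G Us v).
Proof.
move=> H U1' U2' x y U1s U2s; move: (U1s) (U2s).
case/sub_split=> W1 W1s /subsetP W1U; case/sub_split=> W2 W2s /subsetP W2U.
case/mem_split: U1s => U1 U1s E1; case/mem_split: U2s => U2 U2s E2.
move=> x1 x2 y1 y2 xy.
have sub U U' z : (if v \in U then exists a, a \in U :\ v /\ U' = v |: (grow G (U :\ v) a).1
    else U' = U) -> z \in U' -> z \in U.
  case: ifP => [vU [a [aU ->]]|_ -> //] /setU1P[-> //|].
  by move/(subsetP (grow_sub G aU)) => /setD1P[].
have EU : U1 = U2 by apply: (H _ _ x y); rewrite ?(sub _ _ _ E1) ?(sub _ _ _ E2).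
move: E1 E2; rewrite EU; case: ifP => [vU [a [aU E1]] [b [bU E2]]|_ -> ->//].
have [z [z1 z2 zv]] : exists z, [/\ z \in U1', z \in U2' & z != v].
  case: (eqVneq x v) => xv; last by exists x.
  by exists y; split=> //; rewrite -xv eq_sym.
rewrite E1 E2; congr setU; apply: (@comps_eq (U2 :\ v) a b z) => //.
  by move: z1; rewrite E1 in_setU1 (negPf zv).
by move: z2; rewrite E2 in_setU1 (negPf zv).
Qed.

Lemma thin_blocks vs Us : thin Us -> thin (foldl (split G) Us vs).
Proof. by elim: vs Us => //= v vs IH Us /(@thin_split _ v) /IH. Qed.

Section Cost.
Variables (T : finType) (f : V -> T).

(** The number of identifications that [f] makes within [U]; for [f] onto and [U = setT] it is the
    number of contractions. *)
Definition rank U := #|U| - #|f @: U|.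

Lemma card_bigcup_seq (I : eqType) (s : seq I) (F : I -> {set T}) :
  #|\bigcup_(i <- s) F i| <= \sum_(i <- s) #|F i|.
Proof.
elim: s => [|i s IH]; first by rewrite !big_nil cards0.
rewrite !big_cons cardsU; apply: leq_trans (leq_subr _ _) _.
by rewrite leq_add2l.
Qed.

(** The sizes of the components add up exactly, whereas their images under [f] may overlap. *)
Lemma rank_comps U : \sum_(C <- comps G U) rank C <= rank U.
Proof.
have [E cov grw] := comps_correct U.
have Hc C : #|f @: C| <= #|C| := leq_imset_card f C.
have H1 : \sum_(C <- comps G U) rank C + \sum_(C <- comps G U) #|f @: C| = #|U|.
  by rewrite E -big_split; apply: eq_bigr => C _; rewrite /= subnK.
have H2 : #|f @: U| <= \sum_(C <- comps G U) #|f @: C|.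
  apply: leq_trans (card_bigcup_seq _ _); apply: subset_leq_card.
  apply/subsetP=> t /imsetP[x /cov[C Cc xC] ->].
  by rewrite (big_rem C) //= inE imset_f.
by rewrite /rank in H1 *; lia.
Qed.

(** All pieces share [v], so [v] and its image are left out of the counts; the rest is the argument
    for components. *)
Lemma rank_pieces v U : \sum_(U' <- pieces v U) rank U' <= rank U.
Proof.
rewrite /pieces; case: ifP => vU; last by rewrite big_seq1.
rewrite big_map; have [E cov grw] := comps_correct (U :\ v).
have Cv C : C \in comps G (U :\ v) -> v \notin C.
  case/grw=> r rU ->; apply/negP=> /(subsetP (grow_sub G rU)).
  by rewrite !inE eqxx.
have H1 : \sum_(C <- comps G (U :\ v)) rank (v |: C) +
    \sum_(C <- comps G (U :\ v)) #|(f @: (v |: C)) :\ f v| = #|U|.-1.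
  rewrite (cardsD1 v U) vU /= E -big_split !big_seq; apply: eq_bigr => C /Cv vC.
  have := cardsD1 (f v) (f @: (v |: C)); rewrite imset_f ?setU11 //=.
  have := leq_imset_card f (v |: C); rewrite /rank cardsU1 vC; lia.
have H2 : #|f @: U :\ f v| <= \sum_(C <- comps G (U :\ v)) #|(f @: (v |: C)) :\ f v|.
  apply: leq_trans (card_bigcup_seq _ _); apply: subset_leq_card.
  apply/subsetP=> t /setD1P[tv /imsetP[x xU tx]].
  have xv : x != v by apply: contraNneq tv => <-; rewrite tx.
  have [|C Cc xC] := cov x; first by rewrite !inE xv.
  by rewrite (big_rem C) //= !inE tv tx imset_f // setU1r.
have := cardsD1 (f v) (f @: U); rewrite imset_f //=.
have : 0 < #|U| by apply/card_gt0P; exists v.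
have : rank U = #|U| - #|f @: U| by [].
lia.
Qed.

Lemma rank_split Us v : \sum_(U <- split G Us v) rank U <= \sum_(U <- Us) rank U.
Proof.
rewrite (perm_big _ (split_perm Us v)) big_flatten big_map /=.
by apply: leq_sum => U _; exact: rank_pieces.
Qed.

Lemma rank_blocks vs Us : \sum_(U <- foldl (split G) Us vs) rank U <= \sum_(U <- Us) rank U.
Proof.
elim: vs Us => //= v vs IH Us; exact: leq_trans (IH _) (rank_split _ _).
Qed.

End Cost.

Lemma size_split Us v : (forall U, U \in Us -> 1 < #|U|) ->
  forall U, U \in split G Us v -> 1 < #|U|.
Proof.
move=> H U' /mem_split[U UUs]; case: ifP => [vU [a [aU ->]]|_ ->]; last exact: H.
rewrite cardsU1; set C := (grow G _ a).1.
have -> : v \notin C by apply/negP=> /(subsetP (grow_sub G aU)); rewrite !inE eqxx.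
by rewrite addnC addn1 ltnS; apply/card_gt0P; exists a; exact: grow_root.
Qed.

(** * Quotients without cycles *)

(** The intended [E] is an equivalence with connected classes. A cycle of the quotient through the
    class [D] would give two inequivalent neighbours of [D] that are connected outside [D]; this
    expresses acyclicity without forming the quotient. *)
Definition quotient_acyclic (E : rel V) U := forall d y1 y2,
  let D := [set z | E d z] in
  y1 \in U :\: D -> y2 \in U :\: D ->
  meets (nbh G y1) (D :&: U) -> meets (nbh G y2) (D :&: U) ->
  connect (within (adj G) (U :\: D)) y1 y2 -> E y1 y2.

(** If [v] lies in [D], a walk outside [D] avoids [v] and so stays in one piece. Otherwise the
    neighbours [d1], [d2] are connected within [D], hence without [v], and determine one piece; it
    contains [y1] and [y2], and the walk between them is shortened to it. *)
Lemma quotient_acyclic_split (E : rel V) Us v :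
  (forall d, conn G [set z | E d z]) -> shortcuts Us ->
  (forall U, U \in split G Us v -> quotient_acyclic E U) ->
  forall U, U \in Us -> quotient_acyclic E U.
Proof.
move=> cE sc H U UUs; have [vU|vU] := boolP (v \in U); last first.
  by apply: H; exact: split_mem_notin.
move=> d y1 y2 D y1D y2D /meets_nbhP[d1 /setIP[d1D d1U] a1] /meets_nbhP[d2 /setIP[d2D d2U] a2] y12.
have [y1U y1n] : y1 \in U /\ y1 \notin D by case/setDP: y1D.
have [y2U y2n] : y2 \in U /\ y2 \notin D by case/setDP: y2D.
have [vD|vD] := boolP (v \in D).
  have ne y : y \notin D -> y != v by apply: contraNneq => ->.
  have y1v : y1 \in U :\ v by rewrite !inE ne.
  set C := (grow G (U :\ v) y1).1; pose A := v |: C.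
  have AH : A \in split G Us v by exact: split_mem.
  have UDv : U :\: D \subset U :\ v.
    by apply/subsetP=> z; rewrite in_setD in_setD1 => /andP[/ne -> ->].
  have dA x dx : x \in C -> dx \in U -> adj G x dx -> dx \in A.
    move=> xC dxU a; apply/setU1P; case: (eqVneq dx v); first by left.
    by move=> dv; right; apply: (grow_adj y1v xC) => //; rewrite !inE dv.
  have y1C : y1 \in C by exact: grow_root.
  have y2C : y2 \in C.
    by rewrite mem_grow //; apply: connect_within_sub y12.
  apply: (H A AH d); rewrite -/D ?in_setD ?in_setU1 ?y1n ?y2n ?y1C ?y2C ?orbT //.
  - by apply/meets_nbhP; exists d1 => //; rewrite in_setI d1D (dA y1).
  - by apply/meets_nbhP; exists d2 => //; rewrite in_setI d2D (dA y2).
  pose P z := (z \in C) && connect (within (adj G) (A :\: D)) y1 z.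
  suff /andP[] : P y2 by [].
  apply: connect_ind y12; last by rewrite /P y1C connect0.
  move=> u w /andP[uC cu] /and3P[uD wD uw].
  have wC : w \in C by apply: (grow_adj y1v uC) => //; exact: (subsetP UDv).
  rewrite /P wC; apply: connect_trans cu (connect1 _).
  move: uD wD; rewrite /within !in_setD !in_setU1 => /andP[-> _] /andP[-> _].
  by rewrite uC wC uw !orbT.
have d12 : connect (within (adj G) (U :\ v)) d1 d2.
  have := sc U (within (adj G) D) d1 d2 UUs _ d1U d2U (cE d _ _ d1D d2D).
  have sr : subrel (within (adj G) D) (adj G) by move=> ? ? /and3P[].
  move=> /(_ sr); apply: connect_sub => x y /and3P[xU yU /and3P[xD yD xy]].
  apply: connect1; rewrite /within !inE xU yU xy !andbT.
  by apply/andP; split; apply: contraNneq vD => <-.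
have d1v : d1 \in U :\ v by rewrite !inE d1U andbT; apply: contraNneq vD => <-.
set C := (grow G (U :\ v) d1).1; pose A := v |: C.
have AH : A \in split G Us v by exact: split_mem.
have d1C : d1 \in C by exact: grow_root.
have d2C : d2 \in C by rewrite mem_grow.
have yA y dx : dx \in C -> y \in U -> adj G y dx -> y \in A.
  move=> xC dxU a; apply/setU1P; case: (eqVneq y v); first by left.
  by move=> dv; right; apply: (grow_adj d1v xC); rewrite ?inE ?dv // adj_sym.
have y1A := yA _ _ d1C y1U a1; have y2A := yA _ _ d2C y2U a2.
apply: (H A AH d); rewrite -/D ?in_setD ?y1A ?y2A ?y1n ?y2n //.
- by apply/meets_nbhP; exists d1 => //; rewrite in_setI in_setU1 d1C orbT d1D.
- by apply/meets_nbhP; exists d2 => //; rewrite in_setI in_setU1 d2C orbT d2D.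
pose e := within (adj G) (~: D).
have eG : subrel e (adj G) by move=> ? ? /and3P[].
have : connect (within e U) y1 y2.
  apply: connect_sub y12 => x y /and3P[/setDP[xU xD] /setDP[yU yD] xy].
  by apply: connect1; rewrite /within xU yU /e /within !in_setC xD yD.
move/(shortcut eG vU d1v y1A y2A); apply: connect_sub => x y /and3P[xA yA'].
case/and3P; rewrite !in_setC => xD yD xy; apply: connect1.
by rewrite /within !in_setD xA yA' xD yD.
Qed.

Lemma quotient_acyclic_blocks (E : rel V) vs Us :
  (forall d, conn G [set z | E d z]) -> shortcuts Us ->
  (forall U, U \in foldl (split G) Us vs -> quotient_acyclic E U) ->
  forall U, U \in Us -> quotient_acyclic E U.
Proof.
move=> cE; elim: vs Us => //= v vs IH Us sc H.
apply: (quotient_acyclic_split (v := v)) => //; apply: IH => //.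
exact: shortcuts_split.
Qed.

End Blocks.

(** * Connected vertex covers *)

Section ConnectedCover.
Variables (V : finType) (G : graph V).
Implicit Types (A B C F O P Q R S T U W X Z : {set V}).

Definition indep S := forall u v, u \in S -> v \in S -> ~~ adj G u v.

(** Covering the edges inside [X] is expressed by independence of the complement. The empty cover is
    allowed. *)
Record cover X Q Z : Prop := Cover {
  cover_req : Q \subset Z;
  cover_sub : Z \subset X;
  cover_conn : conn G Z;
  cover_indep : indep (X :\: Z) }.

Lemma cover_weaken X Q Q' Z : Q' \subset Q -> cover X Q Z -> cover X Q' Z.
Proof. by move=> QQ [QZ ? ? ?]; split=> //; exact: subset_trans QZ. Qed.

Lemma conn_setU r S T : r \in S -> r \in T -> conn G S -> conn G T -> conn G (S :|: T).
Proof.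
move=> rS rT cS cT.
have H x : x \in S :|: T -> connect (within (adj G) (S :|: T)) r x.
  case/setUP=> xx.
    by apply: connect_within_sub (cS _ _ rS xx); rewrite ?subsetUl.
  by apply: connect_within_sub (cT _ _ rT xx); rewrite ?subsetUr.
by move=> x y /H rx /H; apply: connect_trans; rewrite connect_withinC.
Qed.

Lemma conn_exit S T r z : conn G S -> T \subset S -> r \in T -> z \in S -> z \notin T ->
  exists x y, [/\ x \in T, y \in S, y \notin T & adj G x y].
Proof.
move=> cS TS rT zS zT.
case: (boolP [exists x, [exists y, [&& x \in T, y \in S, y \notin T & adj G x y]]]).
  by case/existsP=> x /existsP[y /and4P[? ? ? ?]]; exists x, y.
move/existsPn=> H; case/negP: zT.
apply: (connect_closed _ rT (cS _ _ (subsetP TS _ rT) zS)) => u v uT vS uv.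
have /existsPn/(_ v) := H u.
by rewrite uT vS uv andbT /= negbK.
Qed.

(** * The number of states of a compression *)

Section Keys.
Variables (P Z : {set V}) (r : V).
Hypotheses (rP : r \in P) (PZ : P \subset Z) (cZ : conn G Z).

(** A superset of the keys that can occur, described by [P], [Z] and the graph alone; the count uses
    just these closure properties and knows nothing of the search. *)
Definition keys : {set state V} := [set st : {set V} * {set V} |
  [&& st.1 \subset Z :\: P, P \subset st.2, st.2 \subset Z :\: st.1,
      [forall u in st.1, forall v in st.1, ~~ adj G u v] &
      [forall u in st.2, forall v in Z :\: st.1, adj G u v ==> (v \in st.2)]]].

Let trace Z' (st : state V) : state V := (st.1 :&: Z', st.2 :&: Z').

(* Grow [Z'] from [P] to [Z] along edges p z.  Given the trace of a state
   [(O, T)] on [Z'], one bit determines it at z: if p is in [O], then z is not,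
   and the bit tells whether z is in [T]; otherwise it tells whether z is in
   [O], and if not, then z is in [T] exactly when p is. *)
Lemma card_keys : #|keys| <= 2 ^ #|Z :\: P|.
Proof.
pose good Z' := #|trace Z' @: keys| <= 2 ^ #|Z' :\: P|.
have step Z' : P \subset Z' -> Z' \proper Z -> good Z' ->
    exists2 z, z \in Z :\: Z' & good (z |: Z').
  move=> PZ' /properP[Z'Z [z0 z0Z z0Z']] gZ'.
  have [p [z [pZ' zZ zZ' pz]]] := conn_exit cZ Z'Z (subsetP PZ' _ rP) z0Z z0Z'.
  exists z; first by rewrite inE zZ'.
  pose g (st : state V) := (trace Z' st, if p \in st.1 then z \in st.2 else z \in st.1).
  have sI A : A :&: (z |: Z') :&: Z' = A :&: Z'.
    by rewrite -setIA; congr setI; apply/setIidPr; exact: subsetUr.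
  have subst st : st \in trace (z |: Z') @: keys -> g st \in setX (trace Z' @: keys) [set: bool].
    case/imsetP=> s sK ->; rewrite inE /= inE andbT; apply/imsetP; exists s => //.
    by rewrite /trace /= !sI.
  have inj : {in trace (z |: Z') @: keys &, injective g}.
    move=> _ _ /imsetP[[O1 T1] K1 ->] /imsetP[[O2 T2] K2 ->].
    have pI A : (p \in A :&: (z |: Z')) = (p \in A) by rewrite !inE pZ' orbT andbT.
    have zI A : (z \in A :&: (z |: Z')) = (z \in A) by rewrite !inE eqxx andbT.
    rewrite /g /trace /= !sI !pI !zI => -[EO ET].
    have pO : (p \in O1) = (p \in O2) by have /setP/(_ p) := EO; rewrite !inE pZ' !andbT.
    have pT : (p \in T1) = (p \in T2) by have /setP/(_ p) := ET; rewrite !inE pZ' !andbT.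
    have key O T : (O, T) \in keys ->
       (p \in O -> z \notin O) /\ (p \notin O -> (z \in T) = (z \notin O) && (p \in T)).
      rewrite inE /= => /and5P[OZ PT TZ iO cT]; split.
        move=> pO'; apply/negP => zO'.
        by have /forall_inP/(_ _ pO')/forall_inP/(_ _ zO') := iO; rewrite pz.
      move=> pO'; apply/idP/andP => [zT|[zO' pT']].
        have := subsetP TZ _ zT; rewrite inE => /andP[zO' _]; split=> //.
        have /forall_inP/(_ _ zT)/forall_inP/(_ p) := cT.
        rewrite inE pO' (subsetP Z'Z) // => /(_ isT).
        by rewrite adj_sym pz.
      have /forall_inP/(_ _ pT')/forall_inP/(_ z) := cT.
      by rewrite inE zO' zZ pz => /(_ isT).
    have [k1 k1'] := key _ _ K1; have [k2 k2'] := key _ _ K2 => bit.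
    have [zO zT] : (z \in O1) = (z \in O2) /\ (z \in T1) = (z \in T2).
      move: bit; rewrite -pO; case: (boolP (p \in O1)) => pO1.
        by move=> ->; rewrite (negPf (k1 pO1)) (negPf (k2 _)) // -pO.
      by move=> E; rewrite k1' // k2' -?pO // E pT.
    have ext A1 A2 : A1 :&: Z' = A2 :&: Z' -> (z \in A1) = (z \in A2) ->
        A1 :&: (z |: Z') = A2 :&: (z |: Z').
      move=> E Ez; apply/setP=> x; move/setP/(_ x): E; rewrite !inE.
      by case: eqP => [->|_] //; rewrite !andbT.
    by congr pair; apply: ext.
  rewrite /good -(card_in_imset inj).
  have -> : (z |: Z') :\: P = z |: (Z' :\: P).
    apply/setP=> x; rewrite !inE; case: eqP => [->|] //=.
    by rewrite andbT; apply: contra zZ'; exact: (subsetP PZ').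
  rewrite cardsU1 !inE (negPf zZ') andbF expnD expn1.
  apply: (@leq_trans #|setX (trace Z' @: keys) [set: bool]|).
    by apply: subset_leq_card; apply/subsetP=> _ /imsetP[st /subst ? ->].
  by rewrite cardsX cardsT card_bool mulnC leq_mul2l; apply/orP; right.
have base : good P.
  rewrite /good setDv cards0 expn0; apply: (@leq_trans #|[set (set0, P) : state V]|); last by rewrite cards1.
  apply: subset_leq_card; apply/subsetP=> _ /imsetP[[O T] K ->].
  move: K; rewrite [_ \in keys]inE /= => /and5P[OZ PT _ _ _]; rewrite inE /trace /=; apply/eqP; congr pair.
    apply/eqP; rewrite -subset0; apply/subsetP=> x; rewrite inE => /andP[/(subsetP OZ)].
    by rewrite inE => /andP[/negPf->].
  by apply/setIidPr.
have main m Z' : #|Z :\: Z'| = m -> P \subset Z' -> Z' \subset Z -> good Z' -> good Z.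
  elim: m Z' => [|m IH] Z' Em PZ' Z'Z gZ'.
    suff -> : Z = Z' by [].
    by apply/eqP; rewrite eqEsubset Z'Z andbT -setD_eq0 -cards_eq0 Em.
  have pZ : Z' \proper Z by rewrite properE Z'Z -setD_eq0 -cards_eq0 Em.
  have [z zD gz] := step _ PZ' pZ gZ'.
  apply: (IH (z |: Z')) => //.
  - by move: Em; rewrite (cardsD1 z) zD => -[<-]; rewrite setDDl setUC.
  - by apply: subset_trans PZ' (subsetUr _ _).
  by rewrite subUset sub1set Z'Z andbT; case/setDP: zD.
have gZ : good Z by exact: main base.
apply: leq_trans gZ; rewrite (card_in_imset (f := trace Z)) //.
move=> [O1 T1] [O2 T2] K1 K2 [].
have idZ O T : (O, T) \in keys -> O :&: Z = O /\ T :&: Z = T.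
  rewrite inE /= => /and5P[OZ PT TZ _ _]; split; apply/setIidPl.
    by apply: subset_trans OZ (subsetDl _ _).
  by apply: subset_trans TZ (subsetDl _ _).
by case: (idZ _ _ K1) => -> ->; case: (idZ _ _ K2) => -> -> -> ->.
Qed.

End Keys.

(** * Compression of a connected vertex cover *)

Lemma outs_addE z acc (L : seq {set V}) : foldl (outs_add G z) acc L =
  rev [seq z |: A | A <- L & ~~ meets (nbh G z) A] ++ acc.
Proof.
elim: L acc => //= O L IH acc; rewrite IH /outs_add.
by case: (meets _ O) => //=; rewrite rev_cons cat_rcons.
Qed.

(** [xs] are the vertices still to be processed; [L] holds exactly the independent sets that avoid
    them. *)
Record outs_inv Z Q (xs : seq V) (L : seq {set V}) : Prop := OutsInv {
  outs_uniq : uniq L;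
  outs_sound : forall O, O \in L ->
    [/\ O \subset Z :\: Q, indep O & forall x, x \in xs -> x \notin O];
  outs_complete : forall O, O \subset Z :\: Q -> indep O ->
    (forall x, x \in xs -> x \notin O) -> O \in L }.

Lemma outs_step_inv Z Q x xs L : x \notin xs ->
  outs_inv Z Q (x :: xs) L -> outs_inv Z Q xs (outs_step G Z Q L x).
Proof.
move=> xxs [uL sL cL]; rewrite /outs_step; case: ifP => xZ; last first.
  split=> // O.
    by case/sL=> ? ? H; split=> // y yx; apply: H; rewrite inE yx orbT.
  move=> OZ iO H; apply: cL => // y; rewrite inE => /orP[/eqP->|/H//].
  by apply/negP=> /(subsetP OZ); rewrite xZ.
rewrite outs_addE; split.
- rewrite cat_uniq rev_uniq uL andbT map_inj_in_uniq ?filter_uniq //=.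
    apply/hasPn=> O /sL[_ _ /(_ x)]; rewrite inE eqxx => /(_ isT) xO.
    by rewrite mem_rev; apply: contra xO => /mapP[O' _ ->]; exact: setU11.
  move=> O O'; rewrite !mem_filter => /andP[_ /sL[_ _ /(_ x)]]; rewrite inE eqxx => /(_ isT) xO.
  move=> /andP[_ /sL[_ _ /(_ x)]]; rewrite inE eqxx => /(_ isT) xO' E.
  by rewrite -(setU1K xO) E setU1K.
- move=> O; rewrite mem_cat mem_rev => /orP[/mapP[O' + ->]|/sL[? ? H]]; last first.
    by split=> // y yx; apply: H; rewrite inE yx orbT.
  rewrite mem_filter => /andP[nO' /sL[OZ iO HO]].
  have nx v : v \in O' -> ~~ adj G x v.
    by move=> vO; apply: contra nO' => xv; apply/meets_nbhP; exists v.
  split; first by rewrite subUset sub1set xZ.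
    move=> u v; rewrite !in_setU1 => /orP[/eqP->|uO] /orP[/eqP->|vO].
    - by rewrite adj_irr.
    - exact: nx.
    - by rewrite adj_sym nx.
    exact: iO.
  move=> y yx; rewrite in_setU1 negb_or HO ?inE ?yx ?orbT // andbT.
  by apply: contraNneq xxs => <-.
move=> O OZ iO H; rewrite mem_cat mem_rev; have [xO|xO] := boolP (x \in O).
  apply/orP; left; apply/mapP; exists (O :\ x); last by rewrite setD1K.
  rewrite mem_filter; apply/andP; split.
    apply/negP=> /meets_nbhP[u /setD1P[_ uO] xu].
    by have := iO _ _ xO uO; rewrite xu.
  apply: cL.
  - by apply: subset_trans OZ; exact: subD1set.
  - by move=> u v /setD1P[_ uO] /setD1P[_ vO]; exact: iO.
  move=> y; rewrite inE => /orP[/eqP->|/H]; first by rewrite !inE eqxx.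
  by apply: contra => /setD1P[].
apply/orP; right; apply: cL => // y; rewrite inE => /orP[/eqP->//|]; exact: H.
Qed.

Lemma outs_steps_inv Z Q xs L : uniq xs ->
  outs_inv Z Q xs L -> outs_inv Z Q [::] (foldl (outs_step G Z Q) L xs).
Proof. by elim: xs L => //= x xs IH L /andP[xxs /IH H] /(outs_step_inv xxs) /H. Qed.

Lemma outs_inv0 Z Q : outs_inv Z Q (enum V) [:: set0].
Proof.
split=> // O.
  rewrite inE => /eqP->; split; rewrite ?sub0set //; first by move=> ? ?; rewrite inE.
  by move=> x _; rewrite inE.
move=> _ _ H; rewrite inE; apply/eqP/setP=> x; rewrite inE; apply: negPf.
by apply: H; rewrite mem_enum.
Qed.

Lemma outs_correct Z Q : outs_inv Z Q [::] (outs G Z Q).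
Proof. by apply: outs_steps_inv; [exact: enum_uniq|exact: outs_inv0]. Qed.

Lemma size_outs Z Q xs L : outs_inv Z Q xs L -> size L <= 2 ^ #|Z :\: Q|.
Proof.
case=> uL sL _; rewrite -card_powerset -(card_uniqP uL).
by apply: subset_leq_card; apply/subsetP=> O /sL[]; rewrite inE.
Qed.

Section Compress.
Variables (X Q Z : {set V}) (r : V).
Hypotheses (rQ : r \in Q) (cov : cover X Q Z).

Notation F := (forced G X Z Q).

(** The chosen vertices are forgotten: [st.2] is only known to be connected, to contain the root and
    to absorb every forced vertex adjacent to it. *)
Record valid (st : state V) : Prop := Valid {
  valid_outs : st.1 \subset Z :\: Q;
  valid_indep : indep st.1;
  valid_root : r \in st.2;
  valid_sub : st.2 \subset X :\: st.1;
  valid_conn : conn G st.2;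
  valid_closed : forall u v, u \in st.2 -> v \in F st.1 -> adj G u v -> v \in st.2 }.

Let QZ := cover_req cov.
Let ZX := cover_sub cov.

Lemma forcedP O v : reflect
  [\/ v \in Z /\ v \notin O, v \in X /\ (exists2 u, u \in O & adj G u v) | v \in Q]
  (v \in F O).
Proof.
rewrite /forced !inE in_nbs; apply: (iffP idP).
  case/orP=> [/orP[/andP[? ?]|/andP[/exists_inP[u ? ?] ?]]|?];
    [constructor 1|constructor 2|constructor 3] => //; split=> //.
  by exists u.
case=> [[-> ->]|[-> [u uO uv]]|->]; rewrite ?orbT //.
have -> : [exists u in O, adj G u v] by apply/exists_inP; exists u.
by rewrite orbT.
Qed.

Lemma forced_sub O : O \subset Z :\: Q -> indep O -> F O \subset X :\: O.
Proof.
move=> OZ iO; apply/subsetP=> v /forcedP[[vZ vO]|[vX [u uO uv]]|vQ]; rewrite inE.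
- by rewrite vO (subsetP ZX).
- by rewrite vX andbT; apply/negP=> vO; have := iO _ _ uO vO; rewrite uv.
rewrite (subsetP ZX) ?(subsetP QZ) // andbT; apply/negP=> /(subsetP OZ).
by rewrite inE vQ.
Qed.

Lemma valid_grow O S : O \subset Z :\: Q -> indep O -> F O \subset S ->
  S \subset X :\: O -> valid (O, (grow G S r).1).
Proof.
move=> OZ iO FS SX.
have rS : r \in S by apply: (subsetP FS); apply/forcedP; constructor 3.
split=> //=.
- exact: grow_root.
- exact: subset_trans (grow_sub G rS) SX.
- exact: conn_grow.
by move=> u v ru vF; apply: grow_adj => //; exact: (subsetP FS).
Qed.

(** The bound [i] on the vertices that are not forced turns the round in which a state appears into
    a bound on its size; the comparison with the optimal cover rests on it. *)
Definition layer i (acc : seq (state V)) :=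
  uniq (map (key Z) acc) /\
  forall st, st \in acc -> valid st /\ #|st.2 :\: F st.1| <= i.

Lemma layer_insert i acc st : layer i acc -> valid st -> #|st.2 :\: F st.1| <= i ->
  layer i (insert Z acc st).
Proof.
move=> [u H] v c; rewrite /insert; case: ifPn => // nk; split=> /=; first by rewrite nk.
by move=> st'; rewrite inE => /orP[/eqP->|/H].
Qed.

Lemma layerS i acc : layer i acc -> layer i.+1 acc.
Proof. by move=> [u H]; split=> // st /H[? ?]; split=> //; exact: leqW. Qed.

Lemma mem_insert acc st s : s \in acc -> s \in insert Z acc st.
Proof. by rewrite /insert; case: ifP => // _ H; rewrite inE H orbT. Qed.

Lemma insert_key acc st : exists2 R, (st.1, R) \in insert Z acc st & R :&: Z = st.2 :&: Z.
Proof.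
rewrite /insert; case: ifP => [/mapP[[O R] H []]|_]; first by rewrite /= => -> ->; exists R.
by exists st.2 => //; rewrite inE -surjective_pairing eqxx.
Qed.

Lemma init_layer (L : seq {set V}) acc :
  (forall O, O \in L -> O \subset Z :\: Q /\ indep O) -> layer 0 acc ->
  layer 0 (foldl (fun acc O => insert Z acc (O, (grow G (F O) r).1)) acc L).
Proof.
elim: L acc => //= O L IH acc HL lacc; apply: IH.
  by move=> O' H; apply: HL; rewrite inE H orbT.
have [OZ iO] := HL O (mem_head _ _).
apply: layer_insert => //; first by apply: valid_grow => //; exact: forced_sub.
rewrite /= leqn0 cards_eq0 setD_eq0; apply: grow_sub.
by apply/forcedP; constructor 3.
Qed.

Lemma layer_init : layer 0 (init_states G X Q r Z).
Proof.
apply: init_layer => // O; by case: (outs_correct Z Q) => _ H _ /H[].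
Qed.

Definition child (st : state V) v : state V :=
  (st.1, (grow G (v |: (F st.1 :|: st.2)) r).1).

Definition admissible (st : state V) v :=
  [&& v \in X :\: st.1, v \notin st.2 & meets (nbh G v) st.2].

Lemma explore_stepE st acc v : explore_step G X Q r Z st acc v =
  if admissible st v then insert Z acc (child st v) else acc.
Proof. by []. Qed.

Lemma root_child st v : r \in v |: (F st.1 :|: st.2).
Proof. by apply/setU1P; right; apply/setUP; left; apply/forcedP; constructor 3. Qed.

Lemma valid_child i st v : valid st -> #|st.2 :\: F st.1| <= i ->
  admissible st v -> valid (child st v) /\ #|(child st v).2 :\: F st.1| <= i.+1.
Proof.
move=> [OZ iO rR RX cR clR] ci /and3P[vX vR mv]; split.
  apply: valid_grow => //.
    by apply: subset_trans (subsetUl _ st.2) (subsetUr _ _).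
  by rewrite subUset sub1set vX /= subUset RX andbT; exact: forced_sub.
apply: (@leq_trans #|v |: (st.2 :\: F st.1)|); last first.
  by rewrite cardsU1; apply: (@leq_trans #|st.2 :\: F st.1|.+1); rewrite ?ltnS // -add1n leq_add2r leq_b1.
apply: subset_leq_card; apply/subsetP=> x; rewrite in_setD => /andP[xF].
move/(subsetP (grow_sub G (root_child st v))).
case/setU1P=> [->|/setUP[H|xR]]; first exact: setU11.
  by rewrite H in xF.
by apply/setU1P; right; rewrite in_setD xF.
Qed.

Lemma explore_state_layer i st acc s : valid st -> #|st.2 :\: F st.1| <= i ->
  layer i.+1 acc -> layer i.+1 (foldl (explore_step G X Q r Z st) acc s).
Proof.
move=> vst ci; elim: s acc => //= v s IH acc H; apply: IH; rewrite explore_stepE.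
by case: ifP => // adm; apply: layer_insert; case: (valid_child vst ci adm).
Qed.

Lemma explore_states_layer i acc L : layer i L -> layer i.+1 acc ->
  layer i.+1 (foldl (explore_state G X Q r Z) acc L).
Proof.
case=> _; elim: L acc => //= st L IH acc HL H; apply: IH.
  by move=> s Hs; apply: HL; rewrite inE Hs orbT.
by have [] := HL st (mem_head _ _) => ? ?; exact: explore_state_layer.
Qed.

Lemma layer_explore i acc : layer i acc -> layer i.+1 (explore G X Q r Z acc).
Proof. by move=> H; apply: explore_states_layer => //; exact: layerS. Qed.

Lemma mem_explore_steps st acc s x :
  x \in acc -> x \in foldl (explore_step G X Q r Z st) acc s.
Proof.
elim: s acc => //= v s IH acc H; apply: IH; rewrite explore_stepE.
by case: ifP => // _; exact: mem_insert.
Qed.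

Lemma mem_explore_states acc L x :
  x \in acc -> x \in foldl (explore_state G X Q r Z) acc L.
Proof. by elim: L acc => //= st L IH acc H; apply: IH; exact: mem_explore_steps. Qed.

Lemma explore_child acc st v : st \in acc -> admissible st v ->
  exists2 R, (st.1, R) \in explore G X Q r Z acc & R :&: Z = (child st v).2 :&: Z.
Proof.
move=> + adm; rewrite /explore; suff H L b : st \in L ->
    exists2 R, (st.1, R) \in foldl (explore_state G X Q r Z) b L
      & R :&: Z = (child st v).2 :&: Z by exact: H.
elim: L b => //= s L IH b; rewrite inE => /orP[/eqP<-|/IH//].
have [R HR ER] : exists2 R, (st.1, R) \in explore_state G X Q r Z b st
    & R :&: Z = (child st v).2 :&: Z.
  have: v \in enum V by rewrite mem_enum.
  rewrite /explore_state; case/splitPr=> p1 p2; rewrite foldl_cat /= explore_stepE adm.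
  set c := foldl _ _ p1; have [R HR ER] := insert_key c (child st v).
  by exists R => //; exact: mem_explore_steps.
by exists R => //; exact: mem_explore_states.
Qed.

Definition layers i := iter i (explore G X Q r Z) (init_states G X Q r Z).

Lemma layer_layers i : layer i (layers i).
Proof. by elim: i => [|i IH]; [exact: layer_init|exact: layer_explore]. Qed.

Lemma layers_mono i j : i <= j -> {subset layers i <= layers j}.
Proof.
move=> /subnK <-; elim: (j - i) => // m IH x /IH H.
by rewrite addSn /layers iterS; exact: mem_explore_states.
Qed.

(** Once all forced vertices are reached, a vertex of [X] outside [st.2] is either left out from [Z]
    or outside [Z]. Neighbours of the former are forced, hence covered; the latter are independent
    because [Z] is a cover. *)
Lemma valid_cover st : valid st -> F st.1 \subset st.2 -> cover X Q st.2.
Proof.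
case=> OZ iO rR RX cR clR /subsetP FR; split=> //.
- by apply/subsetP=> x xQ; apply: FR; apply/forcedP; constructor 3.
- by apply: subset_trans RX (subsetDl _ _).
have H x : x \in X :\: st.2 -> x \in st.1 \/ x \in X :\: Z.
  rewrite !inE => /andP[xR ->]; case: (boolP (x \in Z)) => xZ; last by right.
  left; apply: contraNT xR => xO; apply: FR; apply/forcedP; by constructor 1.
have nO x y : x \in st.1 -> y \in X :\: st.2 -> ~~ adj G x y.
  move=> xO; rewrite inE => /andP[yR yX]; apply: contra yR => xy.
  by apply: FR; apply/forcedP; constructor 2; split=> //; exists x.
move=> u v uX vX; have [uO|uZ] := H _ uX; first exact: nO.
have [vO|vZ] := H _ vX; first by rewrite adj_sym nO.
by apply: (cover_indep cov).
Qed.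

Section Optimal.
Variable W : {set V}.
Hypothesis covW : cover X Q W.

Let O := Z :\: W.

Lemma optimal_outs : O \subset Z :\: Q /\ indep O.
Proof.
split; first by apply: setDS; exact: cover_req covW.
move=> u v /setDP[uZ uW] /setDP[vZ vW].
by apply: (cover_indep covW); rewrite inE ?uW ?vW (subsetP ZX).
Qed.

Lemma optimal_forced : F O \subset W.
Proof.
apply/subsetP=> v /forcedP[[vZ]|[vX [u /setDP[uZ uW] uv]]|]; last first.
- exact: (subsetP (cover_req covW)).
- apply: contraLR uv => vW; apply: (cover_indep covW); rewrite inE.
    by rewrite uW (subsetP ZX).
  by rewrite vW.
by rewrite inE vZ andbT negbK.
Qed.

(* [S] is built from the forced vertices by adding vertices of the optimal cover
   [W] outside [Z], each adjacent to the component of the root, while [R] is the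
   component of some state with the same or more vertices of [Z]. *)
Lemma optimal_extend S R : r \in W ->
  F O \subset S -> S \subset W -> S :\: F O \subset (grow G S r).1 ->
  (grow G S r).1 :&: Z \subset R -> (O, R) \in layers #|S :\: F O| ->
  exists R', (O, R') \in layers #|W :\: F O| /\ W :&: Z \subset R'.
Proof.
move=> rW; have [m] := ubnP #|W :\: S|; elim: m S R => // m IH S R ltm FS SW SF SR OR.
have rS : r \in S by apply: (subsetP FS); apply/forcedP; constructor 3.
set C := (grow G S r).1 in SF SR.
have CS : C \subset S := grow_sub G rS.
have [WC|/subsetPn[z zW zC]] := boolP (W \subset C).
  have E : S = W.
    by apply/eqP; rewrite eqEsubset SW; exact: subset_trans WC CS.
  exists R; rewrite -[in #|_|]E; split=> //; apply: subset_trans SR.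
  exact: setSI.
have [c [w [cC wW wC cw]]] :=
  conn_exit (cover_conn covW) (subset_trans CS SW) (grow_root G rS) zW zC.
have wS : w \notin S by apply: contra wC => wS; exact: (grow_adj rS cC wS cw).
have wF : w \notin F O by apply: contra wS => /(subsetP FS).
have WX x : x \in W -> x \in X by exact: (subsetP (cover_sub covW)).
have WZ x : x \in W -> x \in Z -> x \in F O.
  by move=> xW xZ; apply/forcedP; constructor 1; rewrite inE xW.
have wZ : w \notin Z by apply: contra wF => wZ; exact: WZ.
have cross x y : x \in W -> y \in W -> adj G x y -> x \notin Z -> y \in Z.
  move=> xW yW xy xZ; apply: contraLR xy => yZ.
  by apply: (cover_indep cov); rewrite inE ?xZ ?yZ WX.
have cW : c \in W by apply: (subsetP SW); apply: (subsetP CS).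
have cZ : c \in Z by apply: (cross w) => //; rewrite adj_sym.
have cR : c \in R by apply: (subsetP SR); rewrite inE cC.
have [vR _] := (layer_layers #|S :\: F O|).2 _ OR.
set S' := w |: S.
have S'W : S' \subset W by rewrite subUset sub1set wW.
(* If [w] is already in [R], no new state is needed; otherwise the child for [w] is inserted. As
   only its key is sure to be stored, nothing is claimed about [w] itself, only about its neighbours
   in [Z :\: O]. *)
have [R1 [lR1 RR1 wR1]] : exists R1, [/\ (O, R1) \in layers #|S :\: F O|.+1,
    (R :&: Z) \subset R1 & (forall y, y \in Z :\: O -> adj G w y -> y \in R1)].
  have [wR|wR] := boolP (w \in R).
    exists R; split; first by apply: layers_mono OR.
      exact: subsetIl.
    move=> y /setDP[yZ yO] wy; apply: (valid_closed vR) wR _ wy => /=.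
    by apply/forcedP; constructor 1.
  have adm : admissible (O, R) w.
    rewrite /admissible wR !inE WX //= wW /=; apply/meets_nbhP; exists c => //.
    by rewrite adj_sym.
  have [R1 H1 E1] := explore_child OR adm.
  have inR1 y : y \in (child (O, R) w).2 -> y \in Z -> y \in R1.
    by move=> yc yZ; have /setP/(_ y) := E1; rewrite !inE yc yZ !andbT.
  have rt := root_child (O, R) w.
  have RC y : y \in R -> y \in (child (O, R) w).2.
    move=> yR; rewrite mem_grow //.
    apply: connect_within_sub (valid_conn vR (valid_root vR) yR) => //.
    by apply/subsetP=> ? ?; rewrite !inE orbC; apply/orP; left; apply/orP; right.
  have wC' : w \in (child (O, R) w).2.
    by apply: (grow_adj rt (RC _ cR)) cw; exact: setU11.
  exists R1; split=> //.
    by apply/subsetP=> y /setIP[/RC ? ?]; exact: inR1.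
  move=> y /setDP[yZ yO] wy; apply: inR1 => //; apply: (grow_adj rt wC') wy.
  by apply/setU1P; right; apply/setUP; left; apply/forcedP; constructor 1.
have [vR1 _] := (layer_layers _).2 _ lR1.
have SF' : S' :\: F O = w |: (S :\: F O).
  by apply/setP=> x; rewrite in_setD !in_setU1 in_setD; case: eqP => [->|//]; rewrite wF.
have cS' : #|S' :\: F O| = #|S :\: F O|.+1.
  by rewrite SF' cardsU1 in_setD (negPf wS) andbF.
have rS' : r \in S' by rewrite inE rS orbT.
have CC' x : x \in C -> x \in (grow G S' r).1.
  rewrite !mem_grow //; apply: connect_within_sub => //; exact: subsetUr.
apply: (IH S' R1) => //.
- rewrite -ltnS; apply: leq_trans ltm; rewrite ltnS; apply: proper_card; rewrite properE.
  rewrite setDS ?subsetUr //=; apply/subsetPn; exists w; rewrite !inE ?wS ?wW //.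
  by rewrite eqxx.
- by apply: subset_trans FS (subsetUr _ _).
- rewrite SF' subUset sub1set; apply/andP; split.
    by apply: (grow_adj rS' (CC' _ cC)) cw; exact: setU11.
  by apply/subsetP=> x /(subsetP SF); exact: CC'.
(* [R1] may contain other vertices outside [Z] than [S'] does. Along a walk from the root, a vertex
   of [Z] is shown to lie in [R1], and of a vertex outside [Z] only that its neighbours in [Z :\: O]
   do. *)
- pose P y := if y \in Z then y \in R1
    else [forall y' in Z :\: O, adj G y y' ==> (y' \in R1)].
  have rZ : r \in Z := subsetP QZ _ rQ.
  have HP y : connect (within (adj G) S') r y -> P y.
    apply: (@connect_ind _ _ P); last by rewrite /P rZ (valid_root vR1).
    move=> u v Pu /and3P[uS' vS' uv].
    have uW := subsetP S'W _ uS'; have vW := subsetP S'W _ vS'.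
    rewrite /P in Pu *; case: (boolP (v \in Z)) => vZ; case: (boolP (u \in Z)) Pu => uZ Pu.
    - by apply: (valid_closed vR1) Pu _ uv => /=; exact: WZ.
    - have /forall_inP/(_ v) := Pu; rewrite !inE vZ vW /= uv; exact.
    - apply/forall_inP=> x xZ; apply/implyP=> vy.
      case/setU1P: (vS') => [E|vS]; first by apply: wR1; rewrite -?E.
      have [vF|vF] := boolP (v \in F O).
        apply: (valid_closed vR1) (valid_closed vR1 Pu vF uv) _ vy => /=.
        by case/setDP: xZ => xZ xO; apply/forcedP; constructor 1.
      have vC : v \in C by apply: (subsetP SF); rewrite inE vF.
      case/setDP: (xZ) => xZ' xO; apply: (subsetP RR1).
      rewrite inE xZ' andbT; apply: (subsetP SR); rewrite inE xZ' andbT.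
      apply: (grow_adj rS vC) => //; apply: (subsetP FS).
      by apply/forcedP; constructor 1.
    by case/negP: vZ; exact: (cross u).
  apply/subsetP=> y /setIP[]; rewrite mem_grow // => /HP; rewrite /P => + yZ.
  by rewrite yZ.
by rewrite cS'.
Qed.

Lemma optimal_layers : r \in W ->
  exists R, [/\ (O, R) \in layers #|V|, F O \subset R & #|R| <= #|W|].
Proof.
move=> rW; have [OZ iO] := optimal_outs; have FW := optimal_forced.
have [R0 OR0 E0] : exists2 R, (O, R) \in layers 0 & R :&: Z = (grow G (F O) r).1 :&: Z.
  rewrite /layers /= /init_states.
  have : O \in outs G Z Q by case: (outs_correct Z Q) => _ _; apply.
  case/splitPr=> p1 p2; rewrite foldl_cat /=; set b := foldl _ _ p1.
  have [R HR ER] := insert_key b (O, (grow G (F O) r).1); exists R => //.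
  elim: p2 (insert _ _ _) HR => //= O' p2 IH acc HR; apply: IH; exact: mem_insert.
have [R [OR WR]] : exists R, (O, R) \in layers #|W :\: F O| /\ W :&: Z \subset R.
  by apply: (@optimal_extend (F O) R0) => //; rewrite ?setDv ?sub0set ?cards0 // -E0 subsetIl.
have [vR cR] := (layer_layers _).2 _ OR.
have FR : F O \subset R.
  apply/subsetP=> x xF; have xW := subsetP FW _ xF.
  have [xZ|xZ] := boolP (x \in Z); first by apply: (subsetP WR); rewrite inE xW.
  have [->|xr] := eqVneq x r; first exact: valid_root vR.
  (* A forced vertex outside [Z] has a neighbour in the connected set [W]; this neighbour lies in
     [Z], since [X :\: Z] is independent, and [R] absorbs the forced vertex from there. *)
  have [||y [z [/set1P -> zW _ xz]]] := conn_exit (T := [set x]) (cover_conn covW) _ (set11 x) rW.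
  - by rewrite sub1set.
  - by rewrite inE eq_sym.
  have zZ : z \in Z.
    apply: contraLR xz => zZ; apply: (cover_indep cov); rewrite inE ?xZ ?zZ.
      by rewrite (subsetP (cover_sub covW)).
    by rewrite (subsetP (cover_sub covW)).
  apply: (valid_closed vR) _ xF _; last by rewrite adj_sym; exact: xz.
  by apply: (subsetP WR); rewrite inE zW.
exists R; split=> //.
  by apply: layers_mono OR; exact: max_card.
by rewrite -(cardsID (F O) R) -(cardsID (F O) W) (setIidPr FR) (setIidPr FW) leq_add2l.
Qed.

End Optimal.

Lemma best_stepE best s : let b' := foldl (best_step G X Q Z) best s in
  [/\ b' = best \/ exists2 st, st \in s & F st.1 \subset st.2 /\ b' = st.2, #|b'| <= #|best|
    & forall st, st \in s -> F st.1 \subset st.2 -> #|b'| <= #|st.2|].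
Proof.
elim: s best => [|st s IH] best /=; first by split=> //; left.
have [H1 H2 H3] := IH (best_step G X Q Z best st).
have le : #|best_step G X Q Z best st| <= #|best|.
  by rewrite /best_step; case: ifP => // /andP[_ /ltnW].
split; last 1 first.
- move=> st'; rewrite inE => /orP[/eqP-> sub|]; last exact: H3.
  apply: leq_trans H2 _; rewrite /best_step sub /=.
  by case: ltnP.
- case: H1 => [->|[st' H4 H5]]; last by right; exists st'; rewrite // inE H4 orbT.
  rewrite /best_step; case: ifP => [/andP[sub _]|_]; last by left.
  by right; exists st; rewrite // mem_head.
exact: leq_trans H2 le.
Qed.

Lemma compressE : compress G X Q r Z = foldl (best_step G X Q Z) Z (layers #|V|).
Proof. by rewrite /compress foldl_iter -cardE. Qed.

Lemma compress_cover : cover X Q (compress G X Q r Z).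
Proof.
rewrite compressE; have [[->|[st Hst [sub ->]]] _ _] := best_stepE Z (layers #|V|) => //.
by apply: valid_cover => //; case: ((layer_layers _).2 _ Hst).
Qed.

Lemma compress_optimal W : cover X Q W -> #|compress G X Q r Z| <= #|W|.
Proof.
move=> cW; have rW : r \in W := subsetP (cover_req cW) _ rQ.
have [R [OR FR leR]] := optimal_layers cW rW.
rewrite compressE; apply: leq_trans leR.
by have [_ _ H] := best_stepE Z (layers #|V|); exact: (H _ OR FR).
Qed.

(** Each valid state contains [P], because [P] is connected, contains the root and consists of
    forced vertices. So the distinct keys all belong to [keys]. *)
Lemma size_layer P i acc : r \in P -> P \subset Q -> conn G P -> layer i acc ->
  size acc <= 2 ^ #|Z :\: P|.
Proof.
move=> rP PQ cP [ua va].
apply: leq_trans (card_keys rP (subset_trans PQ QZ) (cover_conn cov)).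
rewrite -(size_map (key Z)) -(card_uniqP ua); apply: subset_leq_card.
apply/subsetP=> _ /mapP[[O R] /va[[/= OZ iO rR RX cR clR] _] ->].
have PR : P \subset R.
  apply/subsetP=> x xP; apply: connect_closed rR (cP _ _ rP xP) => u v uR vP uv.
  by apply: clR uR _ uv; apply/forcedP; constructor 3; exact: (subsetP PQ).
rewrite inE /key /=; apply/and5P; split.
- by apply: subset_trans OZ _; exact: setDS.
- by rewrite subsetI PR (subset_trans PQ QZ).
- apply/subsetP=> x /setIP[/(subsetP RX)]; rewrite !inE => /andP[-> _] ->; done.
- by apply/forall_inP=> u uO; apply/forall_inP=> v vO; exact: iO.
apply/forall_inP=> u /setIP[uR _]; apply/forall_inP=> v /setDP[vZ vO].
apply/implyP=> uv; rewrite inE vZ andbT; apply: clR uR _ uv.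
by apply/forcedP; constructor 1.
Qed.

End Compress.

Lemma cover_setT X Q : Q \subset X -> conn G X -> cover X Q X.
Proof.
by move=> QX cX; split=> //; rewrite setDv => u v; rewrite inE.
Qed.

Lemma grow_conn X r : r \in X -> conn G X -> (grow G X r).1 = X.
Proof.
move=> rX cX; apply/eqP; rewrite eqEsubset grow_sub //=.
by apply/subsetP=> x xX; rewrite mem_grow //; exact: cX.
Qed.

Lemma order_step (r x : V) l : search_order G r (x :: l) ->
  (r |: [set y in x :: l]) :\ x = r |: [set y in l].
Proof. by case=> xl _ _; rewrite set_cons setUCA setU1K. Qed.

(** * Iterative compression *)

Section Shrink.
Variables (X B : {set V}) (cap : nat) (r : V).
Hypotheses (cX : conn G X) (BX : B \subset X) (rX : r \in X).

Record shrink_inv (l : seq V) (a : {set V} * {set V}) : Prop := ShrinkInv {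
  shrink_order : search_order G r l;
  shrink_set : a.1 = r |: [set x in l];
  shrink_cover : cover X (a.1 :|: B) a.2 }.

Lemma shrink_inv0 : shrink_inv (grow G X r).2 (X, X).
Proof.
have [_ E _ o] := grow_correct G rX; rewrite grow_conn // in E.
by split=> //=; apply: cover_setT; rewrite // subUset subxx.
Qed.

Lemma shrink_step_cover l x a : shrink_inv (x :: l) a ->
  let Q := (a.1 :\ x) :|: B in r \in a.1 :\ x /\ cover X Q a.2.
Proof.
move=> [o -> c]; rewrite order_step //; split; first exact: setU11.
by apply: cover_weaken c; apply: setSU; rewrite set_cons setUCA subsetUr.
Qed.

Lemma shrink_step_inv l x a : shrink_inv (x :: l) a ->
  shrink_inv l (shrink_step G X B r cap a x).
Proof.
move=> I; have [rQ c] := shrink_step_cover I; case: I => o E _.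
rewrite /shrink_step; split=> /=; first by case: o.
  by rewrite E order_step.
case: ifP => // _; apply: compress_cover => //.
by apply/setUP; left.
Qed.

Lemma shrink_inv_end l a : shrink_inv l a ->
  shrink_inv [::] (foldl (shrink_step G X B r cap) a l).
Proof. by elim: l a => //= x l IH a /shrink_step_inv /IH. Qed.

Lemma shrink_cover_end : cover X B (shrink G X B cap r).
Proof.
case: (shrink_inv_end shrink_inv0) => _ _; apply: cover_weaken; exact: subsetUr.
Qed.

(** [W] and the current [P] share the root, so [W :|: P] is a connected cover containing [P], and
    the current cover is at most as large. Outside the next, smaller [P] it then has at most [#|W|]
    vertices, so the test against [cap] never fails. *)
Lemma shrink_optimal W : cover X B W -> r \in W -> #|W| <= cap ->
  #|shrink G X B cap r| <= #|W|.
Proof.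
move=> cW rW Wcap; rewrite /shrink.
suff H l a : shrink_inv l a -> #|a.2| <= #|W :|: a.1| ->
    #|(foldl (shrink_step G X B r cap) a l).2| <= #|W|.
  by apply: (H _ (X, X)) => /=; [exact: shrink_inv0|exact/subset_leq_card/subsetUr].
elim: l a => [|x l IH] a I /=.
  have -> // : W :|: a.1 = W.
  by case: I => _ -> _; rewrite set_nil setU0; apply/setUidPl; rewrite sub1set.
move=> le; apply: IH; first exact: shrink_step_inv.
have [rQ c] := shrink_step_cover I; rewrite /shrink_step /=.
have I' := shrink_step_inv I; have cP : conn G (a.1 :\ x).
  by have := shrink_set I'; rewrite /= => ->; apply: search_order_conn; case: I'.
have PX : a.1 :\ x \subset X.
  apply: subset_trans (cover_sub c); apply: subset_trans (cover_req c); exact: subsetUl.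
have aZ : a.1 \subset a.2.
  by case: I => _ _ /cover_req; apply: subset_trans; exact: subsetUl.
have xa : x \in a.1 by case: I => _ -> _; rewrite !inE eqxx orbT.
have -> : #|a.2 :\: (a.1 :\ x)| <= cap.
  have ra : r \in W :&: a.1 by rewrite inE rW; case/setD1P: rQ.
  have := cardsD1 x a.1; rewrite xa.
  have := cardsD a.2 (a.1 :\ x); rewrite (setIidPr (subset_trans (subD1set _ _) aZ)).
  have : 0 < #|W :&: a.1| by apply/card_gt0P; exists r.
  by move: le; rewrite cardsU; lia.
apply: compress_optimal => //; first by apply/setUP; left.
case: cW => BW WX cW iW; split.
- by rewrite subUset subsetUr; apply: subset_trans BW _; exact: subsetUl.
- by rewrite subUset WX.
- exact: (conn_setU rW rQ).
move=> u v /setDP[uX uW] /setDP[vX vW]; apply: iW; rewrite inE ?uX ?vX andbT.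
  by apply: contra uW => H; rewrite inE H.
by apply: contra vW => H; rewrite inE H.
Qed.

End Shrink.

Lemma in_boundary U X v :
  (v \in boundary G U X) = (v \in X) && meets (nbh G v) (U :\: X).
Proof.
pose p v := (v \in X) && meets (nbh G v) (U :\: X).
have E s A : (v \in foldl (fun S v => if p v then v |: S else S) A s) =
    (v \in A) || (v \in s) && p v.
  elim: s A => [|x s IH] A /=; first by rewrite orbF.
  rewrite IH inE; case: ifP => px; rewrite ?inE; case: eqP => [->|_] //=.
    by rewrite px orbT.
  by rewrite px !andbF.
by rewrite [LHS]E inE mem_enum.
Qed.

Lemma boundary_sub U X : boundary G U X \subset X.
Proof. by apply/subsetP=> v; rewrite in_boundary => /andP[]. Qed.

Lemma cvc_correct cap U X : conn G X ->
  cover X (boundary G U X) (cvc G cap U X) /\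
  forall W, cover X (boundary G U X) W -> W != set0 -> #|W| <= cap ->
    #|cvc G cap U X| <= #|W|.
Proof.
move=> cX; set B := boundary G U X; have BX : B \subset X := boundary_sub U X.
suff H s best : cover X B best ->
    cover X B (foldl (cvc_step G X B cap) best s) /\
    #|foldl (cvc_step G X B cap) best s| <= #|best| /\
    forall W r, r \in s -> cover X B W -> r \in W -> #|W| <= cap ->
      #|foldl (cvc_step G X B cap) best s| <= #|W|.
  have [c [_ o]] := H (enum V) _ (cover_setT BX cX); split=> // W cW /set0Pn[r rW] Wc.
  by apply: (o W r); rewrite ?mem_enum.
elim: s best => [|r s IH] best cb /=; first by split=> //.
have cb' : cover X B (cvc_step G X B cap best r).
  rewrite /cvc_step; case: ifP => // rX; case: ifP => // _.
  exact: shrink_cover_end.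
have le : #|cvc_step G X B cap best r| <= #|best|.
  by rewrite /cvc_step; case: ifP => // rX; case: ifP => // /ltnW.
have [c [l o]] := IH _ cb'; split=> //; split; first exact: leq_trans l le.
move=> W r'; rewrite inE => /orP[/eqP-> cW rW Wc|]; last exact: o.
have rX : r \in X := subsetP (cover_sub cW) _ rW.
apply: leq_trans l _; apply: leq_trans (shrink_optimal cX BX rX cW rW Wc).
by rewrite /cvc_step rX; case: ltnP.
Qed.

End ConnectedCover.

(** Ranks are counted for the constant map: each piece has at least two vertices, hence positive
    rank, and the ranks add up to at most that of the whole vertex set. *)
Lemma size_blocks (V : finType) (G : graph V) vs :
  size (foldl (split G) [:: setT] vs) <= #|V|.+1.
Proof.
case: vs => [|v vs] //.
have big : forall U, U \in split G [:: setT] v -> 1 < #|U|.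
  move=> U /mem_split[U']; rewrite inE => /eqP->; rewrite inE => -[a [aU ->]].
  rewrite cardsU1; set C := (grow G _ a).1.
  have -> : v \notin C by apply/negP=> /(subsetP (grow_sub G aU)); rewrite !inE eqxx.
  by rewrite addnC addn1 ltnS; apply/card_gt0P; exists a; exact: grow_root.
have {}big : forall U, U \in foldl (split G) [:: setT] (v :: vs) -> 1 < #|U|.
  rewrite /=; elim: vs (split G _ v) big => //= w vs IH Us big U.
  by apply: IH; exact: size_split.
have := rank_blocks G (fun _ : V => tt) (v :: vs) [:: setT].
rewrite big_seq1 => H; rewrite -sum1_size.
apply: leq_trans (leq_trans _ H) _; last by rewrite /rank cardsT leqW // leq_subr.
rewrite !big_seq; apply: leq_sum => U /big U1; rewrite /rank.
have : #|[set tt | _ in U]| <= #|[set: unit]| by apply: subset_leq_card; exact: subsetT.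
by rewrite cardsT card_unit; lia.
Qed.

Lemma fold_cost a b c m : a + b + m * (c + 60) + 50 <= m.+1 * (a + b + c + 110).
Proof. nia. Qed.

Lemma scale_const M a : 0 < M -> a <= M * a.
Proof. exact: leq_pmull. Qed.
Lemma scale_add M a b c d : a <= M * c -> b <= M * d -> a + b <= M * (c + d).
Proof. by rewrite mulnDr; exact: leq_add. Qed.
Lemma scale_succ M a c : 0 < M -> a <= M * c -> a.+1 <= M * c.+1.
Proof. by rewrite mulnS; lia. Qed.
Lemma scale_mul M a b c : b <= M * c -> a * b <= M * (a * c).
Proof. by rewrite mulnCA leq_mul2l => ->; rewrite orbT. Qed.
Lemma scale_unit M a : M * a <= M * a.
Proof. by []. Qed.
Lemma scale_unit1 M a : 0 < M -> M.+1 * a <= M * (2 * a).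
Proof. by move=> M0; rewrite mulnA leq_mul2r; apply/orP; right; lia. Qed.

(** Factors the exponential term [M] out of a cost that is linear in it; the cofactor found becomes
    the polynomial bound. *)
Ltac scale M :=
  lazymatch goal with |- is_true (leq ?a _) =>
    lazymatch a with
    | muln M _ => eapply scale_unit
    | muln (S M) _ => eapply scale_unit1; by rewrite ?expn_gt0
    | context [M] => lazymatch a with
        | addn _ _ => eapply scale_add; scale M
        | S _ => eapply scale_succ; [by rewrite ?expn_gt0 | scale M]
        | muln _ _ => eapply scale_mul; scale M
        end
    | _ => eapply scale_const; by rewrite ?expn_gt0
    end
  end.

(** * The program *)

Definition c_split : code :=
  fn (fun p => foldx (sndx (sndx p)) nilx (fun u acc =>
    ifx (inx (fstx (sndx p)) u)
      (appx c_attach (pairx (fstx (sndx p)) (pairx acc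
         (appx c_comps (pairx (fstx p) (diffx u (fstx (fstx (sndx p)))))))))
      (pairx u acc))).

Lemma c_split_correct : exists2 t, polynomial t & forall n (G : graph 'I_n) v Us,
  size Us <= n.+1 ->
  computes c_split (Pair (vs G) (Pair (vertex_data G v) (sets_data Us)))
    (sets_data (split G Us v)) (t n).
Proof.
use c_in_correct; use c_diff_correct; use c_comps_correct; have [ta pa Ha] := c_attach_correct.
eexists; last first.
  move=> n G v Us sU; apply: computes_fn; eapply runs_eq.
    eapply (runs_fold (encX := @set_data n) (encA := @sets_data n) (a0 := [::])
      (F := split_step G v) (Inv := fun _ _ => True) (N := n.+1)); fold_goals ltac:(exact: sU).
    - apply: Ha; apply: leq_trans (size_comps _ _) _.
      by apply: leq_trans (max_card _) _; rewrite card_ord.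
    - by rewrite /split_step; case: ifP.
  by [].
by poly.
Qed.

Definition c_blocks : code :=
  fn (fun p => foldx p (pairx (appx c_full p) nilx) (fun v us =>
    appx c_split (pairx p (pairx v us)))).

Lemma c_blocks_correct : exists2 t, polynomial t & forall n (G : graph 'I_n),
  computes c_blocks (vs G) (sets_data (blocks G)) (t n).
Proof.
use c_full_correct; have [ts ps Hs] := c_split_correct.
eexists; last first.
  move=> n G; apply: computes_fn; eapply runs_eq.
    eapply (runs_fold (encX := vertex_data G) (encA := @sets_data n) (a0 := [:: setT])
      (F := split G) (Inv := fun _ Us => exists vs, Us = foldl (split G) [:: setT] vs) (N := n)).
    - by runv.
    - by runv.
    - by sizes.
    - by exists [::].
    - move=> v vs' Us [ws ->]; split; first by exists (rcons ws v); rewrite foldl_rcons.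
      runv; apply: Hs; apply: leq_trans (size_blocks _ _) _; by rewrite card_ord.
    - by [].
  by [].
by poly.
Qed.

Definition c_boundary : code :=
  fn (fun p => foldx (fstx p) (appx c_empty (fstx p)) (fun v s =>
    ifx (andx (inx v (sndx (sndx p)))
              (meetsx (sndx v) (diffx (fstx (sndx p)) (sndx (sndx p)))))
      (unionx (fstx v) s) s)).

Lemma c_boundary_correct : exists2 t, polynomial t & forall n (G : graph 'I_n) U X,
  computes c_boundary (Pair (vs G) (Pair (set_data U) (set_data X)))
    (set_data (boundary G U X)) (t n).
Proof.
use c_in_correct; use c_diff_correct; use c_meets_correct; use c_empty_correct; use c_union_correct.
eexists; last first.
  move=> n G U X; apply: computes_fn; eapply runs_eq.
    eapply (runs_fold (encX := vertex_data G) (encA := @set_data n)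
      (F := fun S v => if (v \in X) && meets (nbh G v) (U :\: X) then v |: S else S)
      (Inv := fun _ _ => True) (N := n)); fold_goals sizes.
    by rewrite /meets; case: ifP.
  by [].
by poly.
Qed.

Definition c_forced : code :=
  fn (fun p => (* vs, X, Z, Q, O *)
    letx (sndx p) (fun q => letx (sndx q) (fun z => letx (sndx z) (fun w =>
    unionx (unionx (diffx (fstx z) (sndx w))
                   (interx (appx c_nbs (pairx (fstx p) (sndx w))) (fstx q))) (fstx w))))).

Definition forced_arg n (X Z Q O : {set 'I_n}) :=
  Pair (set_data X) (Pair (set_data Z) (Pair (set_data Q) (set_data O))).

Lemma c_forced_correct : exists2 t, polynomial t & forall n (G : graph 'I_n) X Z Q O,
  computes c_forced (Pair (vs G) (forced_arg X Z Q O)) (set_data (forced G X Z Q O)) (t n).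
Proof.
use c_diff_correct; use c_inter_correct; use c_union_correct; use c_nbs_correct.
eexists; last first.
  by move=> n G X Z Q A; apply: computes_fn; runv.
by poly.
Qed.

Definition c_outs_add : code :=
  fn (fun p => (* z, L *)
    foldx (sndx p) (sndx p) (fun o acc =>
      ifx (meetsx (sndx (fstx p)) o) acc (pairx (unionx (fstx (fstx p)) o) acc))).

Lemma c_outs_add_correct : exists2 t, polynomial t & forall n (G : graph 'I_n) z L m,
  size L <= m ->
  computes c_outs_add (Pair (vertex_data G z) (sets_data L))
    (sets_data (foldl (outs_add G z) L L)) (m.+1 * t n).
Proof.
use c_meets_correct; use c_union_correct; eexists; last first.
  move=> n G z L m sL; apply: computes_fn; eapply runs_le; first eapply runs_eq.
    eapply (runs_fold (encX := @set_data n) (encA := @sets_data n)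
      (F := outs_add G z) (Inv := fun _ _ => True) (N := m)); fold_goals ltac:(exact: sL).
    by rewrite /outs_add /meets; case: ifP.
  - by [].
  exact: fold_cost.
by poly.
Qed.

Definition c_outs : code :=
  fn (fun p => (* vs, Z, Q *)
    foldx (fstx p) (pairx (appx c_empty (fstx p)) nilx) (fun z l =>
      ifx (inx z (diffx (fstx (sndx p)) (sndx (sndx p)))) (appx c_outs_add (pairx z l)) l)).

Lemma c_outs_correct : exists2 t, polynomial t & forall n (G : graph 'I_n) Z Q m,
  #|Z :\: Q| <= m ->
  computes c_outs (Pair (vs G) (Pair (set_data Z) (set_data Q)))
    (sets_data (outs G Z Q)) (2 ^ m * t n).
Proof.
use c_in_correct; use c_diff_correct; use c_empty_correct; have [ta pa Ha] := c_outs_add_correct.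
eexists; last first.
  move=> n G Z Q m mZ; apply: computes_fn; eapply runs_le; first eapply runs_eq.
    eapply (runs_fold (encX := vertex_data G) (encA := @sets_data n) (a0 := [:: set0])
      (F := outs_step G Z Q) (Inv := fun xs L => uniq xs /\ outs_inv G Z Q xs L) (N := n)).
    - by runv.
    - by runv.
    - by sizes.
    - by split; [exact: enum_uniq|exact: outs_inv0].
    - move=> z xs L [/= /andP[zx ux] I]; split; first by split=> //; exact: outs_step_inv.
      runv.
        apply: (Ha n G z L (2 ^ m)); apply: leq_trans (size_outs I) _.
        by rewrite leq_pexp2l //; exact: mZ.
      by rewrite /outs_step; case: ifP.
    - by [].
  - by [].
  scale (2 ^ m).
by poly.
Qed.

(** * Tries for the keys *)

Definition trie_child (b : bool) (t : data) := if b then snd_data t else fst_data t.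
Definition trie_get (k : seq bool) (t : data) := foldl (fun t b => trie_child b t) t k.
Definition trie_node (b : bool) (t u : data) :=
  if b then Pair (fst_data t) u else Pair u (snd_data t).
Definition trie_add (k : seq bool) (t : data) :=
  recs (fun=> Pair Nil Nil) trie_child trie_node k t.
(** Testing membership in a plain list would take time linear in the number of states and square the
    exponential factor; in a trie it takes time linear in the length of the key. *)
Definition trie (ks : seq (seq bool)) := foldr trie_add Nil ks.

Lemma trie_get_nil k : trie_get k Nil = Nil.
Proof. by elim: k => // -[]. Qed.

(** Adding a key overwrites whatever lies below its end; with all keys of the same length nothing is
    lost there. *)
Lemma trie_get_add k k' t : size k = size k' ->
  trie_get k (trie_add k' t) = if k == k' then Pair Nil Nil else trie_get k t.
Proof.
elim: k k' t => [|b k IH] [|b' k'] t //= [E].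
by rewrite /trie_get /= -/(trie_get _ _) eqseq_cons; case: b b' => [] [] /=; rewrite ?IH.
Qed.

Lemma trie_mem k ks : (forall k', k' \in ks -> size k' = size k) ->
  trie_get k (trie ks) = bool_data (k \in ks).
Proof.
elim: ks => [|k' ks IH] H; first exact: trie_get_nil.
rewrite /= trie_get_add; last by rewrite (H k') ?mem_head.
rewrite IH => [|k'' kk]; last by apply: H; rewrite inE kk orbT.
by rewrite inE; case: eqP.
Qed.

Definition c_trie_mem : code :=
  fn (fun p => ifx (foldx (fstx p) (sndx p) (fun x t => ifx x (sndx t) (fstx t))) truex nilx).

Definition c_trie_add : code :=
  fn (fun p => recx (fstx p) (sndx p) (fun=> truex) (fun x t => ifx x (sndx t) (fstx t))
    (fun x t r => ifx x (pairx (fstx t) r) (pairx r (sndx t)))).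

Lemma c_trie_mem_correct : exists2 t, polynomial t & forall n k ks,
  size k = n + n -> (forall k', k' \in ks -> size k' = size k) ->
  computes c_trie_mem (Pair (bits_data k) (trie ks)) (bool_data (k \in ks)) (t n).
Proof.
eexists; last first.
  move=> n k ks sk H; apply: computes_fn; eapply runs_eq.
    eapply runs_ifd; [|run|run].
    eapply (runs_fold (encX := bool_data) (encA := id) (F := fun t b => trie_child b t)
      (Inv := fun _ _ => True) (N := n + n)); fold_goals ltac:(by rewrite sk).
  by have := trie_mem H; rewrite /trie_get => ->; case: (k \in ks).
by poly.
Qed.

Lemma c_trie_add_correct : exists2 t, polynomial t & forall n k d,
  size k = n + n ->
  computes c_trie_add (Pair (bits_data k) d) (trie_add k d) (t n).
Proof.
eexists; last first.
  move=> n k d sk; apply: computes_fn; eapply runs_eq.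
    eapply (runs_rec (encX := bool_data) (encA := id) (encY := id) (b := fun=> Pair Nil Nil)
      (p := trie_child) (q := trie_node) (xs := k)
      (Inv := fun _ _ => True) (N := n + n)).
    - by runv.
    - by runv.
    - by rewrite sk.
    - by [].
    - by move=> a _; runv.
    - by move=> x xs a _; split=> // [|r _]; runv.
  by [].
by poly.
Qed.

Definition c_cat : code :=
  fn (fun p => recx (fstx p) (sndx p) (fun a => a) (fun _ a => a) (fun x _ r => pairx x r)).

Lemma c_cat_computes : exists m, forall (s1 s2 : seq data) N, size s1 <= N ->
  computes c_cat (Pair (seq_data s1) (seq_data s2)) (seq_data (s1 ++ s2)) (N.+1 * m).
Proof.
eexists => s1 s2 N sN; apply: computes_fn; eapply runs_le; first eapply runs_eq.
  eapply (runs_rec (encX := id) (encA := seq_data) (encY := seq_data) (b := id)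
    (p := fun _ a => a) (q := fun x _ r => x :: r) (xs := s1) (a0 := s2)
    (Inv := fun _ _ => True) (N := N)).
  - by eapply runs_eq; [run | rewrite map_id].
  - by runv.
  - exact: sN.
  - by [].
  - by move=> a _; runv.
  - by move=> x xs a _; split=> // [|r _]; runv.
- by congr seq_data; elim: s1 {sN} => //= x s1 ->.
set a := (X in X + _ <= _); rewrite mulSn; instantiate (1 := 500).
by rewrite /a; lia.
Qed.

Section Keys.
Variable n : nat.

Definition key_bits (k : {set 'I_n} * {set 'I_n}) : seq bool :=
  [seq v \in k.1 | v <- enum 'I_n] ++ [seq v \in k.2 | v <- enum 'I_n].

Lemma size_key_bits k : size (key_bits k) = n + n.
Proof. by rewrite size_cat 2!size_map size_enum_ord. Qed.

Lemma key_bits_inj : injective key_bits.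
Proof.
move=> [A B] [C D] /eqP; rewrite eqseq_cat ?size_map // => /andP[/eqP/eq_in_map E1 /eqP/eq_in_map E2].
by congr pair; apply/setP=> v; rewrite ?E1 ?E2 ?mem_enum.
Qed.

Definition state_data (st : state 'I_n) := Pair (set_data st.1) (set_data st.2).
(** The same states twice: the trie of keys for membership, the list for traversal. *)
Definition states_data (Z : {set 'I_n}) (acc : seq (state 'I_n)) :=
  Pair (trie (map key_bits (map (key Z) acc))) (seq_data (map state_data acc)).

End Keys.

Definition c_insert : code :=
  fn (fun p => (* Z, acc, st *)
    letx (fstx (sndx p)) (fun acc => letx (sndx (sndx p)) (fun st =>
    letx (appx c_cat (pairx (fstx st) (interx (sndx st) (fstx p)))) (fun k =>
    ifx (appx c_trie_mem (pairx k (fstx acc))) acc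
      (pairx (appx c_trie_add (pairx k (fstx acc))) (pairx st (sndx acc))))))).

Lemma c_insert_correct : exists2 t, polynomial t & forall n (Z : {set 'I_n}) acc st,
  computes c_insert (Pair (set_data Z) (Pair (states_data Z acc) (state_data st)))
    (states_data Z (insert Z acc st)) (t n).
Proof.
use c_inter_correct; have [tm pm Hm] := c_trie_mem_correct; have [ta pa Ha] := c_trie_add_correct.
have [mc Hc] := c_cat_computes.
have {}Hc n (A B : {set 'I_n}) : computes c_cat (Pair (set_data A) (set_data B))
    (bits_data (key_bits (A, B))) (n.+1 * mc).
  rewrite (set_bits A) (set_bits B) /bits_data map_cat; apply: Hc.
  by rewrite 2!size_map size_enum_ord.
eexists; last first.
  move=> n Z acc [A R]; apply: computes_fn; eapply runs_eq.
    rewrite [states_data Z acc]/states_data [state_data (A, R)]/state_data /=; run.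
  - by apply: (Hm n); rewrite ?size_key_bits // => k' /mapP[k _ ->]; rewrite !size_key_bits.
  - by apply: (Ha n); rewrite size_key_bits.
  rewrite /insert -[(A, R :&: Z)]/(key Z (A, R)) (mem_map (@key_bits_inj n)).
  by case: ifP.
by poly.
Qed.

(** * Coded compression and covers *)

Definition context_data n (G : graph 'I_n) r (X Z Q : {set 'I_n}) :=
  Pair (vs G) (Pair (vertex_data G r) (Pair (set_data X) (Pair (set_data Z) (set_data Q)))).

Notation ctx_vs c := (fstx c) (only parsing).
Notation ctx_r c := (fstx (sndx c)) (only parsing).
Notation ctx_X c := (fstx (sndx (sndx c))) (only parsing).
Notation ctx_Z c := (fstx (sndx (sndx (sndx c)))) (only parsing).
Notation ctx_Q c := (sndx (sndx (sndx (sndx c)))) (only parsing).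

Definition c_forced_ctx : code :=
  fn (fun p => letx (fstx p) (fun c => appx c_forced (pairx (ctx_vs c)
    (pairx (ctx_X c) (pairx (ctx_Z c) (pairx (ctx_Q c) (sndx p))))))).

Lemma c_forced_ctx_correct : exists2 t, polynomial t & forall n (G : graph 'I_n) r X Z Q O,
  computes c_forced_ctx (Pair (context_data G r X Z Q) (set_data O))
    (set_data (forced G X Z Q O)) (t n).
Proof.
have [t pt H] := c_forced_correct; rewrite /forced_arg in H.
eexists; last first.
  by move=> n G r X Z Q A; apply: computes_fn; rewrite /context_data; runv.
by poly.
Qed.

Lemma c_grow_pair : exists2 t, polynomial t & forall n (G : graph 'I_n) S r,
  computes c_grow (Pair (vs G) (Pair (set_data S) (vertex_data G r)))
    (Pair (set_data (grow G S r).1) (vertices_data G (grow G S r).2)) (t n).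
Proof. exact: c_grow_correct. Qed.

Lemma c_insert_pair : exists2 t, polynomial t & forall n (Z : {set 'I_n}) acc O R,
  computes c_insert (Pair (set_data Z) (Pair (states_data Z acc) (Pair (set_data O) (set_data R))))
    (states_data Z (insert Z acc (O, R))) (t n).
Proof. by have [t pt H] := c_insert_correct; exists t => // n Z acc A R; exact: (H n Z acc (A, R)). Qed.

Definition c_init : code :=
  fn (fun c => foldx (appx c_outs (pairx (ctx_vs c) (pairx (ctx_Z c) (ctx_Q c)))) truex
    (fun o acc => appx c_insert (pairx (ctx_Z c) (pairx acc (pairx o
       (fstx (growx (ctx_vs c) (appx c_forced_ctx (pairx c o)) (ctx_r c)))))))).

Lemma c_init_correct : exists2 t, polynomial t & forall n (G : graph 'I_n) r X Z Q m,
  #|Z :\: Q| <= m ->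
  computes c_init (context_data G r X Z Q)
    (states_data Z (init_states G X Q r Z)) (2 ^ m * t n).
Proof.
use c_forced_ctx_correct; use c_insert_pair; use c_grow_pair.
have [to po Ho] := c_outs_correct.
eexists; last first.
  move=> n G r X Z Q m mZ; apply: computes_fn; rewrite /context_data.
  eapply runs_le; first eapply runs_eq.
    eapply (runs_fold (encX := @set_data n) (encA := states_data Z) (a0 := [::])
      (F := fun acc O => insert Z acc (O, (grow G (forced G X Z Q O) r).1))
      (Inv := fun _ _ => True) (N := 2 ^ m)).
    - by eapply runs_eq; [run; exact: Ho mZ|].
    - by runv.
    - by apply: leq_trans (size_outs (outs_correct _ _ _)) _; rewrite leq_pexp2l.
    - by [].
    - by move=> x xs' acc _; split=> //; runv.
    - by [].
  - by [].
  scale (2 ^ m).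
by poly.
Qed.

Definition c_explore_step : code :=
  fn (fun p => (* context, state, vertex, states *)
    letx (fstx p) (fun c => letx (fstx (sndx p)) (fun st =>
    letx (fstx (sndx (sndx p))) (fun v => letx (sndx (sndx (sndx p))) (fun acc =>
    ifx (andx (inx v (diffx (ctx_X c) (fstx st)))
          (andx (notx (inx v (sndx st))) (meetsx (sndx v) (sndx st))))
      (appx c_insert (pairx (ctx_Z c) (pairx acc (pairx (fstx st)
        (fstx (growx (ctx_vs c)
          (unionx (fstx v) (unionx (appx c_forced_ctx (pairx c (fstx st))) (sndx st)))
          (ctx_r c)))))))
      acc))))).

Lemma c_explore_step_correct : exists2 t, polynomial t & forall n (G : graph 'I_n) r X Z Q st v acc,
  computes c_explore_step (Pair (context_data G r X Z Q)
      (Pair (state_data st) (Pair (vertex_data G v) (states_data Z acc))))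
    (states_data Z (explore_step G X Q r Z st acc v)) (t n).
Proof.
use c_forced_ctx_correct; use c_insert_pair; use c_grow_pair; use c_in_correct; use c_diff_correct.
use c_meets_correct; use c_union_correct.
eexists; last first.
  move=> n G r X Z Q [A R] v acc; apply: computes_fn; rewrite /context_data /state_data /=.
  by runv; rewrite /explore_step /meets /=; case: ifP.
by poly.
Qed.

Definition c_explore_state : code :=
  fn (fun p => (* context, states, state *)
    foldx (ctx_vs (fstx p)) (fstx (sndx p)) (fun v acc =>
      appx c_explore_step (pairx (fstx p) (pairx (sndx (sndx p)) (pairx v acc))))).

Lemma c_explore_state_correct : exists2 t, polynomial t & forall n (G : graph 'I_n) r X Z Q st acc,
  computes c_explore_state (Pair (context_data G r X Z Q) (Pair (states_data Z acc) (state_data st)))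
    (states_data Z (explore_state G X Q r Z acc st)) (t n).
Proof.
use c_explore_step_correct; eexists; last first.
  move=> n G r X Z Q st acc; apply: computes_fn; rewrite /context_data; eapply runs_eq.
    eapply (runs_fold (encX := vertex_data G) (encA := states_data Z)
      (F := explore_step G X Q r Z st) (Inv := fun _ _ => True) (N := n)); fold_goals sizes.
  by [].
by poly.
Qed.

Definition c_explore : code :=
  fn (fun p => (* context, states *)
    foldx (sndx (sndx p)) (sndx p) (fun st acc =>
      appx c_explore_state (pairx (fstx p) (pairx acc st)))).

Lemma c_explore_correct : exists2 t, polynomial t & forall n (G : graph 'I_n) r X Z Q acc m,
  size acc <= m ->
  computes c_explore (Pair (context_data G r X Z Q) (states_data Z acc))
    (states_data Z (explore G X Q r Z acc)) (m.+1 * t n).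
Proof.
use c_explore_state_correct; eexists; last first.
  move=> n G r X Z Q acc m sm; apply: computes_fn; eapply runs_le; first eapply runs_eq.
    eapply (runs_fold (encX := @state_data n) (encA := states_data Z)
      (F := explore_state G X Q r Z) (Inv := fun _ _ => True) (N := m)); fold_goals ltac:(exact: sm).
  - by [].
  exact: fold_cost.
by poly.
Qed.

Definition c_best : code :=
  fn (fun p => (* context, list of states *)
    foldx (sndx p) (ctx_Z (fstx p)) (fun st best =>
      ifx (andx (subsetx (appx c_forced_ctx (pairx (fstx p) (fstx st))) (sndx st))
             (appx nat_lt (pairx (appx c_card (sndx st)) (appx c_card best))))
        (sndx st) best)).

Lemma nat_lt_card : exists2 t, polynomial t & forall n (A : {set 'I_n}) b,
  computes nat_lt (Pair (nat_data #|A|) (nat_data b)) (bool_data (#|A| < b)) (t n).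
Proof.
have [t pt H] := nat_lt_correct; exists t => // n A b; apply: H.
by apply: leq_trans (max_card _) _; rewrite card_ord.
Qed.

Lemma c_best_correct : exists2 t, polynomial t & forall n (G : graph 'I_n) r X Z Q s m,
  size s <= m ->
  computes c_best (Pair (context_data G r X Z Q) (seq_data (map (@state_data n) s)))
    (set_data (foldl (best_step G X Q Z) Z s)) (m.+1 * t n).
Proof.
use c_forced_ctx_correct; use c_subset_correct; use nat_lt_card; use c_card_correct.
eexists; last first.
  move=> n G r X Z Q s m sm; apply: computes_fn; rewrite /context_data.
  eapply runs_le; first eapply runs_eq.
    eapply (runs_fold (encX := @state_data n) (encA := @set_data n)
      (F := best_step G X Q Z) (Inv := fun _ _ => True) (N := m)).
    - by runv.
    - by runv.
    - exact: sm.
    - by [].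
    - move=> [A R] xs a _; split=> //; rewrite {1}/state_data /=; runv.
      by rewrite /best_step /=; case: ifP.
    - by [].
  - by [].
  exact: fold_cost.
by poly.
Qed.

Definition c_compress : code :=
  fn (fun c => appx c_best (pairx c (sndx
    (foldx (ctx_vs c) (appx c_init c) (fun _ acc => appx c_explore (pairx c acc)))))).

(** [P] enters only the cost: any connected part of [Q] containing the root bounds the number of
    states. *)
Lemma c_compress_correct : exists2 t, polynomial t & forall n (G : graph 'I_n) r (X Z Q P : {set 'I_n}) m,
  r \in P -> P \subset Q -> conn G P -> cover G X Q Z -> #|Z :\: P| <= m ->
  computes c_compress (context_data G r X Z Q) (set_data (compress G X Q r Z)) (2 ^ m * t n).
Proof.
have [ti pi Hi] := c_init_correct; have [te pe He] := c_explore_correct.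
have [tb pb Hb] := c_best_correct.
eexists; last first.
  move=> n G r X Z Q P m rP PQ cP cov Zm; apply: computes_fn.
  have rQ : r \in Q := subsetP PQ _ rP.
  have size_le i acc : layer G X Q Z r i acc -> size acc <= 2 ^ m.
    move=> /(size_layer cov rP PQ cP) H; apply: leq_trans H _; by rewrite leq_pexp2l.
  pose F (acc : seq (state 'I_n)) (_ : 'I_n) := explore G X Q r Z acc.
  pose a0 := init_states G X Q r Z.
  have fin i s acc : layer G X Q Z r i acc -> layer G X Q Z r (i + size s) (foldl F acc s).
    elim: s i acc => [|x s IH] i acc H; first by rewrite addn0.
    by rewrite /= addnS -addSn; apply: IH; exact: layer_explore.
  eapply runs_le; first eapply runs_eq.
    eapply runs_app; [eapply runs_pair; [run|eapply runs_snd]|].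
      eapply (runs_fold (encX := vertex_data G) (encA := states_data Z) (a0 := a0)
        (F := F) (Inv := fun _ acc => exists i, layer G X Q Z r i acc) (N := n)).
      - by rewrite /context_data; runv.
      - runv; apply: (Hi n G r X Z Q m); apply: leq_trans Zm; apply: subset_leq_card.
        exact: setDS.
      - by sizes.
      - by exists 0; exact: layer_init.
      - move=> v xs acc [i H]; split; first by exists i.+1; exact: layer_explore.
        by runv; apply: (He n G r X Z Q acc (2 ^ m)); exact: size_le H.
      - by [].
    by apply: (Hb n G r X Z Q _ (2 ^ m)); apply: size_le; exact: fin (layer_init rQ cov).
  - by [].
  scale (2 ^ m).
by poly.
Qed.

Lemma nat_leq_card : exists2 t, polynomial t & forall n (A : {set 'I_n}) b,
  computes nat_leq (Pair (nat_data #|A|) (nat_data b)) (bool_data (#|A| <= b)) (t n).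
Proof.
have [t pt H] := nat_leq_correct; exists t => // n A b; apply: H.
by apply: leqW; apply: leq_trans (max_card _) _; rewrite card_ord.
Qed.

Definition c_shrink : code :=
  fn (fun p => (* vertices, r, X, B, cap *)
    letx (fstx p) (fun ve => letx (fstx (sndx p)) (fun r => letx (fstx (sndx (sndx p))) (fun x =>
    letx (fstx (sndx (sndx (sndx p)))) (fun b => letx (sndx (sndx (sndx (sndx p)))) (fun cap =>
    sndx (foldx (sndx (growx ve x r)) (pairx x x) (fun v a =>
      letx (diffx (fstx a) (fstx v)) (fun q =>
      pairx q (ifx (appx nat_leq (pairx (appx c_card (diffx (sndx a) q)) cap))
        (appx c_compress (pairx ve (pairx r (pairx x (pairx (sndx a) (unionx q b))))))
        (sndx a))))))))))).

Lemma size_order n (G : graph 'I_n) (X : {set 'I_n}) r : r \in X -> size (grow G X r).2 <= n.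
Proof.
move=> rX; have [_ _ _] := grow_correct G rX.
suff H l : search_order G r l -> uniq l by move/H/card_uniqP<-; have := max_card (mem (grow G X r).2); rewrite card_ord.
elim: l => //= x l IH [xl _ /IH ->]; rewrite andbT.
by apply: contra xl => xl; rewrite !inE xl orbT.
Qed.

Lemma c_shrink_correct : exists2 t, polynomial t & forall n (G : graph 'I_n) r (X B : {set 'I_n}) cap,
  conn G X -> B \subset X -> r \in X ->
  computes c_shrink (Pair (vs G) (Pair (vertex_data G r) (Pair (set_data X)
      (Pair (set_data B) (nat_data cap)))))
    (set_data (shrink G X B cap r)) (2 ^ cap * t n).
Proof.
use nat_leq_card; use c_grow_pair; use c_diff_correct; use c_card_correct; use c_union_correct.
have [tc pc Hc] := c_compress_correct; rewrite /context_data in Hc.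
eexists; last first.
  move=> n G r X B cap cX BX rX; apply: computes_fn.
  eapply runs_le; first eapply runs_eq.
    do 5 (eapply runs_let; [by runv|cbv beta]).
    eapply runs_snd.
    eapply (runs_fold (encX := vertex_data G) (encA := fun a => Pair (set_data a.1) (set_data a.2))
      (a0 := (X, X)) (xs := (grow G X r).2) (F := shrink_step G X B r cap) (Inv := shrink_inv G X B r) (N := n)).
    - by runv.
    - by runv.
    - exact: size_order.
    - exact: shrink_inv0.
    - move=> v xs [P Z] I; split; first exact: shrink_step_inv.
      have [/= rQ cQ] := shrink_step_cover I.
      have I' := shrink_step_inv cap I.
      have cP : conn G (P :\ v).
        by have := shrink_set I'; rewrite /= => ->; apply: search_order_conn; case: I'.
      eapply runs_eq.
        eapply runs_let; [by runv|cbv beta].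
        eapply runs_pair; [by run|].
        (* Compression is charged only under the test [le], which is exactly the bound on the cover
           outside [P] that its cost requires. *)
        eapply runs_if; [by run | move=> le | by move=> _; run].
        run; apply: (Hc n G r X Z _ (P :\ v) cap) => //; exact: subsetUl.
      rewrite /shrink_step /=; congr Pair; by case: ifP.
    - by [].
  - by [].
  scale (2 ^ cap).
by poly.
Qed.

Definition c_cvc : code :=
  fn (fun p => (* cap, vertices, U, X *)
    letx (fstx p) (fun cap => letx (fstx (sndx p)) (fun ve =>
    letx (sndx (sndx (sndx p))) (fun x =>
    letx (appx c_boundary (pairx ve (pairx (fstx (sndx (sndx p))) x))) (fun b =>
    foldx ve x (fun r best => ifx (inx r x)
      (letx (appx c_shrink (pairx ve (pairx r (pairx x (pairx b cap))))) (fun z =>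
         ifx (appx nat_lt (pairx (appx c_card z) (appx c_card best))) z best))
      best)))))).

Lemma c_cvc_correct : exists2 t, polynomial t & forall n (G : graph 'I_n) (U X : {set 'I_n}) cap,
  conn G X ->
  computes c_cvc (Pair (nat_data cap) (Pair (vs G) (Pair (set_data U) (set_data X))))
    (set_data (cvc G cap U X)) (2 ^ cap * t n).
Proof.
use nat_lt_card; use c_card_correct; use c_in_correct; use c_boundary_correct.
have [ts ps Hs] := c_shrink_correct.
eexists; last first.
  move=> n G U X cap cX; apply: computes_fn; eapply runs_le; first eapply runs_eq.
    do 4 (eapply runs_let; [by runv|cbv beta]).
    eapply (runs_fold (encX := vertex_data G) (encA := @set_data n)
      (F := cvc_step G X (boundary G U X) cap) (Inv := fun _ _ => True) (N := n)).
    - by runv.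
    - by runv.
    - by sizes.
    - by [].
    - move=> r xs best _; split=> //; eapply runs_eq.
        eapply runs_if; [by run | move=> rX | by move=> _; run].
        eapply runs_let; first by run; apply: Hs => //; exact: boundary_sub.
        by cbv beta; run.
      by rewrite /cvc_step; case: ifP => // _; case: ifP.
    - by [].
  - by [].
  scale (2 ^ cap).
by poly.
Qed.

Definition c_cover_all : code :=
  fn (fun p => (* (cap, vertices), U, covers, parts *)
    foldx (sndx (sndx (sndx p))) (fstx (sndx (sndx p))) (fun x acc =>
      pairx (appx c_cvc (pairx (fstx (fstx p)) (pairx (sndx (fstx p)) (pairx (fstx (sndx p)) x)))) acc)).

Lemma c_cover_all_correct : exists2 t, polynomial t & forall n (G : graph 'I_n) cap U acc Xs,
  size Xs <= n -> (forall X, X \in Xs -> conn G X) ->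
  computes c_cover_all (Pair (Pair (nat_data cap) (vs G))
      (Pair (set_data U) (Pair (sets_data acc) (sets_data Xs))))
    (sets_data (cover_all G cap U acc Xs)) (2 ^ cap * t n).
Proof.
have [ts ps Hs] := c_cvc_correct.
eexists; last first.
  move=> n G cap U acc Xs sX cX; apply: computes_fn; eapply runs_le; first eapply runs_eq.
    eapply (runs_fold (encX := @set_data n) (encA := @sets_data n)
      (F := fun acc X => cvc G cap U X :: acc)
      (Inv := fun Xs _ => forall X, X \in Xs -> conn G X) (N := n)).
    - by runv.
    - by runv.
    - exact: sX.
    - exact: cX.
    - move=> X xs a cXs; split; first by move=> Y Yxs; apply: cXs; rewrite inE Yxs orbT.
      by runv; apply: Hs; apply: cXs; rewrite mem_head.
    - by [].
  - by [].
  scale (2 ^ cap).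
by poly.
Qed.

Definition c_cover_block : code :=
  fn (fun p => (* (cap, vertices), phi, covers, U *)
    letx (fstx p) (fun c => letx (fstx (sndx p)) (fun phi =>
    letx (sndx (sndx (sndx p))) (fun u =>
    appx c_cover_all (pairx c (pairx u (pairx
      (appx c_cover_all (pairx c (pairx u (pairx (fstx (sndx (sndx p)))
         (appx c_comps (pairx (sndx c) (interx u phi)))))))
      (appx c_comps (pairx (sndx c) (diffx u phi)))))))))).

Lemma comps_conn (V : finType) (G : graph V) (S X : {set V}) : X \in comps G S -> conn G X.
Proof. by have [_ _ H] := comps_correct G S; case/H => r rS ->; exact: conn_grow. Qed.

Lemma size_comps_ord n (G : graph 'I_n) (S : {set 'I_n}) : size (comps G S) <= n.
Proof.
apply: leq_trans (size_comps _ _) _.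
by apply: leq_trans (max_card _) _; rewrite card_ord.
Qed.

Lemma c_cover_block_correct : exists2 t, polynomial t & forall n (G : graph 'I_n) cap phi acc U,
  computes c_cover_block (Pair (Pair (nat_data cap) (vs G))
      (Pair (set_data phi) (Pair (sets_data acc) (set_data U))))
    (sets_data (cover_block G phi cap acc U)) (2 ^ cap * t n).
Proof.
use c_comps_correct; use c_inter_correct; use c_diff_correct.
have [ts ps Hs] := c_cover_all_correct.
eexists; last first.
  move=> n G cap phi acc U; apply: computes_fn; eapply runs_le; first eapply runs_eq; [run| |].
  - by apply: Hs; [exact: size_comps_ord|move=> X; exact: comps_conn].
  - by apply: Hs; [exact: size_comps_ord|move=> X; exact: comps_conn].
  - by [].
  scale (2 ^ cap).
by poly.
Qed.

Definition c_covers : code :=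
  fn (fun p => (* (cap, vertices), phi *)
    foldx (appx c_blocks (sndx (fstx p))) nilx (fun u acc =>
      appx c_cover_block (pairx (fstx p) (pairx (sndx p) (pairx acc u))))).

Lemma c_covers_correct : exists2 t, polynomial t & forall n (G : graph 'I_n) cap phi,
  computes c_covers (Pair (Pair (nat_data cap) (vs G)) (set_data phi))
    (sets_data (covers G phi cap)) (2 ^ cap * t n).
Proof.
use c_blocks_correct; use c_cover_block_correct.
eexists; last first.
  move=> n G cap phi; apply: computes_fn; eapply runs_le; first eapply runs_eq.
    eapply (runs_fold (encX := @set_data n) (encA := @sets_data n) (a0 := [::])
      (F := cover_block G phi cap) (Inv := fun _ _ => True) (N := n.+1)); fold_goals
      ltac:(by apply: leq_trans (size_blocks _ _) _; rewrite card_ord).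
  - by [].
  scale (2 ^ cap).
by poly.
Qed.

Lemma size_covers n (G : graph 'I_n) phi cap : size (covers G phi cap) <= n.+1 * (n + n).
Proof.
have Ha U acc Xs : size (cover_all G cap U acc Xs) = size acc + size Xs.
  by rewrite /cover_all; elim: Xs acc => [|X Xs IH] acc; rewrite ?addn0 //= IH /= addSnnS.
suff H s acc : size (foldl (cover_block G phi cap) acc s) <= size acc + size s * (n + n).
  apply: leq_trans (H _ _) _; rewrite add0n leq_mul2r; apply/orP; right.
  by apply: leq_trans (size_blocks _ _) _; rewrite card_ord.
elim: s acc => [|U s IH] acc /=; first by rewrite addn0.
apply: leq_trans (IH _) _; rewrite /cover_block !Ha mulSn.
have := size_comps_ord G (U :&: phi); have := size_comps_ord G (U :\: phi); lia.
Qed.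

(** * Coded merging and verification *)

Definition c_bag_pass : code :=
  fn (fun p => foldx (fstx p) (sndx p) (fun w s => ifx (meetsx w s) (unionx s w) s)).

Lemma c_bag_pass_correct : exists2 t, polynomial t & forall n (Ws : seq {set 'I_n}) S,
  size Ws <= n.+1 * (n + n) ->
  computes c_bag_pass (Pair (sets_data Ws) (set_data S))
    (set_data (foldl (@bag_step _) S Ws)) (t n).
Proof.
use c_meets_correct; use c_union_correct; eexists; last first.
  move=> n Ws S sW; apply: computes_fn; eapply runs_eq.
    eapply (runs_fold (encX := @set_data n) (encA := @set_data n)
      (F := @bag_step _) (Inv := fun _ _ => True) (N := n.+1 * (n + n))); fold_goals ltac:(exact: sW).
    by rewrite /bag_step /meets; case: ifP.
  by [].
by poly.
Qed.

Definition c_bag : code :=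
  fn (fun p => (* vertices, sets, vertex *)
    foldx (fstx p) (fstx (sndx (sndx p))) (fun _ s =>
      appx c_bag_pass (pairx (fstx (sndx p)) s))).

Lemma c_bag_correct : exists2 t, polynomial t & forall n (G : graph 'I_n) (Ws : seq {set 'I_n}) v,
  size Ws <= n.+1 * (n + n) ->
  computes c_bag (Pair (vs G) (Pair (sets_data Ws) (vertex_data G v)))
    (set_data (bag Ws v)) (t n).
Proof.
have [tp pp Hp] := c_bag_pass_correct; eexists; last first.
  move=> n G Ws v sW; apply: computes_fn; eapply runs_eq.
    eapply (runs_fold (encX := vertex_data G) (encA := @set_data n) (a0 := [set v])
      (F := fun S _ => foldl (@bag_step _) S Ws) (Inv := fun _ _ => True) (N := n)); fold_goals sizes.
    exact: Hp.
  by [].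
by poly.
Qed.

Definition c_nb_bags : code :=
  fn (fun p => letx (appx c_nbs (pairx (fstx p) (fstx (sndx p)))) (fun d =>
    foldx (sndx (sndx p)) nilx (fun b acc => ifx (meetsx d b) (pairx nilx acc) acc))).

Lemma c_nb_bags_correct : exists2 t, polynomial t & forall n (G : graph 'I_n) D Bs,
  size Bs <= n.+1 ->
  computes c_nb_bags (Pair (vs G) (Pair (set_data D) (sets_data Bs)))
    (nat_data (nb_bags G D Bs)) (t n).
Proof.
use c_meets_correct; use c_nbs_correct; eexists; last first.
  move=> n G D Bs sB; apply: computes_fn; eapply runs_eq.
    eapply runs_let; [by runv|cbv beta].
    eapply (runs_fold (encX := @set_data n) (encA := nat_data) (a0 := 0)
      (F := fun a B => meets (nbs G D) B + a) (Inv := fun _ _ => True) (N := n.+1)); fold_goals ltac:(exact: sB).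
    by rewrite /meets; case: (_ != _).
  congr nat_data; rewrite /nb_bags -[RHS]addn0; elim: Bs {sB} 0 => //= B Bs IH a.
  by rewrite IH addnCA addnA.
by poly.
Qed.

Definition bags_data n (a : ({set 'I_n} * seq {set 'I_n}) * bool) :=
  Pair (Pair (set_data a.1.1) (sets_data a.1.2)) (bool_data a.2).

Definition c_is_one : code := fn (fun p => ifx p (ifx (sndx p) nilx truex) nilx).

Lemma c_is_one_correct m : computes c_is_one (nat_data m) (bool_data (m == 1)) 100.
Proof. by case: m => [|[|m]]. Qed.

Notation eqx a b := (appx c_eq (pairx a b)) (only parsing).

Definition c_add_bag : code :=
  fn (fun p => (* (vertices, sets), vertex, bags *)
    letx (fstx p) (fun c => letx (fstx (sndx p)) (fun v => letx (sndx (sndx p)) (fun a =>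
    ifx (inx v (fstx (fstx a))) a
    (letx (appx c_bag (pairx (fstx c) (pairx (sndx c) v))) (fun d =>
     pairx (pairx (unionx (fstx (fstx a)) d) (pairx d (sndx (fstx a))))
       (andx (sndx a) (andx (notx (meetsx d (fstx (fstx a))))
         (andx (eqx (fstx (growx (fstx c) d v)) d)
           (appx c_is_one (appx c_nb_bags (pairx (fstx c) (pairx d (sndx (fstx a))))))))))))))).

Lemma c_add_bag_correct : exists2 t, polynomial t & forall n (G : graph 'I_n) Ws v a,
  size Ws <= n.+1 * (n + n) -> size a.1.2 <= n.+1 ->
  computes c_add_bag (Pair (Pair (vs G) (sets_data Ws)) (Pair (vertex_data G v) (bags_data a)))
    (bags_data (add_bag G Ws v a)) (t n).
Proof.
have [tb pb Hb] := c_bag_correct; have [tn pn Hn] := c_nb_bags_correct.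
have H1 := c_is_one_correct; use c_grow_pair; use c_eq_correct; use c_meets_correct; use c_in_correct.
use c_union_correct.
eexists; last first.
  move=> n G Ws v [[C Bs] ok] sW sB; apply: computes_fn; rewrite {1}/bags_data /=.
  eapply runs_eq; [run; [exact: Hb|exact: (Hn n G)]|].
  by rewrite /add_bag /=; case: ifP.
by poly.
Qed.

Definition c_bags : code :=
  fn (fun p => (* (vertices, sets), vertex *)
    letx (fstx p) (fun c => letx (sndx p) (fun v =>
    recx (sndx (growx (fstx c) (appx c_full (fstx c)) v)) nilx
      (fun _ => letx (appx c_bag (pairx (fstx c) (pairx (sndx c) v))) (fun d =>
         pairx (pairx d (pairx d nilx)) (eqx (fstx (growx (fstx c) d v)) d)))
      (fun _ a => a)
      (fun u _ a => appx c_add_bag (pairx c (pairx u a)))))).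

Lemma c_bags_correct : exists2 t, polynomial t & forall n (G : graph 'I_n) Ws v,
  size Ws <= n.+1 * (n + n) ->
  computes c_bags (Pair (Pair (vs G) (sets_data Ws)) (vertex_data G v))
    (bags_data (bags G Ws v)) (t n).
Proof.
have [tb pb Hb] := c_bag_correct; have [ta pa Ha] := c_add_bag_correct.
use c_grow_pair; use c_eq_correct; use c_full_correct.
eexists; last first.
  move=> n G Ws v sW; apply: computes_fn; eapply runs_eq.
    do 2 (eapply runs_let; [by runv|cbv beta]).
    pose a0 := ((bag Ws v, [:: bag Ws v]), (grow G (bag Ws v) v).1 == bag Ws v).
    eapply (runs_rec (encX := vertex_data G) (encA := fun=> Nil) (encY := @bags_data n)
      (a0 := tt) (b := fun=> a0) (p := fun _ a => a) (q := fun u _ a => add_bag G Ws u a)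
      (xs := (grow G setT v).2) (Inv := fun xs _ => size xs <= n) (N := n)).
    - by runv.
    - by runv.
    - by apply: size_order; rewrite inE.
    - by apply: size_order; rewrite inE.
    - by move=> a _; eapply runs_eq; [run; exact: Hb|].
    - move=> x xs [] /= sx; split=> [||r Er]; [exact: ltnW|by runv|].
      runv; apply: Ha => //; rewrite {}Er.
      apply: leq_trans (_ : (size xs).+1 <= _); last by rewrite ltnS ltnW.
      elim: xs {sx} => //= y xs IH; rewrite /add_bag.
      by case: ifP => _ /=; [exact: leqW|rewrite ltnS].
  congr bags_data; rewrite /bags.
  by elim: (grow G setT v).2 => //= x xs ->.
by poly.
Qed.

Definition c_count : code := fn (fun p => foldx (fstx p) (sndx p) (fun _ a => pairx nilx a)).

Lemma c_count_correct : exists m, forall (s : seq data) k N, size s <= N ->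
  computes c_count (Pair (seq_data s) (nat_data k)) (nat_data (size s + k)) (N.+1 * m).
Proof.
eexists => s k N sN; apply: computes_fn; eapply runs_le; first eapply runs_eq.
    eapply (runs_fold (encX := id) (encA := nat_data) (F := fun a _ => a.+1)
      (xs := s) (Inv := fun _ _ => True) (N := N)).
    - by eapply runs_eq; [run|rewrite map_id].
    - by runv.
    - exact: sN.
    - by [].
    - by move=> x xs a _; split=> //; runv.
    - by [].
  by congr nat_data; elim: s k {sN} => //= x s IH k; rewrite IH addnS.
exact: fold_cost.
Qed.

Lemma runs_if_cons c e1 e2 env (s : seq data) v t t1 t2 :
  runs c env (seq_data s) t -> (forall x s', s = x :: s' -> runs e1 env v t1) ->
  (s = [::] -> runs e2 env v t2) -> runs (ifx c e1 e2) env v (t + t1 + t2).+1.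
Proof.
case: s => [|x s] Hc H1 H2.
  by apply: runs_le (runs_if_nil _ Hc (H2 erefl)) _; lia.
by apply: runs_le (runs_if_pair _ Hc (H1 _ _ erefl)) _; lia.
Qed.

Definition c_verify : code :=
  fn (fun p => (* (vertices, sets), k *)
    letx (fstx p) (fun c => ifx (fstx c)
      (letx (appx c_bags (pairx c (fstx (fstx c)))) (fun a =>
       ifx (andx (sndx a) (andx (eqx (fstx (fstx a)) (appx c_full (fstx c)))
             (appx nat_leq (pairx (appx c_count (pairx (fstx c) nilx))
                                  (appx c_count (pairx (sndx (fstx a)) (sndx p)))))))
         (pairx nilx (sndx (fstx a))) nilx))
      nilx)).

Lemma size_bags n (G : graph 'I_n) Ws v : size (bags G Ws v).1.2 <= n.+1.
Proof.
apply: leq_trans (_ : (size (grow G setT v).2).+1 <= _); last by rewrite ltnS size_order ?inE.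
rewrite /bags; elim: (grow G setT v).2 => //= y xs IH; rewrite {1}/add_bag.
by case: ifP => _ /=; [exact: leqW|rewrite ltnS].
Qed.

Lemma c_verify_correct : exists2 t, polynomial t & forall n (G : graph 'I_n) Ws k,
  size Ws <= n.+1 * (n + n) ->
  computes c_verify (Pair (Pair (vs G) (sets_data Ws)) (nat_data k))
    (answer_data (verify G k Ws)) (t n).
Proof.
have [tb pb Hb] := c_bags_correct; have [m Hm] := c_count_correct.
have [tl pl Hl] := nat_leq_correct.
use c_eq_correct; use c_full_correct.
eexists; last first.
  move=> n G Ws k sW; apply: computes_fn.
  eapply runs_let; [by runv|cbv beta].
  eapply runs_if_cons; first by runv.
    move=> x s' Es; have [v0 [l E]] : exists v0 l, enum 'I_n = v0 :: l.
      by case: (enum 'I_n) Es => // v0 l _; exists v0, l.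
    have Ef : fst_data (vs G) = vertex_data G v0 by rewrite E.
    eapply runs_eq.
      eapply runs_let; first by eapply runs_app; [run|rewrite Ef; apply: Hb sW].
      cbv beta; rewrite /bags_data /=; run.
      - apply: (Hm (map (vertex_data G) (enum 'I_n)) 0 n); by rewrite size_map size_enum_ord.
      - apply: (Hm (map (@set_data n) (bags G Ws v0).1.2) k n.+1).
        by rewrite size_map size_bags.
      - rewrite size_map size_enum_ord addn0; exact: (Hl n).
    rewrite /verify E size_map card_ord.
    by case: ifP.
  move=> E; eapply runs_eq; first by run.
  by rewrite /verify; case: (enum 'I_n) E.
by poly.
Qed.

Definition c_try : code :=
  fn (fun p => (* (cap, vertices), phi, k *)
    appx c_verify (pairx (pairx (sndx (fstx p))
      (appx c_covers (pairx (fstx p) (fstx (sndx p))))) (sndx (sndx p)))).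

Lemma c_try_correct : exists2 t, polynomial t & forall n (G : graph 'I_n) cap phi k,
  computes c_try (Pair (Pair (nat_data cap) (vs G)) (Pair (set_data phi) (nat_data k)))
    (answer_data (try G k cap phi)) (2 ^ cap * t n).
Proof.
use c_covers_correct; have [tv pv Hv] := c_verify_correct.
eexists; last first.
  move=> n G cap phi k; apply: computes_fn; eapply runs_le.
    by runv; apply: (Hv n); exact: size_covers.
  scale (2 ^ cap).
by poly.
Qed.

(** * Search over random colourings *)

Section Search.
Variables (n : nat) (G : graph 'I_n).

(** Only the first [n] bits matter, and missing bits read as [false]. *)
Definition colouring (bits : seq bool) : {set 'I_n} := [set v : 'I_n | nth false bits v].

Definition search_step k cap (a : seq bool * option (seq {set 'I_n})) (_ : unit) :=
  (drop n a.1, if a.2 is Some _ then a.2 else try G k cap (colouring a.1)).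
Definition search k cap reps bits :=
  (foldl (search_step k cap) (bits, None) (nseq reps tt)).2.

(* Phase [b] assumes that [b] witness sets are big: these then have at most
   [k.+2 - b] vertices, and [2 ^ (k + b)] colourings are tried. *)
Definition phase_step k bits (a : (nat * nat) * option (seq {set 'I_n})) (_ : unit) :=
  ((a.1.1.-1, a.1.2 + a.1.2),
   if a.2 is Some _ then a.2 else search k a.1.1 a.1.2 bits).
(** Every phase reads the same bits from their beginning. Success is claimed for a single phase, so
    independence between phases is not at stake, and the longest phase, with [4 ^ k] colourings,
    dictates the number of bits. *)
Definition phases k bits :=
  (foldl (phase_step k bits) ((k.+2, 2 ^ k), None) (nseq k.+1 tt)).2.

End Search.

Definition c_take : code :=
  fn (fun p => recx (fstx p) (sndx p) (fun=> nilx) (fun _ a => sndx a)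
    (fun _ a r => pairx (fstx a) r)).
Definition c_drop : code := fn (fun p => foldx (fstx p) (sndx p) (fun _ a => sndx a)).

Lemma c_take_correct : exists2 t, polynomial t & forall n (G : graph 'I_n) bits,
  computes c_take (Pair (vs G) (bits_data bits)) (set_data (colouring n bits)) (t n).
Proof.
eexists; last first.
  move=> n G bits; apply: computes_fn; eapply runs_eq.
    eapply (runs_rec (encX := vertex_data G) (encA := bits_data) (encY := bits_data)
      (b := fun=> [::]) (p := fun _ a => behead a) (q := fun _ a r => head false a :: r)
      (Inv := fun _ _ => True) (N := n)).
    - by runv.
    - by runv.
    - by sizes.
    - by [].
    - by move=> a _; runv.
    - move=> x xs a _; split=> // [|r _]; runv; by case: a.
  rewrite set_bits; congr bits_data.
  have -> : [seq v \in colouring n bits | v <- enum 'I_n] = [seq nth false bits (val v) | v <- enum 'I_n].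
    by apply: eq_map => v; rewrite inE.
  rewrite [RHS](map_comp (fun i => nth false bits i) val) val_enum_ord.
  rewrite -[X in iota _ X](size_enum_ord n).
  elim: (enum 'I_n) bits => //= x xs IH bits; rewrite IH nth0; congr cons.
  by rewrite (iotaDl 1 0) -map_comp; apply: eq_map => i; rewrite /= nth_behead.
by poly.
Qed.

Lemma c_drop_correct : exists2 t, polynomial t & forall n (G : graph 'I_n) bits,
  computes c_drop (Pair (vs G) (bits_data bits)) (bits_data (drop n bits)) (t n).
Proof.
eexists; last first.
  move=> n G bits; apply: computes_fn; eapply runs_eq.
    eapply (runs_fold (encX := vertex_data G) (encA := bits_data)
      (F := fun a _ => behead a) (Inv := fun _ _ => True) (N := n)); fold_goals sizes.
    by match goal with |- context [behead ?a] => case: a end.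
  congr bits_data; rewrite -[n in drop n](size_enum_ord n).
  elim: (enum 'I_n) bits => [|x s IH] bits /=; first by rewrite drop0.
  by rewrite IH; case: bits.
by poly.
Qed.

Definition c_search : code :=
  fn (fun p => (* (cap, vertices), k, reps, bits *)
    letx (fstx (sndx p)) (fun k =>
    sndx (foldx (fstx (sndx (sndx p))) (pairx (sndx (sndx (sndx p))) nilx) (fun _ a =>
      pairx (appx c_drop (pairx (sndx (fstx p)) (fstx a)))
        (ifx (sndx a) (sndx a) (appx c_try (pairx (fstx p)
           (pairx (appx c_take (pairx (sndx (fstx p)) (fstx a))) k)))))))).

Lemma answer_ifd n (o u : option (seq {set 'I_n})) :
  (if answer_data o is Pair _ _ then answer_data o else answer_data u) =
  answer_data (if o is Some _ then o else u).
Proof. by case: o. Qed.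

Lemma nat_data_map a : nat_data a = seq_data (map (fun=> Nil) (nseq a tt)).
Proof. by rewrite map_nseq. Qed.

Lemma search_cost a b c d m :
  (a + (b + c + m * (d + 60) + 50).+1).+3 <= m.+1 * (a + b + c + d + 120).
Proof. nia. Qed.

Lemma c_search_correct : exists2 t, polynomial t & forall n (G : graph 'I_n) k cap reps bits,
  computes c_search (Pair (Pair (nat_data cap) (vs G)) (Pair (nat_data k)
      (Pair (nat_data reps) (bits_data bits))))
    (answer_data (search G k cap reps bits)) (reps.+1 * (2 ^ cap * t n)).
Proof.
use c_try_correct; use c_take_correct; use c_drop_correct.
eexists; last first.
  move=> n G k cap reps bits; apply: computes_fn; eapply runs_le; first eapply runs_eq.
    eapply runs_let; [by runv|cbv beta].
    eapply runs_snd.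
    eapply (runs_fold (encX := fun=> Nil) (xs := nseq reps tt)
      (encA := fun a => Pair (bits_data a.1) (answer_data a.2))
      (a0 := (bits, None)) (F := search_step G k cap)
      (Inv := fun _ _ => True) (N := reps)).
    - by eapply runs_eq; [run|exact: nat_data_map].
    - by runv.
    - by rewrite size_nseq.
    - by [].
    - move=> x xs a _; split=> //; eapply runs_eq.
        eapply runs_pair; [by run|eapply runs_ifd; [by run|by run|by run]].
      by rewrite /search_step /= -answer_ifd.
    - by [].
  - by [].
  apply: leq_trans (search_cost _ _ _ _ _) _; rewrite leq_mul2l /=; scale (2 ^ cap).
by poly.
Qed.

Lemma c_cat_nat : exists m, forall a b N, a <= N ->
  computes c_cat (Pair (nat_data a) (nat_data b)) (nat_data (a + b)) (N.+1 * m).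
Proof.
have [m H] := c_cat_computes; exists m => a b N aN.
by have := H (nseq a Nil) (nseq b Nil) N; rewrite size_nseq cat_nseq /ncons -iterD; apply.
Qed.

Definition c_phases : code :=
  fn (fun p => (* (vertices, k), reps, bits *)
    letx (fstx p) (fun c => letx (sndx (sndx p)) (fun bits =>
    sndx (foldx (pairx nilx (sndx c))
      (pairx (pairx (pairx nilx (pairx nilx (sndx c))) (fstx (sndx p))) nilx) (fun _ a =>
      letx (fstx a) (fun q =>
      pairx (pairx (sndx (fstx q)) (appx c_cat (pairx (sndx q) (sndx q))))
        (ifx (sndx a) (sndx a) (appx c_search (pairx (pairx (fstx q) (fstx c))
           (pairx (sndx c) (pairx (sndx q) bits))))))))))).

(** [D] stands for the [2 ^ (k + b)] repetitions and [E] for the factor [2 ^ (k + 2 - b)] of each: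
    their product is [4 * 4 ^ k] for every [b]. [C] is the unary number of repetitions, which is
    doubled for the next phase. *)
Lemma phase_cost M A B C D E F G : 0 < M -> 0 < D -> C <= 2 * M -> D * E <= 4 * M ->
  A + (B + C.+1 * F + D.+1 * (E * G)) <= M * (A + B + 3 * F + 8 * G).
Proof.
move=> M0 D0 CM DM.
have E1 : C.+1 * F <= M * (3 * F) by rewrite mulnA leq_mul2r; apply/orP; right; lia.
have E2 : D.+1 * (E * G) <= M * (8 * G).
  rewrite !mulnA leq_mul2r; apply/orP; right; nia.
rewrite !mulnDr -addnA.
have := leq_pmull A M0; have := leq_pmull B M0; lia.
Qed.

Lemma c_phases_correct : exists2 t, polynomial t & forall n (G : graph 'I_n) k bits,
  k <= n ->
  computes c_phases (Pair (Pair (vs G) (nat_data k)) (Pair (nat_data (2 ^ k)) (bits_data bits)))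
    (answer_data (phases G k bits)) (4 ^ k * t n).
Proof.
have [mc Hc] := c_cat_nat; have [ts ps Hs] := c_search_correct.
eexists; last first.
  move=> n G k bits kn; apply: computes_fn; eapply runs_le; first eapply runs_eq.
    do 2 (eapply runs_let; [by runv|cbv beta]).
    eapply runs_snd.
    eapply (runs_fold (encX := fun=> Nil) (xs := nseq k.+1 tt)
      (encA := fun a => Pair (Pair (nat_data a.1.1) (nat_data a.1.2)) (answer_data a.2))
      (a0 := ((k.+2, 2 ^ k), None)) (F := phase_step G k bits)
      (Inv := fun xs a => exists2 b, b + size xs = k.+1 & a.1 = (k.+2 - b, 2 ^ (k + b))) (N := n.+1)).
    - by eapply runs_eq; [run|exact: (nat_data_map k.+1)].
    - by runv.
    - by rewrite size_nseq.
    - by exists 0; rewrite ?size_nseq ?add0n // subn0 addn0.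
    - move=> x xs [[cap reps] res] [b /= bk [Ecap Ereps]]; split.
        exists b.+1; first by rewrite -bk addSnnS.
        by rewrite /= Ecap Ereps addnS expnS mul2n addnn subnS.
      eapply runs_le.
        eapply runs_eq.
          eapply runs_let; [by run|cbv beta].
          eapply runs_pair.
            eapply runs_pair; [by run|eapply runs_app; [by run|exact: (Hc _ _ reps)]].
          eapply runs_ifd; [by run|by run|eapply runs_app; [by run|exact: Hs]].
        rewrite /= answer_ifd; by case: cap {Ecap}.
      have M0 : 0 < 4 ^ k by rewrite expn_gt0.
      have R0 : 0 < reps by rewrite Ereps expn_gt0.
      have C1 : reps <= 2 * 4 ^ k.
        by rewrite Ereps -(expnM 2 2 k) -expnS leq_pexp2l //; lia.
      have C2 : reps * 2 ^ cap <= 4 * 4 ^ k.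
        by rewrite Ereps Ecap -expnD -expnS -(expnM 2 2 k.+1) leq_pexp2l //; lia.
      apply: leq_trans (phase_cost 2000 0 mc (ts n) M0 R0 C1 C2).
      lia.
    - by [].
  - by [].
  scale (4 ^ k).
by poly.
Qed.

(** * Preparing the input, tossing, and the whole program *)

Definition c_double : code := fn (fun p => foldx (fstx p) (sndx p) (fun _ a => appx c_cat (pairx a a))).

Lemma c_double_correct : exists2 t, polynomial t & forall n k b, k <= n ->
  computes c_double (Pair (nat_data k) (nat_data b)) (nat_data (2 ^ k * b)) ((2 ^ k * b).+1 * t n).
Proof.
have [mc Hc] := c_cat_nat; eexists; last first.
  move=> n k b kn; apply: computes_fn; set M := 2 ^ k * b; eapply runs_le; first eapply runs_eq.
    eapply (runs_fold (encX := fun=> Nil) (xs := nseq k tt) (encA := nat_data)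
      (F := fun a _ => a + a) (Inv := fun xs a => 2 ^ size xs * a = M) (N := n)).
    - by eapply runs_eq; [run|exact: nat_data_map].
    - by runv.
    - by rewrite size_nseq.
    - by rewrite size_nseq.
    - move=> x xs a /= E; split; first by rewrite -E expnS addnn -mul2n mulnA [2 ^ _ * 2]mulnC.
      by eapply runs_app; [by run|apply: (Hc a a M); rewrite -E leq_pmull ?expn_gt0].
    - by [].
  - congr nat_data; rewrite /M; elim: k b {kn M} => [|k IH] b; first by rewrite mul1n.
    by rewrite /= IH expnS addnn -mul2n mulnA [2 ^ _ * 2]mulnC.
  scale (M.+1).
by poly.
Qed.

(** [k] can be much larger than [n], and its length must not enter the running time. The recursion
    is over a list of length [n], so only that many cells of [k] are read. *)
Definition c_min : code :=
  fn (fun p => recx (fstx p) (sndx p) (fun=> nilx) (fun _ a => sndx a)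
    (fun _ a r => ifx a (pairx nilx r) nilx)).

Lemma c_min_correct : exists2 t, polynomial t & forall n (s : seq data) k, size s <= n ->
  computes c_min (Pair (seq_data s) (nat_data k)) (nat_data (minn k (size s))) (t n).
Proof.
eexists; last first.
  move=> n s k sn; apply: computes_fn; eapply runs_eq.
    eapply (runs_rec (encX := id) (encA := nat_data) (encY := nat_data) (xs := s)
      (b := fun=> 0) (p := fun _ a => a.-1) (q := fun _ a r => if a is _.+1 then r.+1 else 0)
      (Inv := fun _ _ => True) (N := n)).
    - by eapply runs_eq; [run|rewrite map_id].
    - by runv.
    - exact: sn.
    - by [].
    - by move=> a _; runv.
    - move=> x xs a _; split=> // [|r _]; first by runv; case: a.
      by eapply runs_eq; [eapply runs_ifd; [by run|by run|by run]|case: a].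
  congr nat_data; elim: s k {sn} => [|x s IH] [|k] //=; rewrite ?minn0 ?min0n //.
  by rewrite IH minnSS.
by poly.
Qed.

Definition c_falses : code := fn (fun p => foldx p nilx (fun _ a => pairx nilx a)).

Lemma c_falses_correct : exists2 t, polynomial t & forall n (s : seq data), size s <= n ->
  computes c_falses (seq_data s) (nat_data (size s)) (t n).
Proof.
eexists; last first.
  move=> n s sn; apply: computes_fn; eapply runs_eq.
    eapply (runs_fold (encX := id) (encA := nat_data) (a0 := 0) (F := fun a _ => a.+1)
      (xs := s) (Inv := fun _ _ => True) (N := n)).
    - by eapply runs_eq; [run|rewrite map_id].
    - by runv.
    - exact: sn.
    - by [].
    - by move=> x xs a _; split=> //; runv.
    - by [].
  congr nat_data; rewrite -[RHS]addn0; elim: s 0 {sn} => //= x s IH a.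
  by rewrite IH addSnnS.
by poly.
Qed.

(** The accumulator holds the index of the current row in unary and the remaining rows. Their
    lengths give the zeros before and after the single one in the singleton's bit vector. *)
Definition c_vertices : code :=
  fn (fun g => recx g (pairx nilx g) (fun=> nilx)
    (fun _ a => pairx (pairx nilx (fstx a)) (sndx (sndx a)))
    (fun x a r => pairx (pairx
       (appx c_cat (pairx (fstx a) (pairx truex (appx c_falses (sndx (sndx a)))))) x) r)).

Lemma map_const (T U : Type) (c : U) (s : seq T) : [seq c | _ <- s] = nseq (size s) c.
Proof. by elim: s => //= x s ->. Qed.

Lemma set_data1 n (x : 'I_n) :
  set_data [set x] = seq_data (nseq x Nil ++ Pair Nil Nil :: nseq (n - x.+1) Nil).
Proof.
rewrite /set_data; congr seq_data.
have -> : [seq bool_data (v \in [set x]) | v <- enum 'I_n] =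
    [seq bool_data (i == x :> nat) | i <- iota 0 n].
  by rewrite -val_enum_ord -map_comp; apply: eq_map => v; rewrite inE.
have En : x + (n - x.+1).+1 = n by have := ltn_ord x; lia.
rewrite -[in iota _ _]En iotaD map_cat /= eqxx; congr (_ ++ _ :: _).
  rewrite -[in RHS](size_iota 0 x) -map_const; apply/eq_in_map => i.
  by rewrite mem_iota => /andP[_ ix]; rewrite ltn_eqF.
rewrite -[in RHS](size_iota x.+1 (n - x.+1)) -map_const; apply/eq_in_map => i.
by rewrite mem_iota => /andP[xi _]; rewrite gtn_eqF.
Qed.

Lemma c_vertices_correct : exists2 t, polynomial t & forall n (G : graph 'I_n),
  computes c_vertices (graph_data G) (vs G) (t n).
Proof.
have [mc Hc] := c_cat_computes; have [tf pf Hf] := c_falses_correct.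
eexists; last first.
  move=> n G; apply: computes_fn; rewrite /graph_data.
  pose row (u : 'I_n) := set_data [set v | adj G u v].
  eapply runs_eq.
    eapply (runs_rec (encX := row) (xs := enum 'I_n)
      (encA := fun i => Pair (nat_data i) (seq_data (map row (drop i (enum 'I_n)))))
      (a0 := 0) (encY := vertices_data G) (b := fun=> [::]) (p := fun _ i => i.+1)
      (q := fun x _ r => x :: r) (Inv := fun xs i => xs = drop i (enum 'I_n)) (N := n)).
    - by runv.
    - by eapply runs_eq; [run|rewrite drop0].
    - by sizes.
    - by rewrite drop0.
    - by move=> a _; runv.
    - move=> x xs i E.
      have Ed : drop i.+1 (enum 'I_n) = xs by rewrite -addn1 addnC -drop_drop -E /= drop0.
      have Ex : i = x.
        have ilt : i < n.
          by rewrite -[n](size_enum_ord n) ltnNge; apply/negP=> /drop_oversize; rewrite -E.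
        have : nth x (enum 'I_n) i = x by rewrite -[i]addn0 -nth_drop -E.
        by move/(f_equal (@nat_of_ord n)); rewrite nth_enum_ord.
      have sxs : size xs = n - x.+1 by rewrite -Ed size_drop size_enum_ord Ex.
      split=> // [|r _].
        by eapply runs_eq; [run|rewrite -E /= Ed].
      rewrite -E; eapply runs_eq.
        eapply runs_pair; last by run.
        eapply runs_pair; last by run.
        eapply runs_app; last first.
          apply: (Hc (nseq x Nil) (Pair Nil Nil :: nseq (n - x.+1) Nil) n).
          by rewrite size_nseq ltnW.
        eapply runs_eq.
          run; apply: (Hf n (map row xs)); by rewrite size_map sxs leq_subr.
        by rewrite size_map sxs Ex.
      by rewrite -set_data1.
  by congr vertices_data; elim: (enum 'I_n) 0 => //= x s IH i; rewrite IH.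
by poly.
Qed.

Lemma computes_le c x y t u : computes c x y t -> t <= u -> computes c x y u.
Proof. by move=> [E H] tu; split=> //; exact: leq_trans tu. Qed.

(** The number of tosses in unary: [n] bits for each of at most [4 ^ minn k n] colourings. *)
Definition c_length : code :=
  fn (fun x => letx (appx c_min x) (fun k =>
    letx (appx c_double (pairx k (appx c_double (pairx k (pairx nilx nilx))))) (fun m =>
    foldx (fstx x) nilx (fun _ a => appx c_cat (pairx m a))))).

Lemma size_rows n (G : graph 'I_n) :
  size [seq set_data [set v | adj G u v] | u <- enum 'I_n] = n.
Proof. by rewrite size_map size_enum_ord. Qed.

Lemma c_length_correct : exists2 t, polynomial t & forall n (G : graph 'I_n) k,
  computes c_length (instance_data G k) (nat_data (n * 4 ^ minn k n)) (4 ^ minn k n * t n).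
Proof.
have [mc Hc] := c_cat_nat; have [td pd Hd] := c_double_correct; have [tm pm Hm] := c_min_correct.
eexists; last first.
  move=> n G k; apply: computes_fn; rewrite /instance_data; set M := 4 ^ minn k n.
  have M0 : 0 < M by rewrite expn_gt0.
  have E4 : 2 ^ minn k n * (2 ^ minn k n * 1) = M by rewrite muln1 -expnMn.
  have E2 : 2 ^ minn k n * 1 <= M by rewrite -E4 leq_pmull // expn_gt0.
  eapply runs_le; first eapply runs_eq.
    eapply runs_let.
      run; have := Hm n [seq set_data [set v | adj G u v] | u <- enum 'I_n] k.
      by rewrite size_rows; apply.
    cbv beta; eapply runs_let.
      run; first by apply: (computes_le (u := M.+1 * td n) (Hd n (minn k n) 1 (geq_minr _ _)));
        rewrite leq_mul2r ltnS E2 orbT.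
      have := Hd n (minn k n) (2 ^ minn k n * 1) (geq_minr _ _).
      by rewrite E4; apply.
    cbv beta; rewrite ?E4.
    eapply (runs_fold (encX := id) (xs := [seq set_data [set v | adj G u v] | u <- enum 'I_n])
      (encA := nat_data) (a0 := 0) (F := fun a _ => M + a) (Inv := fun _ _ => True) (N := n)).
    - by eapply runs_eq; [run|rewrite map_id].
    - by runv.
    - by rewrite size_rows.
    - by [].
    - by move=> x xs a _; split=> //; eapply runs_app; [by run|exact: (Hc M a M (leqnn M))].
    - by [].
  - congr nat_data; rewrite -[n in RHS](size_rows G) -[RHS]addn0.
    by elim: [seq _ | _ <- _] 0 => //= x s IH a; rewrite IH mulSn addnCA addnA.
  scale M.
by poly.
Qed.

Definition c_main : code :=
  fn (fun p => (* instance, bits *)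
    letx (fstx p) (fun x => letx (appx c_min x) (fun k =>
    appx c_phases (pairx (pairx (appx c_vertices (fstx x)) k)
      (pairx (appx c_double (pairx k (pairx nilx nilx))) (sndx p)))))).

Lemma c_main_correct : exists2 t, polynomial t & forall n (G : graph 'I_n) k bits,
  computes c_main (Pair (instance_data G k) (bits_data bits))
    (answer_data (phases G (minn k n) bits)) (4 ^ minn k n * t n).
Proof.
have [td pd Hd] := c_double_correct; have [tm pm Hm] := c_min_correct.
have [tv pv Hv] := c_vertices_correct; have [tp pp Hp] := c_phases_correct.
eexists; last first.
  move=> n G k bits; apply: computes_fn; rewrite /instance_data; set M := 4 ^ minn k n.
  have M0 : 0 < M by rewrite expn_gt0.
  have E2 : 2 ^ minn k n * 1 <= M by rewrite muln1 /M (expnMn 2 2) leq_pmull // expn_gt0.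
  eapply runs_le.
    eapply runs_let; [by run|cbv beta].
    eapply runs_let.
      run; have := Hm n [seq set_data [set v | adj G u v] | u <- enum 'I_n] k.
      by rewrite size_rows; apply.
    cbv beta; run.
      by apply: (computes_le (u := M.+1 * td n) (Hd n (minn k n) 1 (geq_minr _ _)));
        rewrite leq_mul2r ltnS E2 orbT.
    by rewrite muln1; apply: (computes_le (u := M * tp n) (Hp n G _ bits (geq_minr _ _))).
  scale M.
by poly.
Qed.

(** The recursive language is deterministic, so all random bits are drawn beforehand by this
    hand-written function, one per cell of its unary argument. *)
Definition toss_term : term := If (Var 0) (TPair Toss (Call 1 (Snd (Var 0)))) TNil.

Definition main_term : term :=
  Let (TPair (Var 0) TNil)
    (Let (Call 1 (compile 2 c_length).1)
      (Let (TPair (TPair (Var 2) (Var 0)) TNil)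
        (compile (2 + size (compile 2 c_length).2) c_main).1)).

Definition the_program : program :=
  main_term :: toss_term :: (compile 2 c_length).2 ++
    (compile (2 + size (compile 2 c_length).2) c_main).2.

Lemma eval_toss s s' :
  exists2 t, t <= 7 * (size s).+1 &
  eval the_program [:: nat_data (size s)] (s ++ s') toss_term (bits_data s) s' t.
Proof.
elim: s => [|b s [t lt IH]].
  have H1 := EvVar the_program [:: nat_data 0] s' 0.
  by exists 3 => //; exact: (EvIfF _ H1 (EvNil _ _ _)).
have H1 := EvVar the_program [:: nat_data (size (b :: s))] ((b :: s) ++ s') 0.
have H2 := EvToss the_program [:: nat_data (size (b :: s))] b (s ++ s').
have H3 := EvSnd (EvVar the_program [:: nat_data (size (b :: s))] (s ++ s') 0).
have H4 : eval the_program [:: nat_data (size (b :: s))] (s ++ s') (Call 1 (Snd (Var 0)))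
    (bits_data s) s' (2 + t).+1 := EvCall (f := 1) H3 IH.
exists (1 + (1 + (2 + t).+1).+1).+1; first by rewrite /=; lia.
exact: (EvIfT _ (H1 : eval _ _ _ _ (Pair _ _) _ _) (EvPair H2 H4)).
Qed.

Theorem the_program_correct : exists2 t, polynomial t &
  forall n (G : graph 'I_n) k s, n * 4 ^ minn k n <= size s ->
    runs_within the_program (4 ^ minn k n * t n) s (instance_data G k)
      (answer_data (phases G (minn k n) (take (n * 4 ^ minn k n) s))).
Proof.
have [tl pl Hl] := c_length_correct; have [tm pm Hm] := c_main_correct.
exists (fun n => tl n + tm n + 7 * n + 100); first by poly.
move=> n G k s; set M := 4 ^ _; set N := n * M => Ns.
set x := instance_data G k; set bits := take N s.
have M0 : 0 < M by rewrite expn_gt0.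
have sz : size bits = N by rewrite size_takel.
have pat : has_at the_program 2 ((compile 2 c_length).2 ++
    (compile (2 + size (compile 2 c_length).2) c_main).2) by move=> i _.
have [atl atm] := has_at_cat pat.
have El := @compile_correct _ c_length 2 [:: x] [:: x] s atl.
have [Vl Tl] := Hl n G k; rewrite -/x in Vl Tl; rewrite Vl in El.
have [tt ltt Et] := eval_toss bits (drop N s).
rewrite cat_take_drop sz in Et.
have Em := @compile_correct _ c_main _ [:: Pair x (bits_data bits)]
  [:: bits_data bits; seq_data [:: x]; x] (drop N s) atm.
have [Vm Tm] := Hm n G k bits; rewrite Vm in Em.
have H1 := EvPair (EvVar the_program [:: x] s 0) (EvNil the_program [:: x] s).
have H2 := EvCall (f := 1) El Et.
have H3 := EvPair (EvPair (EvVar the_program [:: bits_data bits; seq_data [:: x]; x] (drop N s) 2)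
  (EvVar the_program [:: bits_data bits; seq_data [:: x]; x] (drop N s) 0)) (EvNil _ _ _).
exists (drop N s); eexists; split; last exact: (EvLet H1 (EvLet H2 (EvLet H3 Em))).
have -> : M * (tl n + tm n + 7 * n + 100) = M * tl n + M * tm n + 7 * N + M * 100.
  by rewrite /N; nia.
rewrite sz in ltt; rewrite -/x in Tm; move: Tl Tm ltt M0; rewrite -/M.
move: (cost _ _) (cost _ _) => c1 c2; lia.
Qed.

(** * Contractions as maps *)

Section Model.
Variables (V U : finType) (G : graph V) (H : graph U).

Definition fiber (f : V -> U) t := [set v | f v == t].

(* [f] sends a vertex to the vertex of [H] into which it is contracted. *)
Record contraction_map (f : V -> U) : Prop := ContractionMap {
  map_onto : forall t, exists v, f v = t;
  map_conn : forall t, conn G (fiber f t);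
  map_adj : forall u v, adj G u v -> f u != f v -> adj H (f u) (f v);
  map_lift : forall s t, adj H s t -> exists u v, [/\ f u = s, f v = t & adj G u v] }.

End Model.

Lemma card_fibers (V U : finType) (f : V -> U) : (forall t, exists v, f v = t) ->
  #|f @: [set: V]| = #|U|.
Proof.
move=> onto; rewrite -cardsT; apply: eq_card => t; rewrite !inE.
by have [v <-] := onto t; rewrite imset_f ?inE.
Qed.

Section ContractStep.
Variables (V : finType) (G : graph V) (x y : V).
Hypothesis xy : adj G x y.

Notation W := {z : V | (z != x) && (z != y)}.
Let G' := contract G x y.
Let g (v : V) : option W := insub v.

Let gN v : (g v == None) = (v == x) || (v == y).
Proof.
rewrite /g; case: insubP => [w vP _|] /=.
  by case/andP: vP => /negPf-> /negPf->.
by rewrite negb_and !negbK => ->.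
Qed.

Let gS v w : g v = Some w -> val w = v.
Proof. by rewrite /g; case: insubP => // w' _ <- [->]. Qed.

Let gK w : g (val w) = Some w.
Proof. exact: valK. Qed.

Let xg : g x = None. Proof. by apply/eqP; rewrite gN eqxx. Qed.
Let yg : g y = None. Proof. by apply/eqP; rewrite gN eqxx orbT. Qed.

Lemma contract_onto a : exists v, g v = a.
Proof. by case: a => [w|]; [exists (val w)|exists x]. Qed.

Lemma contract_edge u v : adj G u v -> g u = g v \/ adj G' (g u) (g v).
Proof.
case Eu: (g u) => [a|]; case Ev: (g v) => [b|] uv; last by left.
- by right; rewrite /= (gS Eu) (gS Ev).
- right; rewrite /= (gS Eu); have /eqP := Ev; rewrite gN => /orP[]/eqP E; move: uv; rewrite E => ->; by rewrite ?orbT.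
- right; rewrite /= (gS Ev) adj_sym; have /eqP := Eu; rewrite gN => /orP[]/eqP E; move: uv; rewrite E.
    by move=> ->.
  by rewrite [in X in _ -> X]orbC [adj G v y]adj_sym => ->.
Qed.

Lemma contract_lift a b : adj G' a b -> exists u v, [/\ g u = a, g v = b & adj G u v].
Proof.
case: a b => [a|] [b|] //=.
- by move=> ab; exists (val a), (val b).
- by case/orP=> H; [exists (val a), x|exists (val a), y].
by case/orP=> H; [exists x, (val b)|exists y, (val b)]; rewrite adj_sym.
Qed.

Lemma contract_fiber u v : g u = g v -> u = v \/ adj G u v.
Proof.
case Eu: (g u) => [a|]; case Ev: (g v) => [b|] // E.
  by left; rewrite -(gS Eu) -(gS Ev); case: E => ->.
move/eqP: Eu; move/eqP: Ev; rewrite !gN => /orP[]/eqP-> /orP[]/eqP->; try by left.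
  by right; rewrite adj_sym.
by right.
Qed.

Lemma card_contract : #|V| = #|{: option W}|.+1.
Proof.
rewrite card_option card_sig; have nxy : x != y by apply: contraTneq xy => ->; rewrite adj_irr.
have E : #|[pred z | (z != x) && (z != y)]| = #|[set~ x] :\ y|.
  by apply: eq_card => z; rewrite !inE andbC.
rewrite E; have := cardsC1 x; rewrite (cardsD1 y) !inE eq_sym nxy /= => H.
by have : 0 < #|V| by [apply/card_gt0P; exists x]; lia.
Qed.

(** An edge of the contracted graph lifts to some edge of [G]; its ends can be joined to prescribed
    preimages, since vertices with the same image are equal or adjacent. *)
Lemma connect_lift (S : {set (option W)}) u v :
  connect (within (adj G') S) (g u) (g v) -> g u \in S ->
  connect (within (adj G) (g @^-1: S)) u v.
Proof.
move=> + uS; have : forall v, g u = g v -> connect (within (adj G) (g @^-1: S)) u v.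
  move=> w E; case: (contract_fiber E) => [->|uw]; first exact: connect0.
  by apply: connect1; rewrite /within !inE -E uS uw.
move=> H0 c; pose P a := forall v, g v = a -> connect (within (adj G) (g @^-1: S)) u v.
suff : P (g v) by apply.
apply: (@connect_indP _ _ P _ _ _ _ c); last by move=> w E; apply: H0.
move=> a b Pa /and3P[aS bS /contract_lift[u1 [v1 [E1 E2 uv]]]] w E.
apply: connect_trans (Pa u1 E1) _.
apply: connect_trans (connect1 (_ : within (adj G) (g @^-1: S) u1 v1)) _.
  by rewrite /within !inE E1 E2 aS bS.
have [->|vw] : v1 = w \/ adj G v1 w by apply: contract_fiber; rewrite E2 E.
  exact: connect0.
by apply: connect1; rewrite /within !inE E2 E bS.
Qed.

Lemma connect_push (S : {set (option W)}) u v :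
  connect (within (adj G) (g @^-1: S)) u v -> connect (within (adj G') S) (g u) (g v).
Proof.
apply: (@connect_indP _ _ (fun v => connect (within (adj G') S) (g u) (g v))); last exact: connect0.
move=> a b ua /and3P[]; rewrite !inE => aS bS /contract_edge[<- //|ab].
by apply: connect_trans ua (connect1 _); rewrite /within aS bS.
Qed.

Variables (U : finType) (H : graph U) (f : V -> U) (f' : option W -> U).
Hypothesis ff' : forall v, f v = f' (g v).

Let fib t : fiber f t = g @^-1: fiber f' t.
Proof. by apply/setP=> v; rewrite !inE ff'. Qed.

Lemma contraction_map_lift : contraction_map G' H f' -> contraction_map G H f.
Proof.
case=> onto cn ad li; split.
- by move=> t; have [a <-] := onto t; have [v <-] := contract_onto a; exists v; rewrite ff'.
- move=> t u v; rewrite fib !inE => ut vt; apply: connect_lift; last by rewrite inE.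
  by apply: (cn t); rewrite inE.
- move=> u v uv; rewrite !ff' => ne; case: (contract_edge uv) => [E|]; last by move/ad; exact.
  by rewrite E eqxx in ne.
move=> s t /li[a [b [<- <- /contract_lift[u [v [<- <- uv]]]]]].
by exists u, v; rewrite !ff'.
Qed.

Lemma contraction_map_push : contraction_map G H f -> contraction_map G' H f'.
Proof.
case=> onto cn ad li; split.
- by move=> t; have [v <-] := onto t; exists (g v); rewrite ff'.
- move=> t a b; have [u <-] := contract_onto a; have [v <-] := contract_onto b.
  rewrite !inE => ut vt; apply: connect_push; rewrite -fib.
  by apply: (cn t); rewrite inE ff'.
- by move=> a b /contract_lift[u [v [<- <- uv]]]; rewrite -!ff' => ne; exact: ad.
move=> s t st; have [u [v [Eu Ev uv]]] := li _ _ st.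
case: (contract_edge uv) => [E|uv']; last by exists (g u), (g v); rewrite -!ff'.
by move: st; rewrite -Eu -Ev !ff' E adj_irr.
Qed.

End ContractStep.

Lemma contracts_in_map j (V U : finType) (G : graph V) (H : graph U) :
  contracts_in j G H -> exists2 f, contraction_map G H f & #|V| = #|U| + j.
Proof.
elim: j V G => [|j IH] V G /=.
  case=> f bf fE; exists f; last by rewrite addn0; exact: bij_eq_card bf.
  have [h fK hK] := bf; split.
  - by move=> t; exists (h t).
  - move=> t u v; rewrite !inE => /eqP Eu /eqP Ev.
    have -> : u = v by apply: (can_inj fK); rewrite Eu Ev.
    exact: connect0.
  - by move=> u v uv _; rewrite fE.
  by move=> s t st; exists (h s), (h t); rewrite !hK -fE !hK.
case=> x [y [xy /IH[f' cf card]]].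
exists (fun v => f' (insub v)); first exact: (contraction_map_lift xy _ cf).
by rewrite (card_contract xy) card addnS.
Qed.

(** As long as there are more vertices than images, some fibre has two vertices and, being
    connected, contains an edge; contracting it leaves a map of the same kind. When the numbers
    agree, the map is an isomorphism. *)
Lemma map_contracts_in j (V U : finType) (G : graph V) (H : graph U) f :
  contraction_map G H f -> #|V| = #|U| + j -> contracts_in j G H.
Proof.
elim: j V G f => [|j IH] V G f cf card /=; case: (cf) => onto cn ad li.
  have fI : injective f.
    have /imset_injP fI : #|f @: [set: V]| == #|[set: V]|.
      by rewrite card_fibers // cardsT card addn0.
    by move=> u v E; apply: fI; rewrite ?inE.
  exists f; first by apply: inj_card_bij => //; rewrite card addn0.
  move=> u v; apply/idP/idP => [/li[u' [v' [/fI-> /fI->]]]//|uv].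
  by apply: ad => //; apply: contraTneq uv => /fI->; rewrite adj_irr.
have [x [z [xz E]]] : exists x z, x != z /\ f x = f z.
  case: (boolP [exists x, [exists z, (x != z) && (f x == f z)]]).
    by case/existsP=> x /existsP[z /andP[xz /eqP E]]; exists x, z.
  move/existsPn=> H1; have fI : injective f.
    move=> u v E; apply/eqP; apply: contraT => uv.
    by have /existsPn/(_ v) := H1 u; rewrite uv E eqxx.
  have := card_fibers onto; rewrite card_imset // cardsT card; lia.
have [y [xy Ey]] : exists y, adj G x y /\ f x = f y.
  have := cn (f x) x z; rewrite !inE eqxx E => /(_ isT (eqxx _)) /connectP[[|y p] /=].
    by move=> _ E'; rewrite E' eqxx in xz.
  by case/andP=> /and3P[]; rewrite !inE => _ /eqP Ey xy _ _; exists y.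
exists x, y; split=> //.
pose f' (a : option {z : V | (z != x) && (z != y)}) := if a is Some w then f (val w) else f x.
apply: (IH _ _ f'); last by apply/eqP; rewrite -eqSS -(card_contract xy) card addnS.
have ff' v : f v = f' (insub v).
  rewrite /f'; case: insubP => [w _ <- //|]; rewrite negb_and !negbK.
  by case/orP=> /eqP->.
exact: (contraction_map_push ff' cf).
Qed.

Lemma count_lt_two (T : Type) (x0 : T) (p : pred T) s a b :
  a < b -> b < size s -> p (nth x0 s a) -> p (nth x0 s b) -> 1 < count p s.
Proof.
move=> ab bs pa pb; rewrite -(cat_take_drop b s) count_cat.
have H : has p (take b s).
  by apply/(has_nthP x0); exists a; rewrite ?size_take ?bs // nth_take.
have : has p (drop b s).
  by apply/(has_nthP x0); exists 0; rewrite ?size_drop ?subn_gt0 // nth_drop addn0.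
by move: H; rewrite !has_count; lia.
Qed.

(** * Soundness *)

Section Soundness.
Variables (V : finType) (G : graph V).
Implicit Types (D B : {set V}) (Bs Ws : seq {set V}).

(* An elimination order of the quotient: each bag but the last is adjacent to
   exactly one later bag. *)
Fixpoint tree_bags Bs : Prop :=
  if Bs is D :: Bs' then
    [/\ D != set0, conn G D, forall B, B \in Bs' -> [disjoint D & B]
      & Bs' <> [::] -> nb_bags G D Bs' = 1 /\ tree_bags Bs']
  else False.

Lemma bag_root Ws v : v \in bag Ws v.
Proof.
rewrite /bag; have: v \in [set v] by rewrite inE.
move: [set v]; elim: (enum V) => //= _ s IH S vS; apply: IH.
elim: Ws S vS => //= W Ws IH' S vS; apply: IH'.
by rewrite /bag_step; case: ifP => // _; rewrite inE vS.
Qed.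

Lemma bag_conn Ws v : (grow G (bag Ws v) v).1 == bag Ws v -> conn G (bag Ws v).
Proof. by move/eqP=> E; rewrite -[X in conn _ X]E; apply: conn_grow; exact: bag_root. Qed.

Lemma bags_sound Ws v0 : let a := bags G Ws v0 in a.2 ->
  tree_bags a.1.2 /\ forall v, (v \in a.1.1) = has (fun B => v \in B) a.1.2.
Proof.
rewrite /bags; set a0 := (_, _); elim: (grow G setT v0).2 => [|u l IH] /=.
  move=> ok; split=> [|v]; last by rewrite orbF.
  split=> //; last exact: bag_conn.
  by apply/set0Pn; exists v0; exact: bag_root.
set a := foldr _ _ _ in IH *; rewrite /add_bag; case: ifP => // ua /= /and4P[/IH[tb cov] dis cn nb].
split; last first.
  by move=> v; rewrite inE orbC cov.
split.
- by apply/set0Pn; exists u; exact: bag_root.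
- exact: bag_conn.
- move=> B Ba; apply/pred0P=> v /=; apply/negP=> /andP[vD vB].
  case/negP: dis; apply/meetsP; exists v => //.
  by rewrite cov; apply/hasP; exists B.
by move=> _; split=> //; apply/eqP.
Qed.

Section Quotient.
Variable Bs : seq {set V}.
Hypothesis tb : tree_bags Bs.
Hypothesis cov : forall v, has (fun B => v \in B) Bs.

Notation Wt i := (nth set0 Bs i).

Lemma bags_suffix i : i < size Bs -> tree_bags (drop i Bs).
Proof.
elim: i Bs tb => [|i IH] [|D [|D' s]] //= H lt.
by case: H => _ _ _ [] // _ H; exact: IH.
Qed.

Lemma bags_drop i : i < size Bs -> drop i Bs = Wt i :: drop i.+1 Bs.
Proof. by move=> lt; rewrite (drop_nth set0 lt). Qed.

Lemma bags_neq0 i : i < size Bs -> Wt i != set0.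
Proof. by move=> lt; have := bags_suffix lt; rewrite bags_drop // => -[]. Qed.

Lemma bags_conn i : i < size Bs -> conn G (Wt i).
Proof. by move=> lt; have := bags_suffix lt; rewrite bags_drop // => -[]. Qed.

Lemma bags_disjoint i j : i < j -> j < size Bs -> [disjoint Wt i & Wt j].
Proof.
move=> ij lt; have := bags_suffix (ltn_trans ij lt).
rewrite bags_drop; last exact: ltn_trans lt.
case=> _ _ + _; apply; rewrite -(subnKC ij) -nth_drop mem_nth //.
rewrite size_drop ltn_sub2r //; exact: leq_ltn_trans ij lt.
Qed.

Lemma bags_nb i : i.+1 < size Bs -> nb_bags G (Wt i) (drop i.+1 Bs) = 1.
Proof.
move=> lt; have := bags_suffix (ltnW lt); rewrite bags_drop; last exact: ltnW.
case=> _ _ _ []//; move=> E; have := size_drop i.+1 Bs; rewrite E /=; lia.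
Qed.

Definition bags_adj : rel 'I_(size Bs) :=
  fun i j => (i != j) && meets (nbs G (Wt i)) (Wt j).

Lemma bags_adj_sym : symmetric bags_adj.
Proof.
move=> i j; rewrite /bags_adj eq_sym; congr (_ && _).
by apply/meets_nbsP/meets_nbsP => -[x [y [xi yj xy]]]; exists y, x; rewrite adj_sym.
Qed.

Lemma bags_adj_irr : irreflexive bags_adj.
Proof. by move=> i; rewrite /bags_adj eqxx. Qed.

Definition bags_graph := Graph bags_adj_sym bags_adj_irr.

Lemma bags_later (i : 'I_(size Bs)) : i.+1 < size Bs ->
  exists2 j : 'I_(size Bs), i < j & bags_adj i j.
Proof.
move=> lt; have H : has (meets (nbs G (Wt i))) (drop i.+1 Bs).
  by rewrite has_count [count _ _](bags_nb lt).
have /(has_nthP set0)[j] := H; rewrite size_drop nth_drop => jlt m.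
have jj : i.+1 + j < size Bs by lia.
exists (Ordinal jj); rewrite /= ?leq_addr //.
rewrite /bags_adj m andbT; apply/eqP => /(f_equal (@nat_of_ord _)) /=; lia.
Qed.

Lemma bags_later_uniq (i j k : 'I_(size Bs)) :
  i < j -> i < k -> bags_adj i j -> bags_adj i k -> j = k.
Proof.
suff H (j1 k1 : 'I_(size Bs)) : i < j1 -> j1 < k1 -> bags_adj i j1 -> bags_adj i k1 -> False.
  move=> ij ik aj ak; apply/val_inj; case: (ltngtP j k) => // jk; first by case: (H j k).
  by case: (H k j).
move: j1 k1 => {}j {}k ij jk /andP[_ aj] /andP[_ ak].
have lt : i.+1 < size Bs by apply: leq_ltn_trans ij _.
suff : 1 < nb_bags G (Wt i) (drop i.+1 Bs) by rewrite bags_nb.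
have kn := ltn_ord k; have ik := ltn_trans ij jk.
apply: (@count_lt_two _ set0 _ _ (j - i.+1) (k - i.+1)); rewrite ?nth_drop ?size_drop ?subnKC //.
  by apply: ltn_sub2r => //; exact: leq_ltn_trans ij jk.
by apply: ltn_sub2r => //; exact: leq_ltn_trans ik kn.
Qed.

Lemma bags_nonempty : 0 < size Bs.
Proof. by case: Bs tb. Qed.

(** Every bag but the last has exactly one later neighbour. Moving to later neighbours reaches the
    last bag, and the earliest bag on a cycle would have two of them. *)
Lemma bags_tree : is_tree bags_graph.
Proof.
have n0 := bags_nonempty; split; first by rewrite card_ord.
  have last_lt : (size Bs).-1 < size Bs by rewrite prednK.
  pose z := Ordinal last_lt.
  have H (i : 'I_(size Bs)) : connect bags_graph i z.
    have [m] := ubnP (size Bs - i); elim: m i => // m IH i im.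
    have [lt|ge] := ltnP i.+1 (size Bs).
      have [j ij a] := bags_later lt.
      apply: connect_trans (connect1 (a : bags_graph i j)) (IH _ _).
      by have := ltn_ord j; lia.
    suff -> : i = z by exact: connect0.
    by apply/val_inj => /=; have := ltn_ord i; lia.
  move=> i j; apply: connect_trans (H i) _.
  by rewrite (sym_connect_sym bags_adj_sym).
move=> s /andP[cyc us]; rewrite ltnNge; apply/negP => s3.
have [i0 i0s] : exists i, i \in s by case: s s3 {cyc us} => // i s _; exists i; rewrite mem_head.
pose i := [arg min_(j < i0 in s) (j : nat)].
have [is_ imin] : i \in s /\ forall j, j \in s -> i <= j.
  by rewrite /i; case: arg_minnP.
case: (rot_to is_) => r p E.
have up : uniq (i :: p) by rewrite -E rot_uniq.
have cp : cycle bags_graph (i :: p) by rewrite -E rot_cycle.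
have sp : 1 < size p by rewrite -ltnS -/(size (i :: p)) -E size_rot.
have later j : j \in p -> i < j.
  move=> jp; have ij : i <= j by apply: imin; rewrite -(mem_rot r) E inE jp orbT.
  rewrite ltn_neqAle ij andbT; apply/negP=> /eqP/val_inj Eij.
  by move: up; rewrite /= Eij jp.
case: p sp up cp later {E} => // a p sp up cp later.
have lp : last a p \in p by case: p sp {up cp later} => // b p _ /=; exact: mem_last.
have ab : a = last a p.
  move: cp; rewrite /= rcons_path => /and3P[ia _ li].
  apply: (@bags_later_uniq i) => //.
  - by apply: later; exact: mem_head.
  - by apply: later; exact: mem_last.
  by rewrite bags_adj_sym.
by move: up; rewrite /= [in X in _ && X]ab lp !andbF.
Qed.

Definition bag_index (v : V) : 'I_(size Bs).
Proof. by exists (find (fun B => v \in B) Bs); rewrite -has_find. Defined.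

Lemma mem_bag_index v (i : 'I_(size Bs)) : (v \in Wt i) = (bag_index v == i).
Proof.
have vi : v \in Wt (bag_index v) by exact: (nth_find set0 (cov v)).
apply/idP/eqP => [vi'|<- //]; apply/val_inj.
case: (ltngtP (bag_index v) i) => // lt.
  have := bags_disjoint lt (ltn_ord i); move/pred0P/(_ v); by rewrite /= vi vi'.
by have := bags_disjoint lt (ltn_ord _); move/pred0P/(_ v); rewrite /= vi vi'.
Qed.

Lemma bags_map : contraction_map G bags_graph bag_index.
Proof.
have fibE i : fiber bag_index i = Wt i by apply/setP=> v; rewrite inE mem_bag_index.
split.
- move=> i; have /set0Pn[v] := bags_neq0 (ltn_ord i).
  by rewrite mem_bag_index => /eqP; exists v.
- by move=> i; rewrite fibE; exact: bags_conn.
- move=> u v uv ne; rewrite /= /bags_adj ne; apply/meets_nbsP.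
  by exists u, v; rewrite !mem_bag_index !eqxx.
move=> i j /andP[_ /meets_nbsP[u [v []]]]; rewrite !mem_bag_index => /eqP ui /eqP vj uv.
by exists u, v.
Qed.

Lemma conn_induced D : conn G D -> graph_connected (induced G D).
Proof.
move=> cD x y.
have H v : connect (within (adj G) D) (val x) v ->
    forall vD : v \in D, connect (induced G D) x (exist _ v vD).
  apply: (@connect_indP _ _ (fun v => forall vD, connect (induced G D) x (exist _ v vD))).
    move=> a b IH /and3P[aD bD ab] bD'; apply: connect_trans (IH aD) (connect1 _).
    by rewrite /= /induced_adj.
  move=> xD; have -> : exist (fun v => v \in D) (val x) xD = x by exact: val_inj.
  exact: connect0.
have := H (val y) (cD _ _ (valP x) (valP y)) (valP y).
suff -> : exist _ (val y) (valP y) = y by [].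
exact: val_inj.
Qed.

Lemma bags_witness : witness_structure G bags_graph (fun t => Wt t).
Proof.
split.
- by move=> i; exact: bags_neq0.
- move=> i j; rewrite neq_ltn => /orP[] lt; first exact: bags_disjoint.
  by rewrite disjoint_sym; exact: bags_disjoint.
- by move=> v; exists (bag_index v); rewrite mem_bag_index.
- by move=> i; apply: conn_induced; exact: bags_conn.
move=> i j ij; split=> [H|/andP[_ /meets_nbsP //]].
by rewrite /= /bags_adj ij; apply/meets_nbsP.
Qed.

End Quotient.

Lemma verify_sound k Ws Bs : verify G k Ws = Some Bs ->
  exists H : graph 'I_(size Bs),
    [/\ is_tree H, k_contractible k G H & witness_structure G H (fun t => nth set0 Bs t)].
Proof.
rewrite /verify; case: (enum V) => // v0 _; case: ifP => // /and3P[ok /eqP full le] [<-].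
have [tb cov] := bags_sound ok.
have cov' v : has (fun B => v \in B) (bags G Ws v0).1.2 by rewrite -cov full inE.
exists (bags_graph (bags G Ws v0).1.2); split.
- exact: bags_tree.
- have cm := bags_map tb cov'.
  have ge := card_fibers (map_onto cm).
  exists (#|V| - size (bags G Ws v0).1.2); first by rewrite leq_subLR.
  apply: (map_contracts_in cm); rewrite card_ord subnKC //.
  rewrite -[size _]card_ord -ge -cardsT; exact: leq_imset_card.
exact: bags_witness.
Qed.

End Soundness.

(** * Completeness *)

(** Otherwise a simple path from [a] to [b] avoiding [c] would close to a cycle through [c]. *)
Lemma tree_separation (U : finType) (T : graph U) c a b : graph_acyclic T ->
  adj T c a -> adj T c b -> connect (within (adj T) (~: [set c])) a b -> a = b.
Proof.
move=> ac ca cb /connectP[p0 pp0 lp]; apply/eqP; apply: contraT => ab.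
case/shortenP: pp0 lp => p pp up _ Eb.
have sub : subrel (within (adj T) (~: [set c])) (adj T) by move=> ? ? /and3P[].
have pc : c \notin p.
  elim: p a pp {up ca ab Eb} => // z p IH a /= /andP[/and3P[_ zc _] /IH cp].
  by rewrite inE negb_or cp andbT; rewrite !inE in zc; rewrite eq_sym.
have nca : c != a by apply: contraTneq ca => ->; rewrite adj_irr.
have := ac (c :: a :: p); rewrite /ucycle; case: p pp up pc Eb ab => [|z p] pp up pc Eb ab.
  by rewrite Eb eqxx in ab.
have -> : cycle (adj T) (c :: a :: z :: p).
  have := sub_path sub pp; rewrite /= rcons_path ca => /andP[-> ->] /=.
  by move: cb; rewrite adj_sym Eb.
have -> : uniq (c :: a :: z :: p).
  by rewrite cons_uniq up andbT inE negb_or nca.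
by move/(_ isT).
Qed.

Section Completeness.
Variables (V U : finType) (G : graph V) (T : graph U) (f : V -> U).
Hypotheses (cf : contraction_map G T f) (acT : graph_acyclic T) (conT : graph_connected T).
Implicit Types (B C D S X W Y : {set V}).

(** The image of the walk in the tree avoids [t], and [f y1] and [f y2] are neighbours of [t]. *)
Lemma separation t y1 y2 d1 d2 :
  d1 \in fiber f t -> d2 \in fiber f t -> adj G y1 d1 -> adj G y2 d2 ->
  connect (within (adj G) (~: fiber f t)) y1 y2 -> f y1 <> t -> f y2 <> t -> f y1 = f y2.
Proof.
rewrite !inE => /eqP E1 /eqP E2 a1 a2 c n1 n2; apply: (tree_separation acT (c := t)).
- by rewrite -E1; apply: (map_adj cf); rewrite ?E1 1?adj_sym // eq_sym; apply/eqP.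
- by rewrite -E2; apply: (map_adj cf); rewrite ?E2 1?adj_sym // eq_sym; apply/eqP.
have P0 : connect (within (adj T) (~: [set t])) (f y1) (f y1) by exact: connect0.
apply: (@connect_indP _ _ (fun v => connect (within (adj T) (~: [set t])) (f y1) (f v)) _ _ _ P0 c) => u v cu /and3P[]; rewrite !inE => ut vt uv.
case: (eqVneq (f u) (f v)) => [<- //|ne].
by apply: connect_trans cu (connect1 _); rewrite /within !inE ut vt (map_adj cf).
Qed.

Definition big t := 1 < #|fiber f t|.

Lemma not_big x : ~~ big (f x) -> fiber f (f x) = [set x].
Proof.
rewrite /big -leqNgt => le; apply/eqP; rewrite eq_sym eqEcard cards1 le andbT sub1set.
by rewrite inE.
Qed.

Lemma graph_conn : conn G setT.
Proof.
move=> x y _ _; suff H t : connect T (f x) t -> forall v, f v = t -> connect (within (adj G) setT) x v.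
  exact: (H (f y)).
have inF u v : f u = f v -> connect (within (adj G) setT) u v.
  move=> E; apply: connect_within_sub (map_conn cf (t := f v) _ _) => //.
  - by rewrite inE E.
  - by rewrite inE.
pose P s := forall v, f v = s -> connect (within (adj G) setT) x v.
apply: (@connect_indP _ _ P); last by move=> v /esym; exact: inF.
move=> a b Pa /(map_lift cf)[u [v [Es Et uv]]] w Ew.
apply: connect_trans (Pa u Es) _.
have uv' : within (adj G) setT u v by rewrite /within !inE.
apply: connect_trans (connect1 uv') _; apply: inF; by rewrite Et.
Qed.

Variable phi : {set V}.

Definition good := (forall u v, f u = f v -> (u \in phi) = (v \in phi)) /\
  (forall u v, adj G u v -> f u != f v -> big (f u) -> big (f v) ->
     (u \in phi) != (v \in phi)).

Definition parts (Y : {set V}) := comps G (Y :&: phi) ++ comps G (Y :\: phi).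

Lemma partsP Y X : X \in parts Y -> exists b r,
  let S := [set x in Y | (x \in phi) == b] in r \in S /\ X = (grow G S r).1.
Proof.
rewrite mem_cat => /orP[] XC.
  exists true; have [_ _ H] := comps_correct G (Y :&: phi); have [r rS ->] := H _ XC.
  exists r; have -> : [set x in Y | (x \in phi) == true] = Y :&: phi; last by [].
  by apply/setP=> x; rewrite !inE eqb_id.
exists false; have [_ _ H] := comps_correct G (Y :\: phi); have [r rS ->] := H _ XC.
exists r; have -> : [set x in Y | (x \in phi) == false] = Y :\: phi; last by [].
by apply/setP=> x; rewrite !inE eqbF_neg andbC.
Qed.

Lemma parts_cover Y x : x \in Y -> exists2 X, X \in parts Y & x \in X.
Proof.
move=> xY; case: (boolP (x \in phi)) => xp.
  have [_ H _] := comps_correct G (Y :&: phi); have [|X XC xX] := H x; first by rewrite inE xY.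
  by exists X => //; rewrite mem_cat XC.
have [_ H _] := comps_correct G (Y :\: phi); have [|X XC xX] := H x; first by rewrite inE xY xp.
by exists X => //; rewrite mem_cat XC orbT.
Qed.

Lemma parts_conn Y X : X \in parts Y -> conn G X.
Proof. by case/partsP=> b [r [rS ->]]; exact: conn_grow. Qed.

Lemma parts_sub Y X : X \in parts Y -> X \subset Y.
Proof.
case/partsP=> b [r [rS ->]]; apply: subset_trans (grow_sub G rS) _.
by apply/subsetP=> x; rewrite inE => /andP[].
Qed.

Lemma parts_mono Y X x y : X \in parts Y -> x \in X -> y \in X -> (x \in phi) = (y \in phi).
Proof.
case/partsP=> b [r [rS ->]] /(subsetP (grow_sub G rS)) + /(subsetP (grow_sub G rS)).
by rewrite !inE => /andP[_ /eqP->] /andP[_ /eqP->].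
Qed.

Lemma parts_adj Y X x y : X \in parts Y -> x \in X -> y \in Y -> adj G x y ->
  (x \in phi) = (y \in phi) -> y \in X.
Proof.
move=> XY; case/partsP: (XY) => b [r [rS E]] xX yY xy c.
have xS := subsetP (grow_sub G rS) x; rewrite -E in xS.
rewrite E; apply: (grow_adj rS) xy; first by rewrite -E.
by move: (xS xX); rewrite !inE yY c => /andP[].
Qed.

Lemma parts_eq Y X X' x : X \in parts Y -> X' \in parts Y -> x \in X -> x \in X' -> X = X'.
Proof.
case/partsP=> b [r [rS ->]]; case/partsP=> b' [r' [rS' ->]] xX xX'.
have := subsetP (grow_sub G rS) x xX; have := subsetP (grow_sub G rS') x xX'.
rewrite !inE => /andP[_ /eqP Eb'] /andP[_ /eqP Eb].
have E : b = b' by rewrite -Eb -Eb'.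
by rewrite -E in rS' xX' *; exact: comps_eq xX xX'.
Qed.

Lemma conn_parts Y D X x y : D \subset Y -> conn G D ->
  (forall u v, u \in D -> v \in D -> (u \in phi) = (v \in phi)) ->
  X \in parts Y -> x \in D -> x \in X -> y \in D -> y \in X.
Proof.
move=> DY cD mono XY xD xX yD.
have: (y \in X) && (y \in D).
  have P0 : (x \in X) && (x \in D) by rewrite xX.
  apply: (@connect_ind _ _ (fun z => (z \in X) && (z \in D)) _ _ _ P0 (cD x y xD yD)).
  move=> u v /andP[uX uD] /and3P[_ vD uv]; rewrite vD andbT.
  by apply: (parts_adj XY uX) => //; [exact: (subsetP DY)|exact: mono].
by case/andP.
Qed.

Hypothesis phi_good : good.

(** * Monochromatic components of a block *)

Section Block.
Variable Y : {set V}.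
Hypothesis YB : Y \in blocks G.

Lemma block_shortcut (e : rel V) x y : subrel e (adj G) -> x \in Y -> y \in Y ->
  connect e x y -> connect (within e Y) x y.
Proof. exact: (shortcuts_blocks (@shortcuts_setT _ G) YB). Qed.

Lemma block_uncut w x y : w \in Y -> x \in Y -> y \in Y -> x != w -> y != w ->
  connect (within (adj G) (~: [set w])) x y.
Proof.
move=> wY xY yY xw yw.
have H : uncut G [::] [:: setT] by [].
have := @uncut_blocks _ _ (enum V) _ _ H; rewrite cats0 => /(_ Y w x y YB).
by rewrite mem_enum !inE xw yw xY yY; apply.
Qed.

Lemma fiber_block t : conn G (fiber f t :&: Y).
Proof.
move=> x y /setIP[xt xY] /setIP[yt yY].
have sub : subrel (within (adj G) (fiber f t)) (adj G) by move=> ? ? /and3P[].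
have := block_shortcut sub xY yY (map_conn cf xt yt).
apply: connect_sub => u v /and3P[uY vY /and3P[ut vt uv]].
by apply: connect1; rewrite /within !in_setI uY vY ut vt.
Qed.

Section Part.
Variable X : {set V}.
Hypothesis XP : X \in parts Y.

Lemma fiber_part x y : x \in X -> y \in Y -> f x = f y -> y \in X.
Proof.
move=> xX yY E; have xY := subsetP (parts_sub XP) _ xX.
have xD : x \in fiber f (f x) :&: Y by rewrite !inE eqxx.
have yD : y \in fiber f (f x) :&: Y by rewrite !inE E eqxx.
apply: (conn_parts _ (@fiber_block (f x)) _ XP xD xX yD); first exact: subsetIr.
move=> u v; rewrite !inE => /andP[/eqP uf _] /andP[/eqP vf _].
by apply: phi_good.1; rewrite uf vf.
Qed.

(* Take for [f x0] a big witness set meeting [X], if there is one.  A vertex x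
   of [X] outside it and adjacent to it is a singleton witness set; two
   neighbours of x in [Y] are connected in [Y] without x, so in the tree they
   lie in the same branch at x, that is, in the same witness set. *)
Lemma part_core : exists2 x0, x0 \in X &
  forall x y, x \in X -> f x != f x0 -> y \in Y -> adj G x y -> f y = f x0.
Proof.
have [x0 x0X small] : exists2 x0, x0 \in X & forall x y, x \in X -> y \in X ->
    f x != f x0 -> f y = f x0 -> adj G x y -> ~~ big (f x).
  have [/existsP[x0 /andP[x0X bx0]]|/existsPn no] := boolP [exists x, (x \in X) && big (f x)].
    exists x0 => // x y xX yX nx Ey xy; apply/negP=> bx.
    have := phi_good.2 x y xy; rewrite Ey => /(_ nx bx bx0).
    by rewrite (parts_mono XP xX yX) eqxx.
  have [r [r0 [rS EX]]] := partsP XP.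
  exists r0; first by rewrite EX grow_root.
  move=> x y xX _ _ _ _; apply/negP=> bx.
  by have := no x; rewrite xX bx.
exists x0 => // x y xX nx yY xy.
have sub x1 d y1 : x1 \in X -> d \in X -> f x1 != f x0 -> f d = f x0 -> adj G x1 d ->
    y1 \in Y -> adj G x1 y1 -> f y1 = f x0.
  move=> x1X dX n1 Ed a1 y1Y a2; have sm := not_big (small _ _ x1X dX n1 Ed a1).
  have ny : y1 != x1 by apply: contraTneq a2 => ->; rewrite adj_irr.
  have nd : d != x1 by apply: contraTneq a1 => ->; rewrite adj_irr.
  have single z : z != x1 -> f z <> f x1.
    by move=> zx Ez; have := in_set1 z x1; rewrite -sm inE Ez eqxx (negPf zx).
  rewrite -Ed; apply: (@separation (f x1) y1 d x1 x1); rewrite ?inE ?eqxx //.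
  - by rewrite adj_sym.
  - by rewrite adj_sym.
  - rewrite sm; apply: block_uncut => //; try exact: (subsetP (parts_sub XP)).
  - exact: single.
  exact: single.
(* Propagated from [x0] through the connected set [X]: by [sub], once a vertex outside the core
   fibre has a neighbour of [X] in it, all its neighbours in [Y] are there. So no vertex of [X] is
   more than one step away from the core. *)
pose P z := (f z == f x0) || [exists d in X, (f d == f x0) && adj G z d].
have H : P x.
  have P0 : P x0 by rewrite /P eqxx.
  apply: (@connect_ind _ _ P _ _ _ P0 (parts_conn XP x0X xX)) => u v; rewrite /P => Pu /and3P[uX vX uv].
  case: (eqVneq (f v) (f x0)) => //= nv.
  case: (eqVneq (f u) (f x0)) Pu => [Eu _|nu /= /existsP[d /and3P[dX /eqP Ed ud]]].
    by apply/existsP; exists u; rewrite uX Eu eqxx adj_sym.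
  have Ev := sub u d v uX dX nu Ed ud (subsetP (parts_sub XP) _ vX) uv.
  by rewrite Ev eqxx in nv.
move: H; rewrite /P (negPf nx) /= => /existsP[d /and3P[dX /eqP Ed xd]].
exact: sub nx Ed xd yY xy.
Qed.

Variable cap : nat.
Hypothesis capP : forall t, #|fiber f t| <= cap.

Notation W := (cvc G cap Y X).

Lemma cvc_cover : cover G X (boundary G Y X) W.
Proof. by case: (cvc_correct cap Y (parts_conn XP)). Qed.

(** A vertex of [X] outside the cover is not on the boundary, so its neighbours in [Y] lie in [X],
    and there they must be in the cover. *)
Lemma leaf x y : x \in X -> x \notin W -> y \in Y -> adj G x y -> y \in W.
Proof.
move=> xX xW yY xy; have [BW WX _ iW] := cvc_cover.
have yX : y \in X.
  apply: contraNT xW => yX; apply: (subsetP BW); rewrite in_boundary xX.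
  by apply/meets_nbhP; exists y => //; rewrite inE yX.
by apply: contraLR xy => yW; apply: iW; rewrite inE ?xW ?yW.
Qed.

Lemma border x y : x \in X -> y \in Y -> y \notin X -> adj G x y -> x \in W.
Proof.
move=> xX yY yX xy; have [BW _ _ _] := cvc_cover; apply: (subsetP BW).
by rewrite in_boundary xX; apply/meets_nbhP; exists y => //; rewrite inE yX.
Qed.

(** The trace [D] of the core witness set is a competitor of [cvc], within [cap] as a part of a
    witness set. As [f] is constant on it, [rank f X] is at least [#|D|.-1]. *)
Lemma cvc_rank : #|W|.-1 <= rank f X.
Proof.
have [x0 x0X H] := part_core; pose D := fiber f (f x0) :&: Y.
have DX : D \subset X.
  by apply/subsetP=> y /setIP[]; rewrite inE => /eqP/esym E yY; exact: fiber_part E.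
have inD y : y \in Y -> (y \in D) = (f y == f x0) by move=> yY; rewrite !inE yY andbT.
have XY := parts_sub XP.
have x0D : x0 \in D by rewrite inD ?eqxx // (subsetP XY).
have covD : cover G X (boundary G Y X) D.
  split=> //; last 1 first.
  - move=> u v /setDP[uX uD] /setDP[vX vD]; have uY := subsetP XY _ uX; have vY := subsetP XY _ vX.
    apply/negP=> uv; rewrite inD // in uD; rewrite inD // in vD.
    by have := H u v uX uD vY uv => E; rewrite E eqxx in vD.
  - apply/subsetP=> x; rewrite in_boundary => /andP[xX /meets_nbhP[y /setDP[yY yX] xy]].
    apply: contraNT yX => xD; rewrite inD ?(subsetP XY) // in xD.
    by apply: (subsetP DX); rewrite inD // (H x y).
  exact: fiber_block.
have le : #|W| <= #|D|.
  have [_ opt] := cvc_correct cap Y (parts_conn XP); apply: opt => //.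
    by apply/set0Pn; exists x0.
  by apply: leq_trans (capP (f x0)); apply: subset_leq_card; exact: subsetIl.
have imX : #|f @: X| <= 1 + (#|X| - #|D|).
  apply: (@leq_trans #|f x0 |: f @: (X :\: D)|).
    apply: subset_leq_card; apply/subsetP=> _ /imsetP[x xX ->].
    rewrite in_setU1; case: (eqVneq (f x) (f x0)) => //= nx; apply: imset_f.
    by rewrite inE xX inD ?(subsetP XY) // nx.
  rewrite cardsU1 leq_add ?leq_b1 //; apply: leq_trans (leq_imset_card _ _) _.
  by rewrite cardsD (setIidPr DX).
have := subset_leq_card DX; rewrite /rank; lia.
Qed.

End Part.
End Block.
End Completeness.

(** * Merging overlapping sets *)

Section Classes.
Variables (V : finType) (Ws : seq {set V}).

Definition together : rel V := fun u v => has (fun W : {set V} => (u \in W) && (v \in W)) Ws.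

Lemma together_sym : symmetric together.
Proof. by move=> u v; apply: eq_has => W; rewrite andbC. Qed.

Lemma connect_togetherC : connect_sym together.
Proof. exact: sym_connect_sym together_sym. Qed.

(** Each pass over [Ws] strictly enlarges the set until it contains every member of [Ws] that it
    meets, so [#|V|] passes reach the whole class. *)
Lemma bag_class v : bag Ws v = [set u | connect together v u].
Proof.
pose F (S : {set V}) := foldl (@bag_step V) S Ws.
have sub (S : {set V}) s : S \subset foldl (@bag_step V) S s.
  elim: s S => //= W s IH S; apply: subset_trans (IH _).
  by rewrite /bag_step; case: ifP => // _; exact: subsetUl.
have E : bag Ws v = iter #|V| F [set v] by rewrite /bag foldl_iter -cardE.
pose closed (S : {set V}) := all (fun W : {set V} => meets W S ==> (W \subset S)) Ws.
have cl : closed (bag Ws v).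
  rewrite E; apply: (@iter_saturate _ F closed (fun S : {set V} => #|S|)).
  - by move=> S; exact: max_card.
  - by rewrite cards1.
  - move=> S cS; suff -> : F S = S by [].
    rewrite /F; move: cS; rewrite /closed; elim: Ws => //= W s IH /andP[cW cs].
    rewrite [bag_step S W]/bag_step; case: ifP cW => [mW /= WS|_ _]; last exact: IH.
    by rewrite (setUidPl WS) IH.
  move=> S /allPn[W WWs]; rewrite negb_imply => /andP[m WS].
  apply: proper_card; rewrite properE sub /=; apply/subsetPn.
  have /subsetPn[u uW uS] := WS; exists u => //.
  rewrite /F; case/splitPr: WWs => p1 p2; rewrite foldl_cat /=.
  apply: (subsetP (sub _ p2)); set S1 := foldl _ _ p1.
  have m1 : meets W S1.
    by case/meetsP: m => x xW xS; apply/meetsP; exists x => //; exact: (subsetP (sub S p1)).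
  by rewrite /bag_step m1 inE uW orbT.
apply/setP=> u; rewrite inE; apply/idP/idP; last first.
  apply: connect_ind; last exact: bag_root.
  move=> a b aB /hasP[W WWs /andP[aW bW]]; have /allP/(_ W WWs) := cl.
  by have -> : meets W (bag Ws v); [apply/meetsP; exists a|move/subsetP/(_ b bW)].
have: forall z, z \in [set v] -> connect together v z by move=> z /set1P->; exact: connect0.
rewrite E; elim: #|V| [set v] => [|m IH] S HS; first exact: HS.
rewrite iterSr; apply: IH.
(* The list being folded is generalised to one whose members belong to [Ws], while [together] keeps
   referring to all of [Ws]. *)
have : forall W, W \in Ws -> W \in Ws by [].
rewrite /F; elim: {1 3}Ws S HS => //= W s IH S HS sW z.
apply: IH; last by move=> W' W's; apply: sW; rewrite inE W's orbT.
move=> z'; rewrite /bag_step; case: ifP => [/meetsP[x xW xS]|_]; last exact: HS.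
rewrite inE => /orP[/HS//|z'W]; apply: connect_trans (HS x xS) (connect1 _).
by apply/hasP; exists W; [apply: sW; rewrite mem_head|rewrite xW z'W].
Qed.

(* Merging a set [W] into one class loses at most [#|W| - 1] labels. *)
Lemma label_exists : exists g : V -> V, (forall u v, together u v -> g u = g v) /\
  #|V| <= #|g @: [set: V]| + \sum_(W <- Ws) #|W|.-1.
Proof.
rewrite /together; elim: Ws => [|W s [g [gs gn]]].
  by exists id; split=> //; rewrite big_nil addn0 imset_id cardsT.
have [->|/set0Pn[w wW]] := eqVneq W set0.
  exists g; split; last by rewrite big_cons cards0.
  by move=> u v /=; rewrite !inE; exact: gs.
pose g' v := if g v \in g @: W then g w else g v.
exists g'; split.
  move=> u v /= /orP[/andP[uW vW]|uv]; first by rewrite /g' !imset_f.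
  by rewrite /g' (gs u v).
have sub : g @: [set: V] \subset (g' @: [set: V]) :|: (g @: W :\ g w).
  apply/subsetP=> _ /imsetP[v _ ->]; rewrite !inE.
  case: (boolP (g v \in g @: W)) => gv.
    case: (eqVneq (g v) (g w)) => [E|_]; last by rewrite orbT.
    by rewrite E; apply/orP; left; apply/imsetP; exists w; rewrite ?inE // /g' imset_f.
  by apply/orP; left; apply/imsetP; exists v; rewrite ?inE // /g' (negPf gv).
have := subset_leq_card sub; have := cardsUI (g' @: [set: V]) (g @: W :\ g w).
have := leq_imset_card g W; have := cardsD1 (g w) (g @: W); rewrite imset_f // big_cons.
move: gn; set s1 := \sum_(_ <- _) _; lia.
Qed.

End Classes.

Section Covers.
Variables (V : finType) (G : graph V) (phi : {set V}) (cap : nat).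

Lemma covers_perm : perm_eq (covers G phi cap)
  (flatten [seq [seq cvc G cap U X | X <- parts G phi U] | U <- blocks G]).
Proof.
have Ha U acc Xs : perm_eq (cover_all G cap U acc Xs) ([seq cvc G cap U X | X <- Xs] ++ acc).
  rewrite /cover_all; elim: Xs acc => //= X Xs IH acc; apply: perm_trans (IH _) _.
  by rewrite -cat1s perm_catCA.
suff H s acc : perm_eq (foldl (cover_block G phi cap) acc s)
    (flatten [seq [seq cvc G cap U X | X <- parts G phi U] | U <- s] ++ acc).
  by have := H (blocks G) [::]; rewrite cats0.
elim: s acc => //= U s IH acc; apply: perm_trans (IH _) _.
rewrite -catA perm_sym perm_catCA perm_cat2l perm_sym /cover_block.
apply: perm_trans (Ha _ _ _) _; rewrite /parts map_cat -catA perm_sym perm_catCA perm_cat2l perm_sym.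
exact: Ha.
Qed.

Lemma mem_covers W : W \in covers G phi cap ->
  exists U X, [/\ U \in blocks G, X \in parts G phi U & W = cvc G cap U X].
Proof.
rewrite (perm_mem covers_perm) => /flattenP[s /mapP[U UB ->] /mapP[X XP ->]].
by exists U, X.
Qed.

Lemma covers_mem U X : U \in blocks G -> X \in parts G phi U ->
  cvc G cap U X \in covers G phi cap.
Proof.
move=> UB XP; rewrite (perm_mem covers_perm); apply/flattenP.
by exists [seq cvc G cap U X | X <- parts G phi U]; exact: map_f.
Qed.

End Covers.

(** * The quotient by the merged covers *)

Section Completeness.
Variables (V U : finType) (G : graph V) (T : graph U) (f : V -> U).
Hypotheses (cf : contraction_map G T f) (acT : graph_acyclic T) (conT : graph_connected T).
Variables (phi : {set V}) (cap : nat).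
Hypotheses (phi_good : good G f phi) (capP : forall t, #|fiber f t| <= cap).
Implicit Types (B C D S X W Y : {set V}).

Notation Ws := (covers G phi cap).
Notation E := (connect (together Ws)).
Notation P Y := (parts G phi Y).
Notation Wc Y X := (cvc G cap Y X).

Let class d := [set z | E d z].

Lemma piece_cover_sub Y X : X \in P Y -> Wc Y X \subset X.
Proof. by move=> XP; case: (cvc_cover XP cap). Qed.

Lemma cover_class Y X d : Y \in blocks G -> X \in P Y -> d \in Wc Y X -> Wc Y X \subset class d.
Proof.
move=> YB XP dW; apply/subsetP=> x xW; rewrite inE; apply: connect1.
by apply/hasP; exists (Wc Y X); [exact: covers_mem|rewrite dW xW].
Qed.

(** Covers are connected, so merging is generated by the edges inside them. This makes it a matter
    of a subrelation of adjacency, to which the shortcuts to a block apply. *)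
Let adj_together : rel V := fun u v => adj G u v && together Ws u v.

Lemma connect_adj_together x y : E x y -> connect adj_together x y.
Proof.
apply: connect_sub => u v /hasP[W WWs /andP[uW vW]].
have [Y [X [YB XP EW]]] := mem_covers WWs.
have cW : conn G W by rewrite EW; case: (cvc_cover XP cap).
apply: connect_sub (cW _ _ uW vW) => a b /and3P[aW bW ab]; apply: connect1.
by rewrite /adj_together ab; apply/hasP; exists W; rewrite // aW.
Qed.

Lemma class_conn d : conn G (class d).
Proof.
have H x : x \in class d -> connect (within (adj G) (class d)) d x.
  rewrite inE => /connect_adj_together c.
  pose Q z := (z \in class d) && connect (within (adj G) (class d)) d z.
  suff /andP[] : Q x by [].
  have Q0 : Q d by rewrite /Q inE !connect0.
  apply: (@connect_ind _ _ Q _ _ _ Q0 c) => u v /andP[ud cu] /andP[uv tuv].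
  have vd : v \in class d.
    by move: ud; rewrite !inE => ud; exact: connect_trans ud (connect1 tuv).
  by rewrite /Q vd; apply: connect_trans cu (connect1 _); rewrite /within ud vd uv.
move=> x y /H dx /H dy; rewrite connect_withinC in dx; exact: connect_trans dx dy.
Qed.

Lemma blocks_thin : thin (blocks G).
Proof.
apply: thin_blocks => U1 U2 x y; rewrite !inE => /eqP-> /eqP->. by [].
Qed.

(** The connecting walk may be taken inside [Y] along edges contained in covers. Such an edge
    determines its block, so the cover belongs to [Y]; consecutive covers share a vertex, hence come
    from the same part and coincide. *)
Lemma trace Y x y : Y \in blocks G -> x \in Y -> y \in Y -> E x y ->
  x = y \/ exists X, [/\ X \in P Y, x \in Wc Y X & y \in Wc Y X].
Proof.
move=> YB xY yY /connect_adj_together c.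
have sub : subrel adj_together (adj G) by move=> ? ? /andP[].
have {}c := block_shortcut YB sub xY yY c.
pose Q z := x = z \/ exists X, [/\ X \in P Y, x \in Wc Y X & z \in Wc Y X].
have Q0 : Q x by left.
apply: (@connect_indP _ _ Q _ _ _ Q0 c) => u v Qu /and3P[uY vY /andP[uv /hasP[W WWs /andP[uW vW]]]].
have [Y' [X' [YB' XP' EW]]] := mem_covers WWs.
have WY z : z \in W -> z \in Y'.
  by rewrite EW => /(subsetP (piece_cover_sub XP')) /(subsetP (parts_sub XP')).
have uv_ne : u != v by apply: contraTneq uv => ->; rewrite adj_irr.
have EY : Y' = Y by apply: (blocks_thin YB' YB _ _ _ _ uv_ne); rewrite ?WY.
rewrite EY in XP' EW; right; case: Qu => [<-|[X [XP xW uWX]]] in uW *.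
  by exists X'; rewrite -EW uW vW.
have EX : X' = X.
  apply: (parts_eq XP' XP (x := u)); first by apply: (subsetP (piece_cover_sub XP')); rewrite -EW.
  exact: (subsetP (piece_cover_sub XP)).
by exists X; split=> //; rewrite -EX -EW.
Qed.

(** Let [X] be the part of [d1]. If [d1] is outside its cover, then [d1 = d2] and both [y1] and [y2]
    are in the cover. Otherwise [D] contains the cover, and a vertex of [X] outside [D] is isolated
    in [Y :\: D]. There remains the case of [y1] and [y2] outside [X]: then [d1] and [d2] lie in the
    core fibre, separation in the tree gives [f y1 = f y2], so [y1] and [y2] belong to one part, and
    as border vertices both to its cover. *)
Lemma acyclic_block Y : Y \in blocks G -> quotient_acyclic G E Y.
Proof.
move=> YB d y1 y2 D y1D y2D /meets_nbhP[d1 /setIP[d1D d1Y] a1] /meets_nbhP[d2 /setIP[d2D d2Y] a2] c.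
have [y1Y y1n] : y1 \in Y /\ y1 \notin D by case/setDP: y1D.
have [y2Y y2n] : y2 \in Y /\ y2 \notin D by case/setDP: y2D.
have d12 : E d1 d2.
  move: d1D d2D; rewrite !inE => H1 H2; apply: connect_trans H2.
  by rewrite connect_togetherC.
have [X XP d1X] := parts_cover G phi d1Y.
have clD x : x \in Wc Y X -> x \in D -> Wc Y X \subset D.
  move=> xW; rewrite inE => dx; apply: subset_trans (cover_class YB XP xW) _.
  by apply/subsetP=> z; rewrite !inE; exact: connect_trans.
have eqW z : E d1 z -> z \in Y -> d1 = z \/ d1 \in Wc Y X /\ z \in Wc Y X.
  move=> e zY; case: (trace YB d1Y zY e) => [->|[X' [XP' H1 H2]]]; first by left.
  have EX : X' = X by apply: (parts_eq XP' XP _ d1X); exact: (subsetP (piece_cover_sub XP')).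
  by right; rewrite -EX.
have inE' x y X' : X' \in P Y -> x \in Wc Y X' -> y \in Wc Y X' -> E x y.
  by move=> XP' xW yW; have := subsetP (cover_class YB XP' xW) y yW; rewrite inE.
have [d1W|d1W] := boolP (d1 \in Wc Y X); last first.
  have Ed : d1 = d2 by case: (eqW d2 d12 d2Y) => // -[H _]; rewrite H in d1W.
  have y1W := leaf XP d1X d1W y1Y; rewrite adj_sym in y1W.
  have y2W := leaf XP d1X d1W y2Y; rewrite adj_sym Ed in y2W.
  exact: inE' XP (y1W a1) (y2W a2).
have WD : Wc Y X \subset D := clD d1 d1W d1D.
have d2W : d2 \in Wc Y X by case: (eqW d2 d12 d2Y) => [<-|[]].
have d2X := subsetP (piece_cover_sub XP) _ d2W.
have alone x z : x \in X -> x \notin D -> connect (within (adj G) (Y :\: D)) x z -> x = z.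
  move=> xX xD cxz; pose Q u := x = u.
  have Q0 : Q x by [].
  apply: (@connect_indP _ _ Q _ _ _ Q0 cxz) => u v <- /and3P[_ /setDP[vY vD] xv].
  have xW : x \notin Wc Y X by apply: contra xD => /(subsetP WD).
  by case/negP: vD; apply: (subsetP WD); exact: (leaf XP xX xW vY xv).
have [y1X|y1X] := boolP (y1 \in X).
  by rewrite (alone y1 y2 y1X y1n c); exact: connect0.
have [y2X|y2X] := boolP (y2 \in X).
  by rewrite connect_withinC in c; rewrite (alone y2 y1 y2X y2n c); exact: connect0.
have [x0 x0X core] := part_core cf acT phi_good YB XP.
have coreW d0 y : d0 \in X -> y \in Y -> y \notin X -> adj G y d0 -> d0 \in fiber f (f x0).
  move=> dX yY yX yd; rewrite inE; apply: contraNT yX => nd.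
  rewrite adj_sym in yd; have /esym Ey := core d0 y dX nd yY yd.
  exact: (fiber_part cf phi_good YB XP x0X yY Ey).
have notF y : y \in Y -> y \notin X -> f y <> f x0.
  move=> yY yX Ey; case/negP: yX.
  exact: (fiber_part cf phi_good YB XP x0X yY (esym Ey)).
have fE : f y1 = f y2.
  apply: (separation cf acT (coreW d1 y1 d1X y1Y y1X a1) (coreW d2 y2 d2X y2Y y2X a2)) => //; last 2 first.
  - exact: notF.
  - exact: notF.
  pose Q z := [&& z \in Y, z \notin X & connect (within (adj G) (~: fiber f (f x0))) y1 z].
  have Q0 : Q y1 by rewrite /Q y1Y y1X connect0.
  suff /and3P[] : Q y2 by [].
  apply: (@connect_ind _ _ Q _ _ _ Q0 c) => u v /and3P[uY uX cu] /and3P[_ /setDP[vY vD] uv].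
  have vX : v \notin X.
    apply: contra vD => vX; apply: (subsetP WD); apply: (border XP cap vX uY uX).
    by rewrite adj_sym.
  rewrite /Q vY vX; apply: connect_trans cu (connect1 _).
  by rewrite /within !inE uv andbT; apply/andP; split; apply/eqP; exact: notF.
have [X1 XP1 y1X1] := parts_cover G phi y1Y.
have y2X1 : y2 \in X1 := fiber_part cf phi_good YB XP1 y1X1 y2Y fE.
apply: (inE' _ _ X1) => //.
  apply: (border XP1 cap y1X1 d1Y _ a1); apply: contra y1X => d1X1.
  by rewrite (parts_eq XP XP1 d1X d1X1).
apply: (border XP1 cap y2X1 d2Y _ a2); apply: contra y1X => d2X1.
by rewrite (parts_eq XP XP1 d2X d2X1).
Qed.

Lemma acyclic_graph : quotient_acyclic G E setT.
Proof.
apply: (quotient_acyclic_blocks (vs := enum V) (Us := [:: setT])).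
- exact: class_conn.
- exact: shortcuts_setT.
- exact: acyclic_block.
by rewrite mem_head.
Qed.

Lemma covers_rank : \sum_(W <- Ws) #|W|.-1 <= #|V| - #|U|.
Proof.
rewrite (perm_big _ (covers_perm G phi cap)) big_flatten big_map /=.
have <- : rank f setT = #|V| - #|U| by rewrite /rank cardsT (card_fibers (map_onto cf)).
apply: leq_trans (_ : \sum_(Y <- blocks G) rank f Y <= _); last first.
  by apply: leq_trans (rank_blocks G f (enum V) [:: setT]) _; rewrite big_seq1.
rewrite !big_seq; apply: leq_sum => Y YB; rewrite big_map.
apply: leq_trans (_ : \sum_(X <- P Y) rank f X <= _).
  by rewrite !big_seq; apply: leq_sum => X XP; exact: (cvc_rank cf acT phi_good YB XP capP).
rewrite /parts big_cat /=; apply: leq_trans (leq_add (rank_comps _ _ _) (rank_comps _ _ _)) _.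
have : #|f @: Y| <= #|f @: (Y :&: phi)| + #|f @: (Y :\: phi)|.
  rewrite -{1}(setID Y phi) imsetU cardsU; exact: leq_subr.
have := leq_imset_card f (Y :&: phi); have := leq_imset_card f (Y :\: phi).
rewrite /rank -(cardsID phi Y); lia.
Qed.

Record run_inv (r : V) (l : seq V) (a : ({set V} * seq {set V}) * bool) : Prop := RunInv {
  run_ok : a.2;
  run_cover : r |: [set x in l] \subset a.1.1;
  run_conn : conn G a.1.1;
  run_mem : forall v, (v \in a.1.1) = has (fun B => v \in B) a.1.2;
  run_class : forall B v, B \in a.1.2 -> v \in B -> B = class v;
  run_uniq : uniq a.1.2 }.

Lemma classE u v : E u v -> class u = class v.
Proof.
move=> e; apply/setP=> z; rewrite !inE; apply/idP/idP; last exact: connect_trans.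
by apply: connect_trans; rewrite connect_togetherC.
Qed.

Lemma mem_class u : u \in class u.
Proof. by rewrite inE connect0. Qed.

Lemma grow_class u : (grow G (class u) u).1 == class u.
Proof. by apply/eqP; apply: grow_conn; [exact: mem_class|exact: class_conn]. Qed.

Lemma run_start r : run_inv r [::]
  ((bag Ws r, [:: bag Ws r]), (grow G (bag Ws r) r).1 == bag Ws r).
Proof.
rewrite bag_class -/(class r); split=> //=.
- exact: grow_class.
- by rewrite set_nil setU0 sub1set mem_class.
- exact: class_conn.
- by move=> v; rewrite orbF.
by move=> B v; rewrite inE => /eqP->; rewrite inE => /classE.
Qed.

(** The class of [u] is adjacent to the class of the neighbour [y] found earlier. The earlier
    classes form a connected set outside the class of [u], so by acyclicity any other earlier
    neighbour lies in the class of [y]. *)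
Lemma run_step r u l a : search_order G r (u :: l) -> run_inv r l a ->
  run_inv r (u :: l) (add_bag G Ws u a).
Proof.
case=> ul [y yl uy] so [ok cov cn mem cls un]; rewrite /add_bag; case: ifPn => ua.
  split=> //; rewrite set_cons setUCA subUset sub1set ua; exact: cov.
rewrite bag_class -/(class u); set D := class u.
have ya : y \in a.1.1 := subsetP cov _ yl.
have dis v : v \in a.1.1 -> v \notin D.
  move=> va; apply: contra ua; rewrite inE => e; have := va; rewrite !mem.
  case/hasP=> B Ba vB; apply/hasP; exists B => //.
  by rewrite (cls B v) // inE connect_togetherC.
have := ya; rewrite mem => /hasP[B0 B0a yB0].
have nb1 : nb_bags G D a.1.2 = 1.
  rewrite /nb_bags -[1](_ : count_mem B0 a.1.2 = _); last by rewrite count_uniq_mem // B0a.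
  apply: eq_in_count => B Ba /=; apply/idP/eqP => [/meets_nbsP[d2 [y2 [d2D y2B dy2]]]|->]; last first.
    by apply/meets_nbsP; exists u, y; rewrite mem_class.
  have y2a : y2 \in a.1.1 by rewrite mem; apply/hasP; exists B.
  rewrite (cls B y2) // (cls B0 y) //; symmetry; apply: classE.
  apply: (acyclic_graph (d := u)); rewrite -/(class u) -/D.
  - by rewrite in_setD dis ?in_setT.
  - by rewrite in_setD dis ?in_setT.
  - by apply/meets_nbhP; exists u; rewrite ?in_setI ?mem_class // ?inE // adj_sym.
  - by apply/meets_nbhP; exists d2; rewrite ?in_setI ?d2D // ?inE // adj_sym.
  apply: connect_within_sub (cn _ _ ya y2a) => //.
  by apply/subsetP=> z za; rewrite in_setD dis ?in_setT.
have uD : u \in D := mem_class u.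
split=> /=.
- rewrite ok nb1 eqxx grow_class !andbT /=; apply/negP=> /meetsP[z zD /dis].
  by rewrite zD.
- rewrite set_cons setUCA subUset sub1set inE uD orbT /=; apply: subset_trans cov _.
  exact: subsetUl.
- have cD : conn G (u |: a.1.1).
    have H z : z \in u |: a.1.1 -> connect (within (adj G) (u |: a.1.1)) y z.
      case/setU1P=> [->|za].
        by apply: connect1; rewrite /within !inE eqxx ya adj_sym uy orbT.
      by apply: connect_within_sub (cn _ _ ya za); rewrite ?subsetUr.
    by move=> z z' /H cz /H; apply: connect_trans; rewrite connect_withinC.
  have -> : a.1.1 :|: D = (u |: a.1.1) :|: D.
    by rewrite [u |: _]setUC -setUA (setUidPr (_ : [set u] \subset D)) // sub1set.
  by apply: (conn_setU (r := u)) => //; [exact: setU11|exact: class_conn].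
- by move=> v; rewrite inE mem orbC.
- by move=> B v; rewrite inE => /orP[/eqP->|/cls H /H//]; rewrite inE => /classE.
by rewrite un andbT; apply: contra ua => Da; rewrite mem; apply/hasP; exists D.
Qed.

Lemma try_complete k : #|V| - #|U| <= k -> 0 < #|V| -> try G k cap phi != None.
Proof.
move=> Uk V0; rewrite /try /verify; case EV: (enum V) => [|v0 s].
  by rewrite cardE EV in V0.
rewrite /bags; have [_ Eg _ so] := @grow_correct V G setT v0 (in_setT v0).
have [_ full _ _] := @grow_correct V G setT v0 (in_setT v0).
set a0 := (_, _); set l := (grow G setT v0).2 in so Eg *.
have : run_inv v0 l (foldr (add_bag G Ws) a0 l).
  move: so; elim: l {Eg full} => [|u l IH] so /=; first exact: run_start.
  by apply: run_step => //; apply: IH; case: so.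
set a := foldr _ _ _; case=> ok cov cn mem cls un.
have aT : a.1.1 = setT.
  apply/eqP; rewrite -subTset; apply: subset_trans cov; rewrite -Eg.
  by rewrite (grow_conn (in_setT v0) (graph_conn cf conT)).
(* [g] is constant on classes, so there are at least as many bags as labels, and thus at least
   [#|V|] minus the total loss of the covers. *)
have [g [gW gn]] := label_exists Ws.
have gE u v : E u v -> g u = g v.
  move=> e; pose Q z := g u = g z; have Q0 : Q u by [].
  by apply: (@connect_indP _ _ Q _ _ _ Q0 e) => x y Qx xy; rewrite /Q Qx; exact: gW.
have le : #|g @: [set: V]| <= size a.1.2.
  pose h B := if [pick v in B] is Some v then g v else v0.
  rewrite -(size_map h); apply: leq_trans (card_size _); apply: subset_leq_card.
  apply/subsetP=> _ /imsetP[v _ ->]; have : v \in a.1.1 by rewrite aT inE.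
  rewrite mem => /hasP[B Ba vB]; apply/mapP; exists B => //.
  rewrite /h; case: pickP => [w wB|/(_ v)]; last by rewrite vB.
  by apply: gE; have := vB; rewrite (cls B w Ba wB) inE connect_togetherC.
rewrite ok aT eqxx /= -[X in X <= _]/(#|V|).
have -> : #|V| <= size a.1.2 + k by have := covers_rank; lia.
by [].
Qed.

End Completeness.

(** A connected set is coloured and enlarged vertex by vertex; by separation a new vertex has only
    one neighbour in it and takes the opposite colour. *)
Lemma tree_bipartite (U : finType) (T : graph U) : is_tree T ->
  exists c : U -> bool, forall s t, adj T s t -> c s != c t.
Proof.
case=> U0 conT acT.
have conTT : conn T setT.
  move=> s t _ _; apply: connect_sub (conT s t) => x y xy.
  by apply: connect1; rewrite /within !inE.
suff H m : m < #|U| -> exists (S : {set U}) (c : U -> bool), [/\ #|S| = m.+1, conn T S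
    & forall s t, s \in S -> t \in S -> adj T s t -> c s != c t].
  have [|S [c [cS _ Hc]]] := H #|U|.-1; first by rewrite prednK.
  have ES : S = setT by apply/eqP; rewrite eqEcard subsetT cardsT cS prednK //=.
  by exists c => s t; apply: Hc; rewrite ES inE.
elim: m => [_|m IH lt].
  have /card_gt0P[r _] := U0; exists [set r], (fun=> true); split; rewrite ?cards1 //.
    by move=> s t /set1P-> /set1P->; exact: connect0.
  by move=> s t /set1P-> /set1P->; rewrite adj_irr.
have [S [c [cS cn Hc]]] := IH (ltnW lt).
have /card_gt0P[r rS] : 0 < #|S| by rewrite cS.
have [z zS] : exists z, z \notin S.
  apply/existsP; apply: contraLR lt => /existsPn H; rewrite -leqNgt -cardsT -cS.
  by apply: subset_leq_card; apply/subsetP=> z _; have := H z; rewrite negbK.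
have [u [w [uS _ wS uw]]] := conn_exit conTT (subsetT S) rS (in_setT z) zS.
have uniq_nb y : y \in S -> adj T w y -> y = u.
  move=> yS wy; apply: (tree_separation acT wy); first by rewrite adj_sym.
  apply: connect_within_sub (cn _ _ yS uS) => //.
  by apply/subsetP=> x xS; rewrite !inE; apply: contraNneq wS => <-.
exists (w |: S), (fun x => if x == w then ~~ c u else c x); split.
- by rewrite cardsU1 wS cS.
- have H x : x \in w |: S -> connect (within (adj T) (w |: S)) u x.
    case/setU1P=> [->|xS].
      by apply: connect1; rewrite /within !inE eqxx uS uw orbT.
    by apply: connect_within_sub (cn _ _ uS xS); rewrite ?subsetUr.
  by move=> x y /H ux /H; apply: connect_trans; rewrite connect_withinC.
move=> s t /setU1P[->|sS] /setU1P[->|tS]; rewrite ?eqxx.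
- by rewrite adj_irr.
- move/(uniq_nb _ tS)->; have /negPf-> : u != w by apply: contraNneq wS => <-.
  by case: (c u).
- rewrite adj_sym => /(uniq_nb _ sS)->; have /negPf-> : u != w by apply: contraNneq wS => <-.
  by case: (c u).
have /negPf-> : s != w by apply: contraNneq wS => <-.
have /negPf-> : t != w by apply: contraNneq wS => <-.
exact: Hc.
Qed.

(** * Counting good colourings *)

Section GoodColourings.
Variables (V U : finType) (G : graph V) (T : graph U) (f : V -> U).
Hypotheses (cf : contraction_map G T f) (tT : is_tree T).

Definition bigs : {set U} := [set t | big f t].

Let C := [set v | big f (f v)].

Lemma sum_fibers : #|V| = \sum_t #|fiber f t|.
Proof.
rewrite -sum1_card (partition_big f xpredT) //=; apply: eq_bigr => t _.
by rewrite -sum1_card; apply: eq_bigl => v; rewrite inE.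
Qed.

Lemma fiber_gt0 t : 0 < #|fiber f t|.
Proof.
by have [v <-] := map_onto cf t; apply/card_gt0P; exists v; rewrite inE.
Qed.

Lemma sum_excess : \sum_t #|fiber f t|.-1 = #|V| - #|U|.
Proof.
rewrite sum_fibers -sum1_card -sumnB => [|t _]; last exact: fiber_gt0.
by apply: eq_bigr => t _; rewrite subn1.
Qed.

Lemma card_C : #|C| = (#|V| - #|U|) + #|bigs|.
Proof.
rewrite -sum_excess -!sum1_card (partition_big f (mem bigs)) /=; last by move=> v; rewrite !inE.
rewrite [\sum_t #|fiber f t|.-1](bigID (mem bigs)) /= [\sum_(t | t \notin _) _]big1 => [|t]; last first.
  by rewrite inE /big -leqNgt => H; case: #|_| H => [|[]].
rewrite addn0 -big_split /=; apply: eq_bigr => t; rewrite inE => bt.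
rewrite addn1 prednK; last exact: fiber_gt0.
rewrite -sum1_card; apply: eq_bigl => v; rewrite !inE; case: eqP => [->|]; rewrite ?bt ?andbF //.
Qed.

Lemma bigs_le : #|bigs| <= #|V| - #|U|.
Proof.
rewrite -sum_excess -sum1_card [X in _ <= X](bigID (mem bigs)) /=.
apply: leq_trans (leq_addr _ _); apply: leq_sum => t; rewrite inE /big.
by case: #|_| => [|[]].
Qed.

(** Every other big witness set accounts for at least one contraction. A big set is thus left with
    at most [j - (b - 1)] of them, for [j] contractions and [b] big sets, and has one vertex more.
    For a singleton, [b <= j] suffices. *)
Lemma fiber_le t : #|fiber f t| <= (#|V| - #|U|).+2 - #|bigs|.
Proof.
have bl := bigs_le; have [bt|] := boolP (big f t); last by rewrite /big -leqNgt; lia.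
have H : #|fiber f t|.-1 + #|bigs :\ t| <= #|V| - #|U|.
  rewrite -sum_excess (bigD1 t) //= leq_add2l -sum1_card.
  rewrite [X in _ <= X](bigID (mem (bigs :\ t))) /=; apply: leq_trans (leq_addr _ _).
  rewrite [X in _ <= X](eq_bigl (mem (bigs :\ t))); last first.
    by move=> s; rewrite !inE; case: (s != t).
  by apply: leq_sum => s; rewrite !inE /big => /andP[_]; case: #|_| => [|[]].
have := cardsD1 t bigs; rewrite inE bt; have := fiber_gt0 t; lia.
Qed.

(** On the vertices of big witness sets the colours are prescribed by a 2-colouring of the tree; the
    colours of all others are free, and [B] ranges over the choices for them. *)
Lemma good_colourings : exists F : {set {set V}},
  (forall phi, phi \in F -> good G f phi) /\
  2 ^ (#|V| - ((#|V| - #|U|) + #|bigs|)) <= #|F|.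
Proof.
have [c Hc] := tree_bipartite tT; pose A := [set v in C | c (f v)].
exists [set phi : {set V} | [forall v in C, (v \in phi) == c (f v)]]; split.
  move=> phi; rewrite inE => /forall_inP H.
  have col v : big f (f v) -> (v \in phi) = c (f v) by move=> b; apply/eqP/H; rewrite inE.
  split.
    move=> u v E; have [b|nb] := boolP (big f (f u)); first by rewrite !col -?E.
    suff -> : v = u by [].
    by apply/set1P; rewrite -(not_big nb) inE E.
  move=> u v uv ne bu bv; rewrite !col //; apply: Hc; exact: (map_adj cf).
rewrite -card_C -(cardsC C) addKn -card_powerset.
pose g (B : {set V}) := B :|: A.
have gI : {in powerset (~: C) &, injective g}.
  move=> B1 B2; rewrite !inE => /subsetP H1 /subsetP H2 E; apply/setP=> v.
  have := congr1 (fun S : {set V} => v \in S) E; rewrite !inE; case: (boolP (big f (f v))) => bv; last by rewrite /= !orbF.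
  move=> _; apply/idP/idP => [/H1|/H2]; by rewrite !inE bv.
rewrite -(card_in_imset gI); apply: subset_leq_card; apply/subsetP=> _ /imsetP[B + ->].
rewrite !inE => /subsetP H; apply/forall_inP=> v vC; rewrite !inE in vC *.
have -> : (v \in B) = false by apply/negP=> /H; rewrite !inE vC.
by rewrite vC.
Qed.

End GoodColourings.

(** * Repetitions and phases *)

Section Phases.
Variables (n : nat) (G : graph 'I_n).

Lemma search_some k cap reps bits Ws : search G k cap reps bits = Some Ws ->
  exists phi, try G k cap phi = Some Ws.
Proof.
suff fold_some s a : (a.2 = Some Ws -> exists phi, try G k cap phi = Some Ws) ->
    (foldl (search_step G k cap) a s).2 = Some Ws -> exists phi, try G k cap phi = Some Ws.
  exact: fold_some.
elim: s a => [|? s IH] a H /=; [exact: H|]; apply: IH; case: a H => b [W|] //= _ E.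
by exists (colouring n b).
Qed.

Lemma phases_some k bits Ws : phases G k bits = Some Ws ->
  exists cap phi, try G k cap phi = Some Ws.
Proof.
suff fold_some s a : (a.2 = Some Ws -> exists cap phi, try G k cap phi = Some Ws) ->
    (foldl (phase_step G k bits) a s).2 = Some Ws -> exists cap phi, try G k cap phi = Some Ws.
  exact: fold_some.
elim: s a => [|? s IH] a H /=; [exact: H|]; apply: IH; case: a H => b [W|] //= _ /search_some[phi E].
by exists b.1, phi.
Qed.

Lemma foldl_keep (A B C : Type) (F : A * option B -> C -> A * option B) s a :
  (forall a x, isSome a.2 -> (F a x).2 = a.2) -> isSome a.2 -> isSome (foldl F a s).2.
Proof. by move=> H; elim: s a => [|x s IH] a Ha //=; apply: IH; rewrite H. Qed.

Lemma search_step_keep k cap a x : isSome a.2 -> (search_step G k cap a x).2 = a.2.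
Proof. by case: a => b []. Qed.

Lemma phase_step_keep k bits a x : isSome a.2 -> (phase_step G k bits a x).2 = a.2.
Proof. by case: a => b []. Qed.

Lemma search_found k cap reps bits i : i < reps ->
  try G k cap (colouring n (drop (i * n) bits)) -> search G k cap reps bits.
Proof.
rewrite /search => lt.
have step m a : (foldl (search_step G k cap) a (nseq m tt)).1 = drop (m * n) a.1.
  elim: m a => [|m IH] a /=; first by rewrite drop0.
  by rewrite IH /= drop_drop mulSn addnC.
rewrite (_ : reps = i + (reps - i.+1).+1); last by lia.
rewrite nseqD.
have := step i (bits, None); rewrite foldl_cat; case: foldl => b o /= -> H.
apply: foldl_keep; first exact: search_step_keep.
by case: o.
Qed.

Lemma phases_found k b bits : b <= k ->
  search G k (k.+2 - b) (2 ^ (k + b)) bits -> phases G k bits.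
Proof.
rewrite /phases => bk.
have step m a : (foldl (phase_step G k bits) a (nseq m tt)).1 = (a.1.1 - m, 2 ^ m * a.1.2).
  elim: m a => [|m IH] a /=; first by rewrite subn0 mul1n -surjective_pairing.
  rewrite IH /=; congr pair; first by rewrite -subn1 -subnDA add1n.
  by rewrite expnS addnn -mul2n mulnA [2 ^ _ * 2]mulnC.
rewrite [X in nseq X](_ : k.+1 = b + (k - b).+1); last by lia.
rewrite nseqD.
have := step b ((k.+2, 2 ^ k), None); rewrite foldl_cat.
case: foldl => c o /= ->; rewrite -expnD [b + k]addnC => H.
apply: foldl_keep; first exact: phase_step_keep.
by case: o.
Qed.

End Phases.

(** * Counting tapes *)

Definition tapes L (P : pred (seq bool)) := #|[set r : L.-tuple bool | P r]|.

(** Independence of disjoint segments of the tape, in counting form. *)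
Lemma tapes_cat a b (P Q : pred (seq bool)) :
  tapes (a + b) (fun s => P (take a s) && Q (drop a s)) = tapes a P * tapes b Q.
Proof.
rewrite /tapes -cardsX.
pose h (x : a.-tuple bool * b.-tuple bool) : (a + b).-tuple bool := cat_tuple x.1 x.2.
have hI : injective h.
  move=> [x1 x2] [y1 y2] /(f_equal val) /= /eqP.
  rewrite eqseq_cat ?size_tuple // => /andP[/eqP E1 /eqP E2].
  by congr pair; apply/val_inj.
rewrite -(card_imset _ hI); apply: eq_card => r; rewrite !inE.
apply/andP/imsetP => [[Pr Qr]|[[x1 x2]]].
  have s1 : size (take a r) == a by rewrite size_takel ?size_tuple ?leq_addr.
  have s2 : size (drop a r) == b by rewrite size_drop size_tuple addKn.
  exists (Tuple s1, Tuple s2); first by rewrite !inE Pr.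
  by apply/val_inj; rewrite /= cat_take_drop.
rewrite !inE /= => /andP[P1 P2] -> /=.
by rewrite take_size_cat ?drop_size_cat ?size_tuple.
Qed.

Lemma tapes_eq L (P Q : pred (seq bool)) : (forall s, size s = L -> P s = Q s) ->
  tapes L P = tapes L Q.
Proof. by move=> H; apply: eq_card => r; rewrite !inE H ?size_tuple. Qed.

Lemma tapes_all L : tapes L xpredT = 2 ^ L.
Proof.
by rewrite /tapes -card_bool -card_tuple; apply: eq_card => r; rewrite !inE.
Qed.

Lemma tapesC L (P : pred (seq bool)) : tapes L P + tapes L (fun s => ~~ P s) = 2 ^ L.
Proof.
rewrite -tapes_all /tapes -(cardsID [set r : L.-tuple bool | P r] [set r : L.-tuple bool | xpredT (val r)]).
by congr (_ + _); apply: eq_card => r; rewrite !inE ?andbT.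
Qed.

Lemma tapes_colouring n (F : {set {set 'I_n}}) :
  tapes n (fun s => colouring n s \in F) = #|F|.
Proof.
pose h (r : n.-tuple bool) := colouring n r.
have hI : injective h.
  move=> x y E; apply: eq_from_tnth => i; have := congr1 (fun S : {set 'I_n} => i \in S) E.
  by rewrite !inE !(tnth_nth false).
pose h' (A : {set 'I_n}) : n.-tuple bool := [tuple i \in A | i < n].
have hK A : h (h' A) = A.
  by apply/setP=> i; rewrite inE -tnth_nth tnth_mktuple.
rewrite /tapes -(card_imset _ hI); apply: eq_card => A.
apply/imsetP/idP => [[r + ->]|AF]; first by rewrite inE.
by exists (h' A); rewrite ?inE -?/(h _) ?hK.
Qed.

Definition all_bad n (F : {set {set 'I_n}}) M (s : seq bool) :=
  all (fun i => colouring n (drop (i * n) s) \notin F) (iota 0 M).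

Lemma colouring_take n m s : n <= m -> colouring n (take m s) = colouring n s.
Proof. by move=> nm; apply/setP=> v; rewrite !inE nth_take // (leq_trans (ltn_ord v)). Qed.

Lemma tapes_bad n (F : {set {set 'I_n}}) M q :
  tapes (M * n + q) (all_bad F M) = (2 ^ n - #|F|) ^ M * 2 ^ q.
Proof.
elim: M => [|M IH]; first by rewrite mul1n -tapes_all.
rewrite mulSn -addnA expnS -mulnA -IH -(tapes_colouring F) -(tapesC n (fun s => colouring n s \in F)) addKn.
rewrite -tapes_cat; apply: tapes_eq => s _; rewrite /all_bad /= mul0n drop0 colouring_take //.
congr (_ && _); rewrite (iotaDl 1 0) all_map; apply: eq_all => i /=.
by rewrite drop_drop add1n mulSn addnC.
Qed.

Lemma phases_sound n (G : graph 'I_n) k s Ws : phases G (minn k n) s = Some Ws ->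
  exists H : graph 'I_(size Ws), [/\ is_tree H, k_contractible k G H
    & witness_structure G H (fun t => nth set0 Ws t)].
Proof.
case/phases_some=> cap [phi] /verify_sound[H [tH [j jk cj] wH]].
by exists H; split=> //; exists j => //; apply: leq_trans jk (geq_minl _ _).
Qed.

(** The phase used is the one for the number [b] of big sets of some contraction, and [M] is its
    number of repetitions; [2 ^ n <= M * #|F|] says that [M] times the success probability of one
    colouring is at least one. *)
Lemma phases_complete n (G : graph 'I_n) k : k_contractible_to_tree k G ->
  exists (F : {set {set 'I_n}}) M, [/\ 2 ^ n <= M * #|F|, 0 < M, M <= 4 ^ minn k n
    & forall s, ~~ all_bad F M s -> phases G (minn k n) s].
Proof.
case=> U [T [tT [j jk /contracts_in_map[f cf]]]]; rewrite card_ord => Ej.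
have [U0 conT acT] := tT; have [F [HF cF]] := good_colourings cf tT.
have EU : #|'I_n| - #|U| = j by rewrite card_ord Ej addKn.
have bl := bigs_le cf; have fl := fiber_le cf; move: bl fl cF; rewrite EU card_ord => bl fl cF.
(* There cannot be more than [n] contractions, so replacing [k] by the minimum loses nothing. *)
have jk' : j <= minn k n by rewrite leq_min jk Ej leq_addl.
set k' := minn k n in jk' *; set b := #|bigs f| in bl fl cF.
have bk : b <= k' by apply: leq_trans jk'.
exists F, (2 ^ (k' + b)); split.
- apply: leq_trans (leq_mul (leqnn _) cF); rewrite -expnD leq_exp2l //; lia.
- by rewrite expn_gt0.
- by rewrite -[4]/(2 ^ 2) -expnM leq_exp2l //; lia.
move=> s /allPn[i]; rewrite mem_iota add0n /= => lt; rewrite negbK => /HF gd.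
apply: (phases_found bk); apply: search_found lt _.
have H t : #|fiber f t| <= k'.+2 - b by apply: leq_trans (fl t) _; rewrite leq_sub2r.
have le : #|'I_n| - #|U| <= k' by rewrite EU.
have n0 : 0 < #|'I_n| by rewrite card_ord Ej addn_gt0 U0.
by move: (try_complete cf acT conT gd H le n0); case: try.
Qed.

Lemma all_bad_take n (F : {set {set 'I_n}}) M N s : M * n <= N ->
  all_bad F M (take N s) = all_bad F M s.
Proof.
move=> MN; apply: eq_in_all => i; rewrite mem_iota add0n /= => iM.
have le : i * n + n <= N by apply: leq_trans MN; rewrite addnC -mulSn leq_mul2r iM orbT.
by rewrite -[N](subnK (leq_trans (leq_addr _ _) le)) -take_drop colouring_take //; lia.
Qed.

Lemma failures_le n (G : graph 'I_n) k L : k_contractible_to_tree k G ->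
  n * 4 ^ minn k n <= L ->
  exists F M, [/\ F <= 2 ^ n, 2 ^ n <= M * F, 0 < M, M * n <= L
    & #|[set r : L.-tuple bool | ~~ phases G (minn k n) (take (n * 4 ^ minn k n) r)]|
      <= (2 ^ n - F) ^ M * 2 ^ (L - M * n)].
Proof.
move=> /phases_complete[F [M [MF M0 M4 found]]] NL.
have MN : M * n <= n * 4 ^ minn k n by rewrite mulnC leq_mul2l M4 orbT.
have ML := leq_trans MN NL.
exists #|F|, M; split=> //.
  have := max_card F; rewrite -cardsT -powersetT card_powerset cardsT card_ord.
  by [].
rewrite -tapes_bad subnKC //; apply: subset_leq_card; apply/subsetP=> r; rewrite !inE.
by apply: contraNT; rewrite -(all_bad_take F r MN) => /found.
Qed.

(** * The success probability *)

Local Open Scope ring_scope.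

(** The inequality [1 - x <= expR (- x)], raised to the power [M]. *)
Lemma one_minus_pow_le (R : realType) (x : R) M : 0 <= x -> x <= 1 -> 1 <= M%:R * x ->
  (1 - x) ^+ M <= (expR 1)^-1.
Proof.
move=> x0 x1 Mx; rewrite -expRN.
apply: le_trans (_ : expR (- x) ^+ M <= _).
  by apply: lerXn2r; rewrite ?nnegrE ?subr_ge0 ?expR_ge0 ?expR_ge1Dx.
by rewrite -expRM_natl ler_expR mulrN lerN2.
Qed.

Lemma success_probability (R : realType) n (G : graph 'I_n) k L :
  k_contractible_to_tree k G -> (n * 4 ^ minn k n <= L)%N ->
  1 - (expR 1)^-1 <=
    #|[set r : L.-tuple bool | phases G (minn k n) (take (n * 4 ^ minn k n) r) != None]|%:R
      / 2%:R ^+ L :> R.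
Proof.
move=> kG NL; have [F [M [F2 MF M0 ML le]]] := failures_le kG NL.
set S := [set r | _]; set B := [set r | _] in le.
have cSB : (#|S| + #|B| = 2 ^ L)%N.
  rewrite -card_bool -card_tuple -(cardC (mem S)); congr (_ + _)%N.
  by apply: eq_card => r; rewrite !inE; case: phases.
have P0 m : (0 : R) < 2%:R ^+ m by rewrite exprn_gt0 // ltr0n.
have E2 m : ((2 ^ m)%N)%:R = 2%:R ^+ m :> R by rewrite natrX.
have -> : #|S|%:R / 2%:R ^+ L = 1 - #|B|%:R / 2%:R ^+ L :> R.
  have -> : #|S|%:R = 2%:R ^+ L - #|B|%:R :> R by rewrite -E2 -cSB natrD addrK.
  by rewrite mulrBl divff // gt_eqF.
rewrite lerD2l lerN2; pose x : R := F%:R / 2%:R ^+ n.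
apply: le_trans (_ : (1 - x) ^+ M <= _); last first.
  apply: one_minus_pow_le.
  - by rewrite divr_ge0 // ltW.
  - by rewrite ler_pdivrMr // mul1r -E2 ler_nat.
  - by rewrite mulrA ler_pdivlMr // mul1r -E2 -natrM ler_nat.
rewrite ler_pdivrMr //.
have -> : 1 - x = (2%:R ^+ n - F%:R) / 2%:R ^+ n by rewrite mulrBl divff // gt_eqF.
rewrite expr_div_n -mulrA.
have -> : 2%:R ^+ L = 2%:R ^+ n ^+ M * 2%:R ^+ (L - M * n) :> R.
  by rewrite -exprM mulnC -exprD subnKC.
rewrite mulKf; last by rewrite expf_neq0 // gt_eqF.
by rewrite -!E2 -natrB // -natrX -natrM ler_nat.
Qed.

Theorem theorem6 (R : realType) :
  exists (p : program) (T : nat -> nat -> nat) (c : nat),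
    (forall n k : nat,
        (T n k)%:R <= c%:R * (488%:R / 100%:R) ^+ k * n.+1%:R ^+ c :> R) /\
    (forall (n : nat) (G : graph 'I_n) (k : nat),
      exists out : (T n k).-tuple bool -> option (seq {set 'I_n}),
        [/\ (forall r : (T n k).-tuple bool,
               runs_within p (T n k) r (instance_data G k) (answer_data (out r))),
            (~ k_contractible_to_tree k G -> forall r, out r = None),
            (k_contractible_to_tree k G ->
               1 - (expR 1)^-1 <=
                 #|[set r | out r != None]|%:R / 2%:R ^+ T n k :> R)
          & (forall r (Ws : seq {set 'I_n}), out r = Some Ws ->
               exists H : graph 'I_(size Ws),
                 [/\ is_tree H, k_contractible k G H
                   & witness_structure G H (fun t => nth set0 Ws t)])]).
Proof.
have [t pt run] := the_program_correct.
have [c tc] := polynomial_add pt polynomial_id.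
(* [T] bounds the time and is also the length of the tape; the summand [n] makes room for the
   [n * 4 ^ minn k n] bits that are tossed. *)
exists the_program, (fun n k => 4 ^ minn k n * (t n + n))%N, c; split=> [n k|n G k].
  rewrite natrM natrX [X in _ <= X]mulrAC [X in _ <= X]mulrC.
  apply: ler_pM; [exact: exprn_ge0|exact: ler0n| |by rewrite -natrX -natrM ler_nat].
  apply: (@le_trans _ _ (4%:R ^+ k)).
    by apply: ler_weXn2l; rewrite ?ler1n ?geq_minl.
  by apply: lerXn2r; rewrite ?nnegrE; lra.
have NL : (n * 4 ^ minn k n <= 4 ^ minn k n * (t n + n))%N.
  by rewrite mulnC leq_mul2l leq_addl orbT.
exists (fun r => phases G (minn k n) (take (n * 4 ^ minn k n) r)); split.
- move=> r; have [|s' [u [le ev]]] := run n G k r; first by rewrite size_tuple.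
  by exists s', u; split=> //; apply: leq_trans le _; rewrite leq_mul2l leq_addr orbT.
- move=> nk r; case E: phases => [Ws|] //; case: nk.
  by have [H [tH kH _]] := phases_sound E; exists _, H.
- by move=> kG; exact: success_probability.
by move=> r Ws; exact: phases_sound.
Qed.
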